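(* The following hold for the class $\mathcal{S}^*_e$ (with $e$ Euler's number): (i) $R_{\mathcal{S}_e^*}(\mathcal{T}_1)= \dfrac{-2+7e-\sqrt{4+4e+17e^2}}{8e}$ $(\approx0.237983)$; (ii) $R_{\mathcal{S}_e^*}(\mathcal{T}_2)=\dfrac{-1+3e-\sqrt{1-2e+5e^2}}{2e}$ $(\approx 0.267302)$; (iii) $R_{\mathcal{S}_e^*}(\mathcal{T}_3)=\sqrt{\dfrac{1-2e+e^2}{-1+2e+8e^2}}$ $(\approx 0.215546)$.
   Context: Let $\mathbb{D}=\{z\in\mathbb{C}:|z|<1\}$ and let $\mathcal{A}$ be the class of analytic functions $f:\mathbb{D}\to\mathbb{C}$ with $f(0)=0$, $f'(0)=1$. For analytic $f,g$ on $\mathbb{D}$, $f\prec g$ ($f$ is subordinate to $g$) means $f=g\circ w$ for some analytic $w:\mathbb{D}\to\mathbb{D}$ with $w(0)=0$. Square roots are principal branches, and quotients such as $f/g$, $g/(zp)$, $zf'/f$ are understood with removable singularities at $0$ filled in. Define $\mathcal{T}_1$: all $f\in\mathcal{A}$ such that $f/g\prec e^z$ and $g/(zp)\prec e^z$ for some $g\in\mathcal{A}$ and some $p\prec\sqrt{1+z}$; $\mathcal{T}_2$: all $f\in\mathcal{A}$ such that $f/g\prec \sqrt{1+z}$ and $g/(zp)\prec \sqrt{1+z}$ for some $g\in\mathcal{A}$ and some $p\prec e^z$; $\mathcal{T}_3$: all $f\in\mathcal{A}$ such that $f/g\prec z+\sqrt{1+z^2}$ and $g/(zp)\prec z+\sqrt{1+z^2}$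 for some $g\in\mathcal{A}$ and some $p\prec z+\sqrt{1+z^2}$. $\mathcal{S}^*_e$ is the class of $f\in\mathcal{A}$ with $zf'(z)/f(z)\prec e^z$, equivalently $|\log (zf'(z)/f(z))|<1$ in $\mathbb{D}$. For classes $\mathcal{G},\mathcal{M}\subset\mathcal{A}$, the $\mathcal{G}$-radius $R_{\mathcal{G}}(\mathcal{M})$ is $\inf\{\rho_f: f\in\mathcal{M}\}$, where $\rho_f$ is the largest number in $(0,1]$ such that for every $0<r\le\rho_f$ the function $f$ has the property defining $\mathcal{G}$ in the disk $|z|<r$, i.e. $z\mapsto f(rz)/r$ belongs to $\mathcal{G}$. *)

(* Defs.v *)
From Stdlib Require Import Reals Lra.
From Coquelicot Require Import Coquelicot.

Open Scope R_scope.

(* Functions on the unit disk are represented by total functions C -> C;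
   every notion below depends only on their values on the open unit disk. *)
Definition in_disk (z : C) : Prop := Cmod z < 1.

Definition analytic_on_disk (f : C -> C) : Prop :=
  forall z : C, in_disk z ->
    @ex_derive C_AbsRing C_NormedModule f z.

Definition Cexp (z : C) : C :=
  (exp (Re z) * cos (Im z), exp (Re z) * sin (Im z)).

(* Principal branch: from (a + i b)^2 = x + i y one gets a^2 = (|z| + x) / 2,
   b^2 = (|z| - x) / 2 and 2 a b = y; the root with a > 0, or a = 0 and b >= 0,
   is chosen. *)
Definition Csqrt (z : C) : C :=
  (sqrt ((Cmod z + Re z) / 2),
   if Rle_dec 0 (Im z) then sqrt ((Cmod z - Re z) / 2)
   else - sqrt ((Cmod z - Re z) / 2)).

Lemma Csqrt_sqr (z : C) : (Csqrt z * Csqrt z)%C = z.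
Proof.
destruct z as [x y].
set (m := Cmod (x, y)).
assert (Hm : m * m = x * x + y * y).
{ unfold m, Cmod; simpl. rewrite sqrt_sqrt; nra. }
assert (Hm0 : 0 <= m) by apply Cmod_ge_0.
assert (Hx : - m <= x <= m) by (split; nra).
assert (Hp : 0 <= (m + x) / 2) by lra.
assert (Hn : 0 <= (m - x) / 2) by lra.
assert (Hpn : 2 * (sqrt ((m + x) / 2) * sqrt ((m - x) / 2)) = Rabs y).
{ rewrite <- sqrt_mult by assumption.
  replace ((m + x) / 2 * ((m - x) / 2)) with (Rsqr (y / 2))
    by (unfold Rsqr; nra).
  rewrite sqrt_Rsqr_abs. unfold Rdiv. rewrite Rabs_mult.
  rewrite (Rabs_pos_eq (/ 2)); lra. }
pose proof (sqrt_sqrt _ Hp) as Ep.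
pose proof (sqrt_sqrt _ Hn) as En.
unfold Csqrt, Cmult; cbn [Re Im fst snd]; fold m.
destruct (Rle_dec 0 y) as [Hy | Hy].
- rewrite Rabs_pos_eq in Hpn by assumption. f_equal; nra.
- rewrite Rabs_left in Hpn by lra. f_equal; nra.
Qed.

Definition subordinate (f g : C -> C) : Prop :=
  analytic_on_disk f /\ analytic_on_disk g /\
  exists w : C -> C,
    analytic_on_disk w /\
    (forall z : C, in_disk z -> in_disk (w z)) /\
    w (RtoC 0) = RtoC 0 /\
    (forall z : C, in_disk z -> f z = g (w z)).

(* Subordination of a quotient q with its removable singularity at 0 filled in:
   the analytic (hence unique) extension h of q to the whole disk is
   subordinate to g.  In all uses below g has no zero in the disk, while the
   total division of C gives x / 0 = 0, so that a zero of the denominator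
   other than 0 is excluded. *)
Definition subordinate_filled (q g : C -> C) : Prop :=
  exists h : C -> C,
    (forall z : C, in_disk z -> z <> RtoC 0 -> h z = q z) /\
    subordinate h g.

Definition class_A (f : C -> C) : Prop :=
  analytic_on_disk f /\ f (RtoC 0) = RtoC 0 /\
  @is_derive C_AbsRing C_NormedModule f (RtoC 0) (RtoC 1).

Definition class_T (phi psi : C -> C) (f : C -> C) : Prop :=
  class_A f /\
  exists g p : C -> C,
    class_A g /\ subordinate p psi /\
    subordinate_filled (fun z => (f z / g z)%C) phi /\
    subordinate_filled (fun z => (g z / (z * p z))%C) phi.

Definition sqrt_one_plus (z : C) : C := Csqrt (1 + z)%C.

Definition crescent (z : C) : C := (z + Csqrt (1 + z * z))%C.

Definition class_T1 : (C -> C) -> Prop := class_T Cexp sqrt_one_plus.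
Definition class_T2 : (C -> C) -> Prop := class_T sqrt_one_plus Cexp.
Definition class_T3 : (C -> C) -> Prop := class_T crescent crescent.

Definition class_S_e (f : C -> C) : Prop :=
  class_A f /\
  subordinate_filled (fun z => (z * C_derive f z / f z)%C) Cexp.

Definition dilation (r : R) (f : C -> C) (z : C) : C :=
  (f (RtoC r * z) / RtoC r)%C.

Definition holds_up_to (G : (C -> C) -> Prop) (f : C -> C) (rho : R) : Prop :=
  0 < rho <= 1 /\ forall r : R, 0 < r <= rho -> G (dilation r f).

Definition is_radius_of (G : (C -> C) -> Prop) (f : C -> C) (rho : R) : Prop :=
  holds_up_to G f rho /\
  forall rho' : R, holds_up_to G f rho' -> rho' <= rho.

(* The first clause says that the radius of every member of M exists, without
   which the infimum in the second clause would silently skip that member. *)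
Definition is_class_radius (G M : (C -> C) -> Prop) (R0 : R) : Prop :=
  (forall f : C -> C, M f -> exists rho : R, is_radius_of G f rho) /\
  is_glb_Rbar
    (fun rho : R => exists f : C -> C, M f /\ is_radius_of G f rho)
    (Finite R0).

(* Main.v *)
Require Import Defs.
From Stdlib Require Import Reals Lra Psatz Classical ClassicalEpsilon.
From Coquelicot Require Import Coquelicot.
Open Scope R_scope.

(** Write [f = z F] with [F = p h1 h2]. Then [z f'/f = 1 + z p'/p + z h1'/h1 + z h2'/h2],
    and each summand is [z w' psi'(w) / psi(w)] for a Schwarz function [w]. The
    Schwarz-Pick lemma applied to [w z / z] gives
    [|z w' - w| <= (r^2 - |w|^2) / (1 - r^2)] at [|z| = r], hence the summands are
    bounded by [r] for [e^z] and by [r / (2 (1 - r))] for [sqrt (1 + z)]; for the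
    crescent they can leave the disk of radius [r / sqrt (1 + r^2)], but for
    [c >= 1/6] they stay in the larger disk with center [c] touching it at its
    leftmost point. The sum therefore lies in the disk [|q - cosh 1| < sinh 1],
    which touches the boundary of [exp D] at [1/e] and is contained in [exp D],
    as long as [r] is less than the claimed radius; [z psi(z) phi(z)^2] takes the
    boundary value [1/e] at minus the radius. Functions are only assumed complex
    differentiable at each point, so the analyticity of [w'] and of [w z / z] is
    derived from Goursat's lemma and Cauchy's formula. *)

(** * Complex differentiation *)

(** The claimed radii solve [d0 + d1 + d2 = 1 - 1/e], where [-d_i] is the value at [z = -r] of the
    i-th logarithmic derivative [z psi'/psi], so every summand must be estimated sharply there.
    Bounding [|w'|] by Schwarz-Pick and [psi'/psi] by its own maximum is too weak: for [e^z] it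
    gives [r / (1 - r^2)] instead of [r]. The bound on [z w' - w] ties [w'] to [w] and loses nothing
    for [w = z]. The obstacle is the crescent: for [w = z] and [z = i r] its summand has modulus
    [r / sqrt (1 - r^2)], more than at [z = -r], so disks centered at 0 do not work. But only the
    leftmost points matter for sharpness: three disks with center [c] and leftmost points [-d_i],
    added to 1, give the disk with center [1 + 3 c] and leftmost point [1 - d0 - d1 - d2]. Taking
    [1 + 3 c = cosh 1] aims at the disk with diameter from [1/e] to [e], and then [c] is about
    0.181, just above 1/6. *)

Notation is_cderive := (@is_derive C_AbsRing C_NormedModule).
Notation is_path_derive := (@is_derive R_AbsRing C_R_NormedModule).

Lemma is_cderive_eps (f : C -> C) (z l : C) :
  is_cderive f z l <->
  forall eps, 0 < eps -> exists d, 0 < d /\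
    forall z', Cmod (z' - z) < d ->
      Cmod (f z' - f z - l * (z' - z)) <= eps * Cmod (z' - z).
Proof.
split.
- intros [_ H] eps Heps.
  destruct (H z (fun P HP => HP) (mkposreal eps Heps)) as [d Hd].
  exists d; split; [apply cond_pos|].
  intros z' Hz'. specialize (Hd z' Hz').
  replace (l * (z' - z))%C with ((z' - z) * l)%C by ring.
  exact Hd.
- intros H; split.
  + apply is_linear_scal_l.
  + intros z0 Hz0 [eps Heps].
    apply (is_filter_lim_locally_unique (V := AbsRing_NormedModule C_AbsRing)) in Hz0.
    subst z0.
    destruct (H eps Heps) as [d [Hd0 Hd]].
    exists (mkposreal d Hd0). intros z' Hz'.
    specialize (Hd z' Hz').
    replace (l * (z' - z))%C with ((z' - z) * l)%C in Hd by ring.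
    exact Hd.
Qed.

Lemma is_path_derive_eps (g : R -> C) (t : R) (v : C) :
  is_path_derive g t v <->
  forall eps, 0 < eps -> exists d, 0 < d /\
    forall s, Rabs (s - t) < d ->
      Cmod (g s - g t - v * RtoC (s - t)) <= eps * Rabs (s - t).
Proof.
assert (E : forall s, Cmod (g s - g t - v * RtoC (s - t)) =
  @norm R_AbsRing C_R_NormedModule
   (minus (minus (g s) (g t)) (scal (minus s t) v))).
{ intros s. rewrite Cmod_norm. f_equal. rewrite scal_R_Cmult.
  rewrite Cmult_comm. reflexivity. }
split.
- intros [_ H] eps Heps.
  destruct (H t (fun P HP => HP) (mkposreal eps Heps)) as [d Hd].
  exists d; split; [apply cond_pos|].
  intros s Hs. rewrite E. exact (Hd s Hs).
- intros H; split.
  + apply is_linear_scal_l.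
  + intros z0 Hz0 [eps Heps].
    apply (is_filter_lim_locally_unique (V := AbsRing_NormedModule R_AbsRing)) in Hz0.
    subst z0.
    destruct (H eps Heps) as [d [Hd0 Hd]].
    exists (mkposreal d Hd0). intros z' Hz'.
    specialize (Hd z' Hz'). rewrite E in Hd. exact Hd.
Qed.

Lemma continuous_C_eps (f : C -> C) (z : C) :
  continuous f z <->
  forall eps, 0 < eps -> exists d, 0 < d /\
    forall z', Cmod (z' - z) < d -> Cmod (f z' - f z) < eps.
Proof.
split.
- intros H eps Heps.
  assert (L : locally (f z) (fun y => Cmod (y - f z) < eps)).
  { apply locally_C. exists (mkposreal eps Heps). intros y Hy; exact Hy. }
  specialize (H _ L). apply locally_C in H. destruct H as [d Hd].
  exists d; split; [apply cond_pos|]. exact Hd.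
- intros H P HP. apply locally_C in HP. destruct HP as [[eps Heps] HP].
  destruct (H eps Heps) as [d [Hd0 Hd]].
  apply locally_C. exists (mkposreal d Hd0). intros z' Hz'.
  apply HP, Hd, Hz'.
Qed.

Lemma continuous_path_eps (g : R -> C) (t : R) :
  continuous g t <->
  forall eps, 0 < eps -> exists d, 0 < d /\
    forall s, Rabs (s - t) < d -> Cmod (g s - g t) < eps.
Proof.
split.
- intros H eps Heps.
  assert (L : locally (g t) (fun y => Cmod (y - g t) < eps)).
  { apply locally_C. exists (mkposreal eps Heps). intros y Hy; exact Hy. }
  destruct (H _ L) as [d Hd].
  exists d; split; [apply cond_pos|]. exact Hd.
- intros H P HP. apply locally_C in HP. destruct HP as [[eps Heps] HP].
  destruct (H eps Heps) as [d [Hd0 Hd]].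
  exists (mkposreal d Hd0). intros z' Hz'.
  apply HP, Hd, Hz'.
Qed.

(** The product and chain rules speak of [C_AbsRing] as a module over itself. The two structures
    differ in their uniform space, while the derivative sees the target only through its operations
    and its norm. *)
Lemma is_cderive_AbsRing (f : C -> C) (z l : C) :
  is_cderive f z l <->
  @is_derive C_AbsRing (AbsRing_NormedModule C_AbsRing) f z l.
Proof.
split; intros [_ H]; split; try apply is_linear_scal_l; exact H.
Qed.

Lemma is_cderive_continuous (f : C -> C) (z l : C) :
  is_cderive f z l -> continuous f z.
Proof.
intros H P HP. apply locally_C.
exact (ex_derive_continuous (V := C_NormedModule) f z (ex_intro _ l H) P HP).
Qed.

Lemma is_cderive_plus (f g : C -> C) (z a b : C) :
  is_cderive f z a -> is_cderive g z b ->
  is_cderive (fun x => (f x + g x)%C) z (a + b)%C.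
Proof. exact (is_derive_plus f g z a b). Qed.

Lemma is_cderive_minus (f g : C -> C) (z a b : C) :
  is_cderive f z a -> is_cderive g z b ->
  is_cderive (fun x => (f x - g x)%C) z (a - b)%C.
Proof. exact (is_derive_minus f g z a b). Qed.

Lemma is_cderive_mult (f g : C -> C) (z a b : C) :
  is_cderive f z a -> is_cderive g z b ->
  is_cderive (fun x => (f x * g x)%C) z (a * g z + f z * b)%C.
Proof.
rewrite !is_cderive_AbsRing. intros Hf Hg.
exact (is_derive_mult (K := C_AbsRing) f g z a b Hf Hg Cmult_comm).
Qed.

Lemma is_cderive_comp (f g : C -> C) (z a b : C) :
  is_cderive f (g z) a -> is_cderive g z b ->
  is_cderive (fun x => f (g x)) z (a * b)%C.
Proof.
rewrite (is_cderive_AbsRing g), Cmult_comm. intros Hf Hg.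
exact (is_derive_comp (K := C_AbsRing) (V := C_NormedModule) f g z a b Hf Hg).
Qed.

Lemma is_cderive_const (c z : C) : is_cderive (fun _ => c) z (RtoC 0).
Proof. exact (is_derive_const c z). Qed.

Lemma is_cderive_id (z : C) : is_cderive (fun x => x) z (RtoC 1).
Proof. apply is_cderive_AbsRing. exact (is_derive_id (K := C_AbsRing) z). Qed.

Lemma is_cderive_ext_loc (f g : C -> C) (z l : C) (d : R) : 0 < d ->
  (forall x, Cmod (x - z) < d -> f x = g x) ->
  is_cderive f z l -> is_cderive g z l.
Proof.
intros Hd He. apply is_derive_ext_loc.
exists (mkposreal d Hd). intros x Hx. apply He. exact Hx.
Qed.

Lemma is_cderive_eq (f : C -> C) (z l l' : C) :
  is_cderive f z l -> l = l' -> is_cderive f z l'.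
Proof. intros H <-; exact H. Qed.

Lemma C_neq_0_of_close (a b : C) : Cmod (a - b) < Cmod b -> a <> RtoC 0.
Proof.
intros H ->. replace (0 - b)%C with (- b)%C in H by ring.
rewrite Cmod_opp in H. lra.
Qed.

Lemma Cmod_triangle_minus (a b : C) : Cmod (a - b) <= Cmod a + Cmod b.
Proof.
unfold Cminus. rewrite <- (Cmod_opp b). apply Cmod_triangle.
Qed.

Lemma Cmod_triangle_rev (a b : C) : Cmod a - Cmod b <= Cmod (a - b).
Proof.
generalize (Cmod_triangle (a - b) b).
replace (a - b + b)%C with a by ring. lra.
Qed.

Lemma Cmod_minus_sym (a b : C) : Cmod (a - b) = Cmod (b - a).
Proof. rewrite <- Cmod_opp. f_equal. ring. Qed.

(** Serves [Clog] and [Csqrt], for which continuity and the identity [f (g x) = x] are the easy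
    facts. *)
Lemma is_cderive_inverse (f g : C -> C) (z l : C) (d : R) :
  0 < d -> (forall x, Cmod (x - z) < d -> f (g x) = x) ->
  continuous g z -> is_cderive f (g z) l -> l <> RtoC 0 ->
  is_cderive g z (/ l)%C.
Proof.
intros Hd Hinv Hg Hf Hl.
apply is_cderive_eps. intros eps Heps.
rewrite is_cderive_eps in Hf. rewrite continuous_C_eps in Hg.
assert (Hl0 : 0 < Cmod l) by (apply Cmod_gt_0; exact Hl).
(* For [k = g x - g z] and [h = x - z] one will have [|h - l k| <= e |k|]. The first bound on [e]
   yields [|l| |k| <= 2 |h|]; with it the second yields [e |k| / |l| <= eps |h|]. *)
set (e := Rmin (Cmod l / 2) (eps * (Cmod l * Cmod l) / 2)).
assert (He : 0 < e).
{ apply Rmin_pos; [lra|]. assert (0 < eps * (Cmod l * Cmod l)) by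
   (apply Rmult_lt_0_compat; nra). lra. }
assert (He1 : e <= Cmod l / 2) by apply Rmin_l.
assert (He2 : e <= eps * (Cmod l * Cmod l) / 2) by apply Rmin_r.
destruct (Hf e He) as [d1 [Hd1 H1]].
destruct (Hg d1 Hd1) as [d2 [Hd2 H2]].
exists (Rmin d d2). split; [apply Rmin_pos; lra|].
intros x Hx.
assert (Hx1 : Cmod (x - z) < d) by (generalize (Rmin_l d d2); lra).
assert (Hx2 : Cmod (x - z) < d2) by (generalize (Rmin_r d d2); lra).
specialize (H1 _ (H2 _ Hx2)).
rewrite (Hinv x Hx1), (Hinv z) in H1
  by (replace (z - z)%C with (RtoC 0) by ring; rewrite Cmod_0; lra).
set (k := (g x - g z)%C) in *.
set (h := (x - z)%C) in *.
assert (Hk : Cmod l * Cmod k <= 2 * Cmod h).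
{ generalize (Cmod_triangle_rev (l * k) h). rewrite Cmod_mult.
  rewrite Cmod_minus_sym in H1. pose proof (Cmod_ge_0 k). nra. }
replace (k - / l * h)%C with (- (/ l * (h - l * k)))%C by (field; exact Hl).
rewrite Cmod_opp, Cmod_mult, Cmod_inv by exact Hl.
apply Rmult_le_reg_l with (Cmod l); [exact Hl0|].
rewrite <- Rmult_assoc, Rinv_r, Rmult_1_l by lra.
apply Rle_trans with (1 := H1).
pose proof (Cmod_ge_0 k). pose proof (Cmod_ge_0 h).
apply Rmult_le_reg_l with (Cmod l); [exact Hl0|].
replace (Cmod l * (e * Cmod k)) with (e * (Cmod l * Cmod k)) by ring.
apply Rle_trans with (e * (2 * Cmod h)); [apply Rmult_le_compat_l; lra|].
replace (Cmod l * (Cmod l * (eps * Cmod h))) with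
  (eps * (Cmod l * Cmod l) / 2 * (2 * Cmod h)) by field.
apply Rmult_le_compat_r; lra.
Qed.

Lemma is_cderive_inv (z : C) : z <> RtoC 0 ->
  is_cderive Cinv z (- / (z * z))%C.
Proof.
intros Hz. apply is_cderive_eps. intros eps Heps.
assert (Hm : 0 < Cmod z) by (apply Cmod_gt_0; exact Hz).
set (m := Cmod z) in *.
exists (Rmin (m / 2) (eps * (m * m * m) / 2)). split.
{ apply Rmin_pos; [lra|]. assert (0 < eps * (m * m * m)) by
   (repeat apply Rmult_lt_0_compat; lra). lra. }
intros x Hx.
set (h := (x - z)%C) in *.
assert (Hx1 : Cmod h < m / 2) by (eapply Rlt_le_trans; [exact Hx | apply Rmin_l]).
assert (Hx2 : Cmod h < eps * (m * m * m) / 2)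
  by (eapply Rlt_le_trans; [exact Hx | apply Rmin_r]).
assert (Hxm : m / 2 <= Cmod x).
{ generalize (Cmod_triangle_rev z x). rewrite Cmod_minus_sym. fold h m. lra. }
assert (Hx0 : x <> RtoC 0) by (apply Cmod_gt_0; lra).
replace (/ x - / z - - / (z * z) * h)%C with (h * h / (x * (z * z)))%C
  by (unfold h; field; split; assumption).
assert (Hzz : (z * z)%C <> RtoC 0) by (apply Cmult_neq_0; assumption).
rewrite Cmod_div by (apply Cmult_neq_0; assumption).
rewrite !Cmod_mult. fold m.
assert (0 < Cmod x * (m * m)) by (apply Rmult_lt_0_compat; nra).
apply Rmult_le_reg_r with (Cmod x * (m * m)); [assumption|].
unfold Rdiv. rewrite Rmult_assoc, Rinv_l, Rmult_1_r by lra.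
replace (eps * Cmod h * (Cmod x * (m * m))) with
  (Cmod h * (eps * (Cmod x * (m * m)))) by ring.
apply Rmult_le_compat_l; [apply Cmod_ge_0|].
apply Rle_trans with (eps * (m * m * m) / 2); [lra|].
replace (eps * (m * m * m) / 2) with (eps * (m / 2 * (m * m))) by field.
apply Rmult_le_compat_l; [lra|]. apply Rmult_le_compat_r; nra.
Qed.

Lemma is_cderive_div (f g : C -> C) (z a b : C) : g z <> RtoC 0 ->
  is_cderive f z a -> is_cderive g z b ->
  is_cderive (fun x => (f x / g x)%C) z ((a * g z - f z * b) / (g z * g z))%C.
Proof.
intros Hg Ha Hb.
eapply is_cderive_eq.
- apply is_cderive_mult; [exact Ha|].
  exact (is_cderive_comp Cinv g z _ _ (is_cderive_inv _ Hg) Hb).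
- cbv beta. field. exact Hg.
Qed.

Lemma is_path_derive_comp (f : C -> C) (g : R -> C) (t : R) (l v : C) :
  is_cderive f (g t) l -> is_path_derive g t v ->
  is_path_derive (fun s => f (g s)) t (l * v)%C.
Proof.
rewrite is_cderive_eps, !is_path_derive_eps. intros Hf Hg eps Heps.
pose proof (Cmod_ge_0 l) as Hl. pose proof (Cmod_ge_0 v) as Hv.
set (e1 := eps / (2 * (Cmod v + 1))).
assert (He1 : 0 < e1) by (apply Rdiv_lt_0_compat; lra).
destruct (Hf e1 He1) as [d1 [Hd1 H1]].
set (e2 := Rmin 1 (eps / (2 * (Cmod l + 1)))).
assert (He2 : 0 < e2) by (apply Rmin_pos; [|apply Rdiv_lt_0_compat]; lra).
destruct (Hg e2 He2) as [d2 [Hd2 H2]].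
exists (Rmin d2 (d1 / (Cmod v + 1))). split.
{ apply Rmin_pos; [|apply Rdiv_lt_0_compat]; lra. }
intros s Hs.
assert (Hs2 : Rabs (s - t) < d2)
  by (eapply Rlt_le_trans; [exact Hs | apply Rmin_l]).
assert (Hs1 : Rabs (s - t) < d1 / (Cmod v + 1))
  by (eapply Rlt_le_trans; [exact Hs | apply Rmin_r]).
specialize (H2 s Hs2).
assert (Hst := Rabs_pos (s - t)).
assert (Hk : Cmod (g s - g t) <= (Cmod v + 1) * Rabs (s - t)).
{ generalize (Cmod_triangle_rev (g s - g t) (v * RtoC (s - t))).
  rewrite Cmod_mult, Cmod_R. assert (e2 <= 1) by apply Rmin_l. nra. }
assert (Hk1 : Cmod (g s - g t) < d1).
{ eapply Rle_lt_trans; [exact Hk|].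
  apply Rmult_lt_reg_r with (/ (Cmod v + 1)); [apply Rinv_0_lt_compat; lra|].
  replace ((Cmod v + 1) * Rabs (s - t) * / (Cmod v + 1)) with (Rabs (s - t))
    by (field; lra). exact Hs1. }
specialize (H1 _ Hk1).
replace (f (g s) - f (g t) - l * v * RtoC (s - t))%C with
 ((f (g s) - f (g t) - l * (g s - g t)) + l * (g s - g t - v * RtoC (s - t)))%C
 by ring.
eapply Rle_trans; [apply Cmod_triangle|]. rewrite Cmod_mult.
assert (A1 : Cmod (f (g s) - f (g t) - l * (g s - g t)) <= eps / 2 * Rabs (s - t)).
{ eapply Rle_trans; [exact H1|].
  apply Rle_trans with (e1 * ((Cmod v + 1) * Rabs (s - t))).
  - apply Rmult_le_compat_l; lra.
  - right. unfold e1. field. lra. }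
assert (A2 : Cmod l * Cmod (g s - g t - v * RtoC (s - t)) <= eps / 2 * Rabs (s - t)).
{ apply Rle_trans with ((Cmod l + 1) * (eps / (2 * (Cmod l + 1)) * Rabs (s - t))).
  - apply Rmult_le_compat; [lra|apply Cmod_ge_0|lra|].
    eapply Rle_trans; [exact H2|]. apply Rmult_le_compat_r; [lra|apply Rmin_r].
  - right. field. lra. }
lra.
Qed.

Lemma Cmod_le_abs_sum (a b : R) : Cmod (a, b) <= Rabs a + Rabs b.
Proof.
replace (a, b) with (RtoC a + Ci * RtoC b)%C
  by (unfold Cplus, Cmult, Ci, RtoC; simpl; f_equal; ring).
eapply Rle_trans; [apply Cmod_triangle|].
rewrite Cmod_mult, Cmod_Ci, !Cmod_R. lra.
Qed.

Lemma is_derive_eps (u : R -> R) (t a : R) : is_derive u t a ->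
  forall eps, 0 < eps -> exists d, 0 < d /\
    forall s, Rabs (s - t) < d ->
      Rabs (u s - u t - a * (s - t)) <= eps * Rabs (s - t).
Proof.
intros [_ H] eps Heps.
destruct (H t (fun P HP => HP) (mkposreal eps Heps)) as [d Hd].
exists d; split; [apply cond_pos|].
intros s Hs. specialize (Hd s Hs). rewrite (Rmult_comm a). exact Hd.
Qed.

Lemma is_path_derive_pair (u v : R -> R) (t a b : R) :
  is_derive u t a -> is_derive v t b ->
  is_path_derive (fun s => (u s, v s)) t (a, b).
Proof.
intros Hu Hv. apply is_path_derive_eps. intros eps Heps.
assert (He : 0 < eps / 2) by lra.
destruct (is_derive_eps _ _ _ Hu _ He) as [d1 [Hd1 H1]].
destruct (is_derive_eps _ _ _ Hv _ He) as [d2 [Hd2 H2]].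
exists (Rmin d1 d2). split; [apply Rmin_pos; lra|].
intros s Hs.
specialize (H1 s (Rlt_le_trans _ _ _ Hs (Rmin_l _ _))).
specialize (H2 s (Rlt_le_trans _ _ _ Hs (Rmin_r _ _))).
replace ((u s, v s) - (u t, v t) - (a, b) * RtoC (s - t))%C with
  ((u s - u t - a * (s - t), v s - v t - b * (s - t)) : C)
  by (unfold Cminus, Cplus, Cmult, Copp, RtoC; simpl; f_equal; ring).
eapply Rle_trans; [apply Cmod_le_abs_sum|]. lra.
Qed.

(** * Exponential, logarithm and square root *)

Lemma Cexp_plus (a b : C) : Cexp (a + b) = (Cexp a * Cexp b)%C.
Proof.
unfold Cexp. rewrite re_plus, im_plus, exp_plus, cos_plus, sin_plus.
unfold Cmult; simpl. f_equal; ring.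
Qed.

Lemma Cexp_0 : Cexp (RtoC 0) = RtoC 1.
Proof.
unfold Cexp, RtoC; simpl. rewrite exp_0, cos_0, sin_0. f_equal; ring.
Qed.

Lemma Cmod_Cexp (z : C) : Cmod (Cexp z) = exp (Re z).
Proof.
unfold Cexp, Cmod; simpl.
replace _ with (sqrt (exp (Re z) * exp (Re z))).
- apply sqrt_square. left; apply exp_pos.
- f_equal. generalize (sin2_cos2 (Im z)). unfold Rsqr. intros H.
  transitivity (exp (Re z) * exp (Re z) * (sin (Im z) * sin (Im z) + cos (Im z) * cos (Im z)));
  [rewrite H|]; ring.
Qed.

Lemma Cexp_neq_0 (z : C) : Cexp z <> RtoC 0.
Proof. apply Cmod_gt_0. rewrite Cmod_Cexp. apply exp_pos. Qed.

(** The remainder splits into remainders of the real [exp], [cos] and [sin] at 0. The addition law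
    carries the result to every other point. *)
Lemma is_cderive_Cexp_0 : is_cderive Cexp (RtoC 0) (RtoC 1).
Proof.
apply is_cderive_eps. intros eps Heps.
(* The four error terms [U1] to [U4] below add up to at most [8 e |z|]. *)
set (e := Rmin 1 (eps / 10)).
assert (He : 0 < e) by (apply Rmin_pos; lra).
assert (He1 : e <= 1) by apply Rmin_l.
assert (He2 : e <= eps / 10) by apply Rmin_r.
destruct (is_derive_eps exp 0 1) with (eps := e) as [d1 [Hd1 H1]];
  [generalize (is_derive_exp 0); rewrite exp_0; exact (fun H => H)|exact He|].
destruct (is_derive_eps sin 0 1) with (eps := e) as [d2 [Hd2 H2]];
  [generalize (is_derive_sin 0); rewrite cos_0; exact (fun H => H)|exact He|].
destruct (is_derive_eps cos 0 0) with (eps := e) as [d3 [Hd3 H3]];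
  [generalize (is_derive_cos 0); rewrite sin_0, Ropp_0; exact (fun H => H)|exact He|].
exists (Rmin (Rmin 1 e) (Rmin d1 (Rmin d2 d3))). split.
{ repeat apply Rmin_pos; lra. }
intros [x y] Hz.
assert (E0 : forall c : C, (c - 0)%C = c) by (intros; ring).
rewrite !E0 in *.
set (m := Cmod (x, y)) in *.
assert (Hx : Rabs x <= m) by exact (re_le_Cmod (x, y)).
assert (Hy : Rabs y <= m).
{ generalize (Rmax_Cmod (x, y)); simpl. intros H.
  eapply Rle_trans; [apply Rmax_r | exact H]. }
assert (Hm0 : 0 <= m) by apply Cmod_ge_0.
assert (M : m < 1 /\ m < e /\ m < d1 /\ m < d2 /\ m < d3).
{ generalize (Rmin_l (Rmin 1 e) (Rmin d1 (Rmin d2 d3))),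
   (Rmin_r (Rmin 1 e) (Rmin d1 (Rmin d2 d3))), (Rmin_l 1 e), (Rmin_r 1 e),
   (Rmin_l d1 (Rmin d2 d3)), (Rmin_r d1 (Rmin d2 d3)), (Rmin_l d2 d3),
   (Rmin_r d2 d3). lra. }
specialize (H1 x). specialize (H2 y). specialize (H3 y).
rewrite !Rminus_0_r in *. rewrite exp_0 in H1. rewrite sin_0 in H2.
rewrite cos_0 in H3.
assert (K1 := H1 ltac:(lra)). assert (K2 := H2 ltac:(lra)).
assert (K3 := H3 ltac:(lra)). clear H1 H2 H3.
replace (1 * x) with x in K1 by ring. replace (1 * y) with y in K2 by ring.
replace (cos y - 1 - 0 * y) with (cos y - 1) in K3 by ring.
replace (sin y - 0 - y) with (sin y - y) in K2 by ring.
replace (Cexp (x, y) - Cexp 0 - 1 * (x, y))%C with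
  (((exp x - 1 - x) * cos y + (1 + x) * (cos y - 1),
   (exp x - 1) * sin y + (sin y - y)) : C).
2:{ rewrite Cexp_0. unfold Cexp, Cminus, Cplus, Cmult, Copp, RtoC; simpl.
    f_equal; ring. }
eapply Rle_trans; [apply Cmod_le_abs_sum|].
pose proof (Rabs_pos x). pose proof (Rabs_pos y).
assert (C1 : Rabs (cos y) <= 1) by (apply Rabs_le; apply COS_bound).
assert (C2 : Rabs (1 + x) <= 2).
{ eapply Rle_trans; [apply Rabs_triang|]. rewrite Rabs_R1. lra. }
assert (C3 : Rabs (exp x - 1) <= 2 * m).
{ replace (exp x - 1) with ((exp x - 1 - x) + x) by ring.
  eapply Rle_trans; [apply Rabs_triang|]. nra. }
assert (C4 : Rabs (sin y) <= 2).
{ generalize (SIN_bound y). intros. apply Rabs_le. lra. }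
assert (U1 : Rabs ((exp x - 1 - x) * cos y) <= e * m).
{ rewrite Rabs_mult. pose proof (Rabs_pos (exp x - 1 - x)).
  pose proof (Rabs_pos (cos y)). nra. }
assert (U2 : Rabs ((1 + x) * (cos y - 1)) <= 2 * (e * m)).
{ rewrite Rabs_mult. pose proof (Rabs_pos (cos y - 1)).
  pose proof (Rabs_pos (1 + x)).
  apply Rmult_le_compat; try lra. nra. }
assert (S1 : Rabs (sin y) <= 2 * e).
{ replace (sin y) with ((sin y - y) + y) by ring.
  eapply Rle_trans; [apply Rabs_triang|]. nra. }
assert (U3 : Rabs ((exp x - 1) * sin y) <= 4 * (e * m)).
{ rewrite Rabs_mult. pose proof (Rabs_pos (exp x - 1)).
  pose proof (Rabs_pos (sin y)).
  apply Rle_trans with (2 * m * (2 * e)); [apply Rmult_le_compat; lra | lra]. }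
assert (U4 : Rabs (sin y - y) <= e * m).
{ eapply Rle_trans; [exact K2|]. apply Rmult_le_compat_l; lra. }
eapply Rle_trans; [apply Rplus_le_compat; apply Rabs_triang|].
assert (e * m <= eps / 10 * m) by (apply Rmult_le_compat_r; lra).
assert (0 <= eps * m) by (apply Rmult_le_pos; lra).
lra.
Qed.

Lemma is_cderive_Cexp (z : C) : is_cderive Cexp z (Cexp z).
Proof.
apply is_derive_ext with (f := fun x => (Cexp z * Cexp (x - z))%C).
{ intros x. rewrite <- Cexp_plus. f_equal. ring. }
eapply is_cderive_eq.
- apply is_cderive_mult; [apply is_cderive_const|].
  apply (is_cderive_comp Cexp (fun x => x - z)%C z (RtoC 1) (RtoC 1)).
  + replace (z - z)%C with (RtoC 0) by ring. exact is_cderive_Cexp_0.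
  + eapply is_cderive_eq;
      [apply is_cderive_minus; [apply is_cderive_id|apply is_cderive_const]|].
    ring.
- cbv beta. ring.
Qed.

(** The arctangent of the slope is the argument only in the right half-plane. This is enough:
    [|Im w| < 1 < pi/2] on the disk, so its exponential image lies there. *)
Definition Clog (z : C) : C := (ln (Cmod z), atan (Im z / Re z)).

Lemma Cmod_gt_0_of_re (z : C) : 0 < Re z -> 0 < Cmod z.
Proof.
intros H. eapply Rlt_le_trans; [|apply re_le_Cmod].
rewrite Rabs_pos_eq; lra.
Qed.

Lemma Cexp_Clog (z : C) : 0 < Re z -> Cexp (Clog z) = z.
Proof.
intros Hz. assert (Hm := Cmod_gt_0_of_re z Hz).
destruct z as [x y]; simpl in *.
unfold Cexp, Clog; simpl.
rewrite exp_ln by exact Hm. rewrite cos_atan, sin_atan.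
assert (E : Cmod (x, y) = x * sqrt (1 + Rsqr (y / x))).
{ transitivity (sqrt (x * x) * sqrt (1 + Rsqr (y / x)));
  [|rewrite sqrt_square by lra; reflexivity].
  rewrite <- sqrt_mult by (pose proof (Rle_0_sqr (y / x)); nra).
  unfold Cmod; simpl. f_equal. unfold Rsqr. field. lra. }
assert (Hs : 0 < sqrt (1 + Rsqr (y / x))).
{ apply sqrt_lt_R0. pose proof (Rle_0_sqr (y / x)). lra. }
rewrite E. f_equal; field; lra.
Qed.

Lemma continuous_Cmod (z : C) : continuous Cmod z.
Proof.
intros P [d Hd].
apply locally_C. exists d. intros x Hx. apply Hd.
apply Rabs_def1.
- generalize (Cmod_triangle_rev x z). change (Cmod (x - z) < d) in Hx.
  change (Cmod (x - z) < d) in Hx. unfold minus, plus, opp; simpl. lra.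
- generalize (Cmod_triangle_rev z x). change (Cmod (x - z) < d) in Hx.
  rewrite Cmod_minus_sym in Hx. unfold minus, plus, opp; simpl. lra.
Qed.

Lemma continuous_Clog (z : C) : 0 < Re z -> continuous Clog z.
Proof.
intros Hz. unfold Clog.
apply (continuous_comp_2 (fun z => ln (Cmod z)) (fun z => atan (Im z / Re z))
  (fun a b => (a, b))).
- apply continuous_comp; [apply continuous_Cmod|].
  apply (ex_derive_continuous (V := R_NormedModule)).
  eexists. apply is_derive_ln. apply Cmod_gt_0_of_re, Hz.
- apply (continuous_comp (fun z => Im z / Re z) atan).
  + apply (continuous_mult (K := R_AbsRing) Im (fun z => / Re z)).
    * apply continuous_snd.
    * apply (continuous_comp Re Rinv); [apply continuous_fst|].
      apply continuous_Rinv. lra.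
  + apply (ex_derive_continuous (V := R_NormedModule)).
    eexists. apply is_derive_Reals, derivable_pt_lim_atan.
- apply continuous_ext with (f := fun x : C => x); [intros []; reflexivity|].
  apply continuous_id.
Qed.

Lemma re_ge_minus (a b : C) : Re a - Cmod (b - a) <= Re b.
Proof.
generalize (re_le_Cmod (b - a)). unfold Cminus. rewrite re_plus, re_opp.
intros H. apply Rabs_le_between in H. lra.
Qed.

Lemma is_cderive_Clog (z : C) : 0 < Re z -> is_cderive Clog z (/ z)%C.
Proof.
intros Hz.
apply (is_cderive_inverse Cexp Clog z z (Re z) Hz).
- intros x Hx. apply Cexp_Clog. generalize (re_ge_minus z x). lra.
- apply continuous_Clog, Hz.
- rewrite <- (Cexp_Clog z Hz) at 2. apply is_cderive_Cexp.
- intros ->. simpl in Hz. lra.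
Qed.

Lemma Clog_1 : Clog (RtoC 1) = RtoC 0.
Proof.
unfold Clog. rewrite Cmod_1, ln_1. simpl.
replace (0 / 1) with 0 by field. rewrite atan_0. reflexivity.
Qed.

Lemma Clog_Cexp (w : C) : - (PI / 2) < Im w < PI / 2 -> Clog (Cexp w) = w.
Proof.
intros H. unfold Clog. rewrite Cmod_Cexp, ln_exp.
replace (Im (Cexp w) / Re (Cexp w)) with (tan (Im w)).
- rewrite atan_tan by exact H. destruct w; reflexivity.
- unfold Cexp, tan; simpl. pose proof (exp_pos (Re w)).
  assert (0 < cos (Im w)) by (apply cos_gt_0; lra).
  field; split; lra.
Qed.

Lemma Csqrt_re_gt_0 (z : C) : 0 < Re z -> 0 < Re (Csqrt z).
Proof.
intros H. unfold Csqrt; simpl. apply sqrt_lt_R0.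
pose proof (Cmod_ge_0 z). lra.
Qed.

(** Both roots lie in the right half-plane, so their sum has modulus at least [Re (Csqrt z)], and
    [x - z] factors as the difference of the roots times their sum. *)
Lemma continuous_Csqrt (z : C) : 0 < Re z -> continuous Csqrt z.
Proof.
intros Hz. apply continuous_C_eps. intros eps Heps.
assert (Hs := Csqrt_re_gt_0 z Hz). set (m := Re (Csqrt z)) in *.
exists (Rmin (Re z) (eps * m)). split.
{ apply Rmin_pos; [lra | apply Rmult_lt_0_compat; lra]. }
intros x Hx.
assert (Hx1 := Rlt_le_trans _ _ _ Hx (Rmin_l _ _)).
assert (Hx2 := Rlt_le_trans _ _ _ Hx (Rmin_r _ _)).
assert (Hxr : 0 < Re x) by (generalize (re_ge_minus z x); lra).
assert (Hsx := Csqrt_re_gt_0 x Hxr).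
assert (E : (x - z)%C = ((Csqrt x - Csqrt z) * (Csqrt x + Csqrt z))%C).
{ transitivity (Csqrt x * Csqrt x - Csqrt z * Csqrt z)%C;
  [rewrite !Csqrt_sqr; reflexivity | ring]. }
assert (L : m <= Cmod (Csqrt x + Csqrt z)).
{ eapply Rle_trans; [|apply re_le_Cmod]. rewrite re_plus.
  fold m. rewrite Rabs_pos_eq; lra. }
rewrite E, Cmod_mult in Hx2.
pose proof (Cmod_ge_0 (Csqrt x - Csqrt z)).
apply Rmult_lt_reg_r with m; [exact Hs|]. nra.
Qed.

Lemma is_cderive_Csqrt (z : C) : 0 < Re z ->
  is_cderive Csqrt z (/ (2 * Csqrt z))%C.
Proof.
intros Hz.
apply (is_cderive_inverse (fun x => x * x)%C Csqrt z _ 1 Rlt_0_1).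
- intros x _. apply Csqrt_sqr.
- apply continuous_Csqrt, Hz.
- eapply is_cderive_eq; [apply is_cderive_mult; apply is_cderive_id|].
  cbv beta. ring.
- apply Cmult_neq_0.
  + intros H. apply RtoC_inj in H. lra.
  + intros H. assert (K := Csqrt_re_gt_0 z Hz). rewrite H in K. simpl in K. lra.
Qed.

Lemma Csqrt_1 : Csqrt (RtoC 1) = RtoC 1.
Proof.
unfold Csqrt. rewrite Cmod_1. simpl.
replace ((1 + 1) / 2) with 1 by field. replace ((1 - 1) / 2) with 0 by field.
rewrite sqrt_1, sqrt_0. destruct (Rle_dec 0 0); [reflexivity|lra].
Qed.

(** * Goursat's lemma *)

Notation CInt := (@RInt C_R_CompleteNormedModule).
Notation is_CInt := (@is_RInt C_R_NormedModule).
Notation ex_CInt := (@ex_RInt C_R_NormedModule).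

Lemma is_CInt_CInt (f : R -> C) (a b : R) :
  (forall t, Rmin a b <= t <= Rmax a b -> continuous f t) ->
  is_CInt f a b (CInt f a b).
Proof.
intros H. apply (RInt_correct (V := C_R_CompleteNormedModule)).
apply (ex_RInt_continuous (V := C_R_CompleteNormedModule)). exact H.
Qed.

Lemma is_CInt_eq (f : R -> C) (a b : R) (l : C) :
  is_CInt f a b l -> CInt f a b = l.
Proof. exact (is_RInt_unique (V := C_R_CompleteNormedModule) f a b l). Qed.

Lemma is_CInt_plus (f g : R -> C) (a b : R) (lf lg : C) :
  is_CInt f a b lf -> is_CInt g a b lg ->
  is_CInt (fun t => (f t + g t)%C) a b (lf + lg)%C.
Proof. exact (is_RInt_plus (V := C_R_NormedModule) f g a b lf lg). Qed.

Lemma is_CInt_minus (f g : R -> C) (a b : R) (lf lg : C) :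
  is_CInt f a b lf -> is_CInt g a b lg ->
  is_CInt (fun t => (f t - g t)%C) a b (lf - lg)%C.
Proof. exact (is_RInt_minus (V := C_R_NormedModule) f g a b lf lg). Qed.

(** The integral is taken in a module over [R], so a complex constant comes out only by treating the
    two components separately. *)
Lemma is_CInt_mult (c : C) (f : R -> C) (a b : R) (l : C) :
  is_CInt f a b l -> is_CInt (fun t => (c * f t)%C) a b (c * l)%C.
Proof.
intros H.
assert (H1 := is_RInt_fct_extend_fst (U := R_NormedModule) (V := R_NormedModule) f a b l H).
assert (H2 := is_RInt_fct_extend_snd (U := R_NormedModule) (V := R_NormedModule) f a b l H).
apply (is_RInt_fct_extend_pair (U := R_NormedModule) (V := R_NormedModule)).
- apply (is_RInt_minus (V := R_NormedModule));
  apply (is_RInt_scal (V := R_NormedModule)); assumption.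
- apply (is_RInt_plus (V := R_NormedModule));
  apply (is_RInt_scal (V := R_NormedModule)); assumption.
Qed.

Lemma is_CInt_const (c : C) (a b : R) :
  is_CInt (fun _ => c) a b (RtoC (b - a) * c)%C.
Proof.
rewrite <- scal_R_Cmult. exact (is_RInt_const (V := C_R_NormedModule) a b c).
Qed.

Lemma Cmod_is_CInt_le (f : R -> C) (a b : R) (l : C) (M : R) :
  (forall t, Rmin a b <= t <= Rmax a b -> Cmod (f t) <= M) ->
  is_CInt f a b l -> Cmod l <= Rabs (b - a) * M.
Proof.
intros Hf Hl. rewrite Cmod_norm.
apply (norm_RInt_le_const_abs (V := C_R_NormedModule) f a b l M); [|exact Hl].
intros t Ht. specialize (Hf t Ht). rewrite Cmod_norm in Hf. exact Hf.
Qed.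

Lemma continuous_horizontal (f : C -> C) (x y : R) :
  continuous f (x, y) -> continuous (fun t => f (t, y)) x.
Proof.
intros H. apply (continuous_comp (fun t : R => (t, y)) f); [|exact H].
apply continuous_path_eps. intros eps Heps. exists eps. split; [exact Heps|].
intros s Hs. replace ((s, y) - (x, y))%C with (RtoC (s - x)).
- rewrite Cmod_R. exact Hs.
- unfold Cminus, Cplus, Copp, RtoC; simpl. f_equal; ring.
Qed.

Lemma continuous_vertical (f : C -> C) (x y : R) :
  continuous f (x, y) -> continuous (fun t => f (x, t)) y.
Proof.
intros H. apply (continuous_comp (fun t : R => (x, t)) f); [|exact H].
apply continuous_path_eps. intros eps Heps. exists eps. split; [exact Heps|].
intros s Hs. replace ((x, s) - (x, y))%C with (Ci * RtoC (s - y))%C.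
- rewrite Cmod_mult, Cmod_Ci, Cmod_R, Rmult_1_l. exact Hs.
- unfold Cminus, Cplus, Copp, Cmult, Ci, RtoC; simpl. f_equal; ring.
Qed.

(** The counterclockwise boundary integral, with opposite sides under one integral sign so that
    their integrands can be subtracted pointwise. *)
Definition rect_int (f : C -> C) (x0 x1 y0 y1 : R) : C :=
  (CInt (fun t => f (t, y0) - f (t, y1))%C x0 x1 +
   Ci * CInt (fun t => f (x1, t) - f (x0, t))%C y0 y1)%C.

Definition continuous_on_rect (f : C -> C) (x0 x1 y0 y1 : R) : Prop :=
  forall x y, x0 <= x <= x1 -> y0 <= y <= y1 -> continuous f (x, y).

Lemma continuous_C_minus (f g : R -> C) (t : R) :
  continuous f t -> continuous g t -> continuous (fun s => f s - g s)%C t.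
Proof.
exact (continuous_minus (V := C_R_NormedModule) f g t).
Qed.

Lemma is_CInt_horizontal (f : C -> C) (a b y : R) :
  (forall t, Rmin a b <= t <= Rmax a b -> continuous f (t, y)) ->
  is_CInt (fun t => f (t, y)) a b (CInt (fun t => f (t, y)) a b).
Proof.
intros H. apply is_CInt_CInt. intros t Ht. apply continuous_horizontal, H, Ht.
Qed.

Lemma is_CInt_vertical (f : C -> C) (a b x : R) :
  (forall t, Rmin a b <= t <= Rmax a b -> continuous f (x, t)) ->
  is_CInt (fun t => f (x, t)) a b (CInt (fun t => f (x, t)) a b).
Proof.
intros H. apply is_CInt_CInt. intros t Ht. apply continuous_vertical, H, Ht.
Qed.

Lemma rect_int_eq (f : C -> C) (x0 x1 y0 y1 : R) :
  (forall x y, Rmin x0 x1 <= x <= Rmax x0 x1 -> Rmin y0 y1 <= y <= Rmax y0 y1 ->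
    continuous f (x, y)) ->
  rect_int f x0 x1 y0 y1 =
  (CInt (fun t => f (t, y0)) x0 x1 - CInt (fun t => f (t, y1)) x0 x1 +
   Ci * (CInt (fun t => f (x1, t)) y0 y1 - CInt (fun t => f (x0, t)) y0 y1))%C.
Proof.
intros H.
assert (M : forall a b, Rmin a b <= a <= Rmax a b /\ Rmin a b <= b <= Rmax a b).
{ intros a b. generalize (Rmin_l a b), (Rmin_r a b), (Rmax_l a b), (Rmax_r a b).
  lra. }
unfold rect_int.
rewrite (is_CInt_eq _ _ _ _ (is_CInt_minus _ _ _ _ _ _
  (is_CInt_horizontal f x0 x1 y0 (fun t Ht => H t y0 Ht (proj1 (M y0 y1))))
  (is_CInt_horizontal f x0 x1 y1 (fun t Ht => H t y1 Ht (proj2 (M y0 y1)))))).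
rewrite (is_CInt_eq _ _ _ _ (is_CInt_minus _ _ _ _ _ _
  (is_CInt_vertical f y0 y1 x1 (fun t Ht => H x1 t (proj2 (M x0 x1)) Ht))
  (is_CInt_vertical f y0 y1 x0 (fun t Ht => H x0 t (proj1 (M x0 x1)) Ht)))).
reflexivity.
Qed.

Lemma CInt_swap (f : R -> C) (a b : R) : ex_CInt f a b ->
  CInt f b a = (- CInt f a b)%C.
Proof.
intros H. symmetry. exact (opp_RInt_swap (V := C_R_CompleteNormedModule) f a b H).
Qed.

Lemma CInt_Chasles (f : R -> C) (a b c : R) : ex_CInt f a b -> ex_CInt f b c ->
  CInt f a c = (CInt f a b + CInt f b c)%C.
Proof.
intros H1 H2. symmetry.
exact (RInt_Chasles (V := C_R_CompleteNormedModule) f a b c H1 H2).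
Qed.

Lemma nested_intervals (a b : nat -> R) :
  (forall n, a n <= a (S n)) -> (forall n, b (S n) <= b n) ->
  (forall n, a n <= b n) -> exists u, forall n, a n <= u <= b n.
Proof.
intros Ha Hb Hab.
assert (Ma : forall n k, a n <= a (n + k)%nat).
{ intros n k. induction k as [|k IH].
  - rewrite Nat.add_0_r. lra.
  - rewrite Nat.add_succ_r. apply Rle_trans with (1 := IH), Ha. }
assert (Mb : forall n k, b (n + k)%nat <= b n).
{ intros n k. induction k as [|k IH].
  - rewrite Nat.add_0_r. lra.
  - rewrite Nat.add_succ_r. apply Rle_trans with (2 := IH), Hb. }
assert (Mab : forall n m, a n <= b m).
{ intros n m. apply Rle_trans with (1 := Ma n m).
  apply Rle_trans with (1 := Hab _). rewrite Nat.add_comm. apply Mb. }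
destruct (completeness (fun x => exists n, x = a n)) as [u [Hu1 Hu2]].
- exists (b 0%nat). intros x [n ->]. apply Mab.
- exists (a 0%nat), 0%nat. reflexivity.
- exists u. intros n. split.
  + apply Hu1. exists n. reflexivity.
  + apply Hu2. intros x [m ->]. apply Mab.
Qed.

(** If [P] failed, it would fail on some quarter, on some quarter of that quarter, and so on. These
    nested rectangles shrink to a point, around which [P] holds for all small rectangles. *)
Lemma rectangle_bisection (P : R -> R -> R -> R -> Prop) (x0 y0 w0 h0 : R) :
  0 <= w0 -> 0 <= h0 ->
  (forall x y w h, 0 <= w -> 0 <= h ->
    x0 <= x -> x + w <= x0 + w0 -> y0 <= y -> y + h <= y0 + h0 ->
    P x y (w / 2) (h / 2) -> P (x + w / 2) y (w / 2) (h / 2) ->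
    P x (y + h / 2) (w / 2) (h / 2) ->
    P (x + w / 2) (y + h / 2) (w / 2) (h / 2) -> P x y w h) ->
  (forall u v, x0 <= u <= x0 + w0 -> y0 <= v <= y0 + h0 ->
    exists d, 0 < d /\ forall x y w h, 0 <= w < d -> 0 <= h < d ->
      x0 <= x -> x + w <= x0 + w0 -> y0 <= y -> y + h <= y0 + h0 ->
      x <= u <= x + w -> y <= v <= y + h -> P x y w h) ->
  P x0 y0 w0 h0.
Proof.
intros Hw0 Hh0 Hsplit Hloc. apply NNPP. intros Hbad.
set (W := fun n => w0 * (/ 2) ^ n). set (H := fun n => h0 * (/ 2) ^ n).
assert (HW : forall n, W (S n) = W n / 2 /\ 0 <= W n).
{ intros n. unfold W. simpl. split; [field|].
  apply Rmult_le_pos; [lra|apply pow_le; lra]. }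
assert (HH : forall n, H (S n) = H n / 2 /\ 0 <= H n).
{ intros n. unfold H. simpl. split; [field|].
  apply Rmult_le_pos; [lra|apply pow_le; lra]. }
(* The size of the n-th rectangle is known in advance, so only its lower left corner has to be
   chosen. *)
set (good := fun n (q q' : R * R) =>
  fst q <= fst q' /\ fst q' + W (S n) <= fst q + W n /\
  snd q <= snd q' /\ snd q' + H (S n) <= snd q + H n /\
  ~ P (fst q') (snd q') (W (S n)) (H (S n))).
set (q := fix q n := match n with
  | O => (x0, y0)
  | S n => epsilon (inhabits (0, 0)) (good n (q n))
  end).
set (inv := fun n => ~ P (fst (q n)) (snd (q n)) (W n) (H n) /\
  x0 <= fst (q n) /\ fst (q n) + W n <= x0 + w0 /\
  y0 <= snd (q n) /\ snd (q n) + H n <= y0 + h0).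
assert (Hstep : forall n, inv n -> good n (q n) (q (S n))).
{ intros n (B1 & B2 & B3 & B4 & B5).
  apply epsilon_spec.
  destruct (HW n) as [EW PW]. destruct (HH n) as [EH PH].
  apply NNPP. intros Hno. apply B1. apply Hsplit; try assumption;
  rewrite <- EW, <- EH; apply NNPP; intros HP; apply Hno;
  [ exists (fst (q n), snd (q n))
  | exists (fst (q n) + W (S n), snd (q n))
  | exists (fst (q n), snd (q n) + H (S n))
  | exists (fst (q n) + W (S n), snd (q n) + H (S n))];
  unfold good; cbn [fst snd]; (repeat split; try assumption; lra). }
assert (Hinv : forall n, inv n).
{ induction n as [|n IH].
  - assert (E1 : W 0%nat = w0) by (unfold W; simpl; ring).
    assert (E2 : H 0%nat = h0) by (unfold H; simpl; ring).
    unfold inv. rewrite E1, E2. simpl. repeat split; try assumption; lra.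
  - destruct (Hstep n IH) as (G1 & G2 & G3 & G4 & G5).
    destruct IH as (_ & B2 & B3 & B4 & B5).
    repeat split; try assumption; lra. }
destruct (nested_intervals (fun n => fst (q n)) (fun n => fst (q n) + W n))
  as [u Hu].
{ intros n. apply (Hstep n (Hinv n)). }
{ intros n. apply (Hstep n (Hinv n)). }
{ intros n. destruct (HW n). simpl. lra. }
destruct (nested_intervals (fun n => snd (q n)) (fun n => snd (q n) + H n))
  as [v Hv].
{ intros n. apply (Hstep n (Hinv n)). }
{ intros n. apply (Hstep n (Hinv n)). }
{ intros n. destruct (HH n). simpl. lra. }
cbv beta in Hu, Hv.
destruct (Hloc u v) as [d [Hd HP]].
{ destruct (Hinv O) as (_ & B2 & B3 & _). specialize (Hu O). lra. }
{ destruct (Hinv O) as (_ & _ & _ & B4 & B5). specialize (Hv O). lra. }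
(* The summand 1 keeps the denominator positive when the rectangle is a point. *)
destruct (pow_lt_1_zero (/ 2)) with (y := d / (w0 + h0 + 1)) as [N HN].
{ rewrite Rabs_pos_eq; lra. }
{ apply Rdiv_lt_0_compat; lra. }
specialize (HN N (le_n N)).
rewrite Rabs_pos_eq in HN by (apply pow_le; lra).
assert (K : (w0 + h0 + 1) * (/ 2) ^ N < d).
{ apply Rmult_lt_reg_r with (/ (w0 + h0 + 1)); [apply Rinv_0_lt_compat; lra|].
  replace ((w0 + h0 + 1) * (/ 2) ^ N * / (w0 + h0 + 1)) with ((/ 2) ^ N)
    by (field; lra). exact HN. }
assert (0 < (/ 2) ^ N) by (apply pow_lt; lra).
destruct (Hinv N) as (B1 & B2 & B3 & B4 & B5).
apply B1, HP; try assumption; try apply Hu; try apply Hv;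
 (split; [apply HW || apply HH|]); unfold W, H; nra.
Qed.

Lemma Rmin_Rmax_le (a b : R) : a <= b -> Rmin a b = a /\ Rmax a b = b.
Proof. intros H. split; [apply Rmin_left | apply Rmax_right]; exact H. Qed.

Lemma rect_int_split_x (f : C -> C) (x0 x1 x2 y0 y1 : R) :
  x0 <= x1 <= x2 -> y0 <= y1 -> continuous_on_rect f x0 x2 y0 y1 ->
  rect_int f x0 x2 y0 y1 =
  (rect_int f x0 x1 y0 y1 + rect_int f x1 x2 y0 y1)%C.
Proof.
intros Hx Hy H.
destruct (Rmin_Rmax_le x0 x1) as [m1 M1]; [lra|].
destruct (Rmin_Rmax_le x1 x2) as [m2 M2]; [lra|].
destruct (Rmin_Rmax_le x0 x2) as [m3 M3]; [lra|].
destruct (Rmin_Rmax_le y0 y1) as [m4 M4]; [lra|].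
rewrite !rect_int_eq by
  (rewrite ?m1, ?M1, ?m2, ?M2, ?m3, ?M3, m4, M4; intros; apply H; lra).
rewrite (CInt_Chasles (fun t => f (t, y0)) x0 x1 x2)
  by (eexists; apply is_CInt_horizontal; rewrite ?m1, ?M1, ?m2, ?M2;
      intros; apply H; lra).
rewrite (CInt_Chasles (fun t => f (t, y1)) x0 x1 x2)
  by (eexists; apply is_CInt_horizontal; rewrite ?m1, ?M1, ?m2, ?M2;
      intros; apply H; lra).
ring.
Qed.

Lemma rect_int_split_y (f : C -> C) (x0 x1 y0 y1 y2 : R) :
  x0 <= x1 -> y0 <= y1 <= y2 -> continuous_on_rect f x0 x1 y0 y2 ->
  rect_int f x0 x1 y0 y2 =
  (rect_int f x0 x1 y0 y1 + rect_int f x0 x1 y1 y2)%C.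
Proof.
intros Hx Hy H.
destruct (Rmin_Rmax_le y0 y1) as [m1 M1]; [lra|].
destruct (Rmin_Rmax_le y1 y2) as [m2 M2]; [lra|].
destruct (Rmin_Rmax_le y0 y2) as [m3 M3]; [lra|].
destruct (Rmin_Rmax_le x0 x1) as [m4 M4]; [lra|].
rewrite !rect_int_eq by
  (rewrite ?m1, ?M1, ?m2, ?M2, ?m3, ?M3, m4, M4; intros; apply H; lra).
rewrite (CInt_Chasles (fun t => f (x0, t)) y0 y1 y2)
  by (eexists; apply is_CInt_vertical; rewrite ?m1, ?M1, ?m2, ?M2;
      intros; apply H; lra).
rewrite (CInt_Chasles (fun t => f (x1, t)) y0 y1 y2)
  by (eexists; apply is_CInt_vertical; rewrite ?m1, ?M1, ?m2, ?M2;
      intros; apply H; lra).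
ring.
Qed.

(* The two sides of a rectangle are compared pointwise, so an integrand which is
   affine up to an error [e] has boundary integral at most [2 e (w + h)]. *)
Lemma rect_int_affine_bound (f : C -> C) (x0 x1 y0 y1 e : R) (c l : C) :
  x0 <= x1 -> y0 <= y1 -> continuous_on_rect f x0 x1 y0 y1 ->
  (forall x y, x0 <= x <= x1 -> y0 <= y <= y1 ->
    Cmod (f (x, y) - (c + l * (x, y))) <= e) ->
  Cmod (rect_int f x0 x1 y0 y1) <= 2 * e * (x1 - x0 + (y1 - y0)).
Proof.
intros Hx Hy Hc He.
destruct (Rmin_Rmax_le y0 y1 Hy) as [my My].
destruct (Rmin_Rmax_le x0 x1 Hx) as [mx Mx].
set (k1 := (l * (Ci * RtoC (y0 - y1)))%C).
set (k2 := (l * RtoC (x1 - x0))%C).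
set (g1 := fun t => (f (t, y0) - f (t, y1))%C).
set (g2 := fun t => (f (x1, t) - f (x0, t))%C).
assert (I1 : is_CInt g1 x0 x1 (CInt g1 x0 x1)).
{ apply is_CInt_CInt. rewrite mx, Mx. intros t Ht.
  apply continuous_C_minus; apply continuous_horizontal, Hc; lra. }
assert (I2 : is_CInt g2 y0 y1 (CInt g2 y0 y1)).
{ apply is_CInt_CInt. rewrite my, My. intros t Ht.
  apply continuous_C_minus; apply continuous_vertical, Hc; lra. }
assert (B1 : Cmod (CInt g1 x0 x1 - RtoC (x1 - x0) * k1) <= Rabs (x1 - x0) * (2 * e)).
{ apply Cmod_is_CInt_le with (f := fun t => (g1 t - k1)%C);
  [|apply is_CInt_minus; [exact I1|apply is_CInt_const]].
  rewrite mx, Mx. intros t Ht.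
  replace (g1 t - k1)%C with
   ((f (t, y0) - (c + l * (t, y0))) - (f (t, y1) - (c + l * (t, y1))))%C.
  - eapply Rle_trans; [apply Cmod_triangle_minus|].
    generalize (He t y0 Ht), (He t y1 Ht). lra.
  - unfold g1, k1. replace (RtoC (y0 - y1)) with ((- Ci) * ((t, y0) - (t, y1)))%C.
    + assert (Ci * Ci = -1)%C as EC by
       (unfold Ci, Cmult, RtoC, Copp; simpl; f_equal; ring).
      replace (l * (Ci * (- Ci * ((t, y0) - (t, y1)))))%C with
       (- (Ci * Ci) * l * ((t, y0) - (t, y1)))%C by ring.
      rewrite EC. ring.
    + unfold Ci, Cmult, Cminus, Cplus, RtoC, Copp; simpl; f_equal; ring. }
assert (B2 : Cmod (CInt g2 y0 y1 - RtoC (y1 - y0) * k2) <= Rabs (y1 - y0) * (2 * e)).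
{ apply Cmod_is_CInt_le with (f := fun t => (g2 t - k2)%C);
  [|apply is_CInt_minus; [exact I2|apply is_CInt_const]].
  rewrite my, My. intros t Ht.
  replace (g2 t - k2)%C with
   ((f (x1, t) - (c + l * (x1, t))) - (f (x0, t) - (c + l * (x0, t))))%C.
  - eapply Rle_trans; [apply Cmod_triangle_minus|].
    generalize (fun H => He x1 t H Ht), (fun H => He x0 t H Ht). lra.
  - unfold g2, k2. replace (RtoC (x1 - x0)) with ((x1, t) - (x0, t))%C; [ring|].
    unfold Cminus, Cplus, RtoC, Copp; simpl; f_equal; ring. }
unfold rect_int. fold g1 g2.
replace (CInt g1 x0 x1 + Ci * CInt g2 y0 y1)%C with
  ((CInt g1 x0 x1 - RtoC (x1 - x0) * k1) +
   Ci * (CInt g2 y0 y1 - RtoC (y1 - y0) * k2))%C.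
- eapply Rle_trans; [apply Cmod_triangle|].
  rewrite Cmod_mult, Cmod_Ci, Rmult_1_l.
  rewrite Rabs_pos_eq in B1 by lra. rewrite Rabs_pos_eq in B2 by lra. lra.
- unfold k1, k2. rewrite !RtoC_minus. ring.
Qed.

(** The bound [eps (w + h)^2] passes from the four quarters to the whole, because four times
    [(w/2 + h/2)^2] is [(w + h)^2]. Near a point, differentiability makes [f] affine up to
    [(eps/2)(w + h)], which gives this very bound. *)
Lemma goursat (f : C -> C) (x0 x1 y0 y1 : R) :
  x0 <= x1 -> y0 <= y1 ->
  (forall x y, x0 <= x <= x1 -> y0 <= y <= y1 ->
    exists l, is_cderive f (x, y) l) ->
  rect_int f x0 x1 y0 y1 = RtoC 0.
Proof.
intros Hx Hy Hf.
assert (Hc : continuous_on_rect f x0 x1 y0 y1).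
{ intros x y Hx' Hy'. destruct (Hf x y Hx' Hy') as [l Hl].
  exact (is_cderive_continuous f _ l Hl). }
assert (B : forall eps, 0 < eps ->
  Cmod (rect_int f x0 x1 y0 y1) <= eps * (x1 - x0 + (y1 - y0)) ^ 2).
{ intros eps Heps.
  cut (Cmod (rect_int f x0 (x0 + (x1 - x0)) y0 (y0 + (y1 - y0))) <=
    eps * (x1 - x0 + (y1 - y0)) ^ 2).
  { replace (x0 + (x1 - x0)) with x1 by ring.
    replace (y0 + (y1 - y0)) with y1 by ring. exact (fun H => H). }
  apply (rectangle_bisection (fun x y w h =>
    Cmod (rect_int f x (x + w) y (y + h)) <= eps * (w + h) ^ 2)); try lra.
  - intros x y w h Hw Hh A1 A2 A3 A4 P1 P2 P3 P4.
    assert (Hcs : forall a b c d, x0 <= a -> b <= x1 -> y0 <= c -> d <= y1 ->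
      continuous_on_rect f a b c d).
    { intros a b c d ? ? ? ? x' y' ? ?. apply Hc; lra. }
    rewrite (rect_int_split_x f x (x + w / 2)) by (try apply Hcs; lra).
    rewrite (rect_int_split_y f x (x + w / 2) y (y + h / 2)) by (try apply Hcs; lra).
    rewrite (rect_int_split_y f (x + w / 2) (x + w) y (y + h / 2))
      by (try apply Hcs; lra).
    replace (x + w / 2 + w / 2) with (x + w) in * by field.
    replace (y + h / 2 + h / 2) with (y + h) in * by field.
    eapply Rle_trans; [apply Cmod_triangle|].
    eapply Rle_trans; [apply Rplus_le_compat; apply Cmod_triangle|]. nra.
  - intros u v Hu Hv.
    destruct (Hf u v) as [l Hl]; [lra|lra|].
    rewrite is_cderive_eps in Hl.
    destruct (Hl (eps / 2)) as [d [Hd H]]; [lra|].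
    exists (d / 2). split; [lra|].
    intros x y w h Hw Hh A1 A2 A3 A4 Hxu Hyv.
    replace (eps * (w + h) ^ 2) with
      (2 * (eps / 2 * (w + h)) * (x + w - x + (y + h - y))) by field.
    apply rect_int_affine_bound with (c := (f (u, v) - l * (u, v))%C) (l := l).
    + lra.
    + lra.
    + intros x' y' ? ?. apply Hc; lra.
    + intros x' y' Hx' Hy'.
      assert (L : Cmod ((x', y') - (u, v)) <= w + h).
      { change (Cmod (x' - u, y' - v) <= w + h).
        eapply Rle_trans; [apply Cmod_le_abs_sum|].
        apply Rplus_le_compat; apply Rabs_le; lra. }
      replace (f (x', y') - (f (u, v) - l * (u, v) + l * (x', y')))%C with
        (f (x', y') - f (u, v) - l * ((x', y') - (u, v)))%C by ring.
      eapply Rle_trans; [apply H; lra|].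
      apply Rmult_le_compat_l; lra. }
apply Cmod_eq_0. apply Rle_antisym; [|apply Cmod_ge_0].
apply le_epsilon. intros e He. rewrite Rplus_0_l.
set (q := (x1 - x0 + (y1 - y0)) ^ 2) in *.
assert (Hq : 0 <= q) by (apply pow2_ge_0).
apply Rle_trans with (1 := B (e / (q + 1)) ltac:(apply Rdiv_lt_0_compat; lra)).
replace e with (e / (q + 1) * (q + 1)) at 2 by (field; lra).
apply Rmult_le_compat_l; [|lra]. left. apply Rdiv_lt_0_compat; lra.
Qed.

(** * Primitives on the disk *)

(** When an exceptional point lies on a side, cutting around it leaves a degenerate rectangle
    through that point, to which [goursat] does not apply. *)
Lemma rect_int_flat_x (f : C -> C) (x y0 y1 : R) :
  rect_int f x x y0 y1 = RtoC 0.
Proof.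
unfold rect_int.
rewrite (is_CInt_eq (fun t => f (t, y0) - f (t, y1))%C x x (RtoC 0))
  by exact (is_RInt_point (V := C_R_NormedModule) _ x).
rewrite (is_CInt_eq (fun t => f (x, t) - f (x, t))%C y0 y1 (RtoC (y1 - y0) * 0)%C).
- ring.
- apply is_RInt_ext with (f := fun _ => RtoC 0); [|apply is_CInt_const].
  intros t _. symmetry. apply Cplus_opp_r.
Qed.

Lemma rect_int_flat_y (f : C -> C) (x0 x1 y : R) :
  rect_int f x0 x1 y y = RtoC 0.
Proof.
unfold rect_int.
rewrite (is_CInt_eq (fun t => f (x1, t) - f (x0, t))%C y y (RtoC 0))
  by exact (is_RInt_point (V := C_R_NormedModule) _ y).
rewrite (is_CInt_eq (fun t => f (t, y) - f (t, y))%C x0 x1 (RtoC (x1 - x0) * 0)%C).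
- ring.
- apply is_RInt_ext with (f := fun _ => RtoC 0); [|apply is_CInt_const].
  intros t _. symmetry. apply Cplus_opp_r.
Qed.

(* Cut out a square of side [2 d] around the exceptional point [(p, q)]: the
   integral over its boundary is [O(d)], and the remaining pieces vanish. *)
Lemma goursat_except (f : C -> C) (p q x0 x1 y0 y1 : R) :
  x0 <= x1 -> y0 <= y1 -> continuous_on_rect f x0 x1 y0 y1 ->
  (forall x y, x0 <= x <= x1 -> y0 <= y <= y1 -> (x <> p \/ y <> q) ->
    exists l, is_cderive f (x, y) l) ->
  rect_int f x0 x1 y0 y1 = RtoC 0.
Proof.
intros Hx Hy Hc Hf.
destruct (classic ((x0 <= p <= x1) /\ (y0 <= q <= y1))) as [[Hp Hq]|Hout].
2:{ apply goursat; try assumption. intros x y Hx' Hy'. apply Hf; try assumption.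
    destruct (Req_dec x p) as [->|]; [|left; assumption].
    right. intros ->. apply Hout. split; assumption. }
assert (Z : forall a b c d, x0 <= a <= b -> b <= x1 -> y0 <= c <= d -> d <= y1 ->
  (b < p \/ p < a \/ d < q \/ q < c \/ a = b \/ c = d) ->
  rect_int f a b c d = RtoC 0).
{ intros a b c d Ha Hb Hcc Hd Hcase.
  destruct (Req_dec a b) as [->|Nab]; [apply rect_int_flat_x|].
  destruct (Req_dec c d) as [->|Ncd]; [apply rect_int_flat_y|].
  apply goursat; try lra. intros x y Hx' Hy'. apply Hf; lra. }
assert (Hcont := proj1 (continuous_C_eps f (p, q)) (Hc p q Hp Hq) 1 Rlt_0_1).
destruct Hcont as [d [Hd Hfd]].
apply Cmod_eq_0. apply Rle_antisym; [|apply Cmod_ge_0].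
apply le_epsilon. intros e He. rewrite Rplus_0_l.
set (M := Cmod (f (p, q)) + 1).
assert (HM : 1 <= M) by (generalize (Cmod_ge_0 (f (p, q))); unfold M; lra).
set (r := Rmin (d / 4) (e / (8 * M))).
assert (Hr : 0 < r) by (apply Rmin_pos; [lra|apply Rdiv_lt_0_compat; lra]).
assert (Hr1 : r <= d / 4) by apply Rmin_l.
assert (Hr2 : r <= e / (8 * M)) by apply Rmin_r.
set (a := Rmax x0 (p - r)). set (b := Rmin x1 (p + r)).
set (a' := Rmax y0 (q - r)). set (b' := Rmin y1 (q + r)).
assert (Ha : x0 <= a <= p /\ p - r <= a /\ (a = x0 \/ a < p)).
{ unfold a, Rmax. destruct (Rle_dec x0 (p - r)); lra. }
assert (Hb : p <= b <= x1 /\ b <= p + r /\ (b = x1 \/ p < b)).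
{ unfold b, Rmin. destruct (Rle_dec x1 (p + r)); lra. }
assert (Ha' : y0 <= a' <= q /\ q - r <= a' /\ (a' = y0 \/ a' < q)).
{ unfold a', Rmax. destruct (Rle_dec y0 (q - r)); lra. }
assert (Hb' : q <= b' <= y1 /\ b' <= q + r /\ (b' = y1 \/ q < b')).
{ unfold b', Rmin. destruct (Rle_dec y1 (q + r)); lra. }
assert (Hcs : forall a b c d, x0 <= a -> b <= x1 -> y0 <= c -> d <= y1 ->
  continuous_on_rect f a b c d).
{ intros a0 b0 c0 d0 ? ? ? ? x' y' ? ?. apply Hc; lra. }
rewrite (rect_int_split_x f x0 a x1) by (try apply Hcs; lra).
rewrite (rect_int_split_x f a b x1) by (try apply Hcs; lra).
rewrite (rect_int_split_y f a b y0 a' y1) by (try apply Hcs; lra).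
rewrite (rect_int_split_y f a b a' b' y1) by (try apply Hcs; lra).
rewrite (Z x0 a y0 y1), (Z b x1 y0 y1), (Z a b y0 a'), (Z a b b' y1) by lra.
rewrite !Cplus_0_l, !Cplus_0_r.
apply Rle_trans with (2 * M * (b - a + (b' - a'))).
- apply rect_int_affine_bound with (c := RtoC 0) (l := RtoC 0); try lra.
  + apply Hcs; lra.
  + intros x y Hx' Hy'.
    replace (f (x, y) - (0 + 0 * (x, y)))%C with
      (f (x, y) - f (p, q) + f (p, q))%C by ring.
    eapply Rle_trans; [apply Cmod_triangle|].
    unfold M. rewrite (Rplus_comm _ 1). apply Rplus_le_compat_r.
    left. apply Hfd. change (Cmod (x - p, y - q) < d).
    eapply Rle_lt_trans; [apply Cmod_le_abs_sum|].
    apply Rle_lt_trans with (r + r); [|lra].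
    apply Rplus_le_compat; apply Rabs_le; lra.
- apply Rle_trans with (2 * M * (4 * r)).
  + apply Rmult_le_compat_l; lra.
  + replace e with (8 * M * (e / (8 * M))) at 1 by (field; lra).
    replace (2 * M * (4 * r)) with (8 * M * r) by ring.
    apply Rmult_le_compat_l; lra.
Qed.

Lemma rect_int_swap_x (f : C -> C) (x0 x1 y0 y1 : R) :
  x0 <= x1 -> y0 <= y1 -> continuous_on_rect f x0 x1 y0 y1 ->
  rect_int f x1 x0 y0 y1 = (- rect_int f x0 x1 y0 y1)%C.
Proof.
intros Hx Hy H.
destruct (Rmin_Rmax_le x0 x1 Hx) as [m1 M1].
destruct (Rmin_Rmax_le y0 y1 Hy) as [m2 M2].
assert (m3 : Rmin x1 x0 = x0) by (rewrite Rmin_comm; exact m1).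
assert (M3 : Rmax x1 x0 = x1) by (rewrite Rmax_comm; exact M1).
rewrite !rect_int_eq by (rewrite ?m1, ?M1, ?m3, ?M3, m2, M2; exact H).
rewrite (CInt_swap (fun t => f (t, y0)) x0 x1), (CInt_swap (fun t => f (t, y1)) x0 x1)
 by (eexists; apply is_CInt_horizontal; rewrite m1, M1; intros; apply H; lra).
ring.
Qed.

Lemma rect_int_swap_y (f : C -> C) (x0 x1 y0 y1 : R) :
  (forall x y, Rmin x0 x1 <= x <= Rmax x0 x1 -> Rmin y0 y1 <= y <= Rmax y0 y1 ->
    continuous f (x, y)) ->
  rect_int f x0 x1 y1 y0 = (- rect_int f x0 x1 y0 y1)%C.
Proof.
intros H.
assert (M : forall a b, Rmin a b <= a <= Rmax a b /\ Rmin a b <= b <= Rmax a b).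
{ intros a b. generalize (Rmin_l a b), (Rmin_r a b), (Rmax_l a b), (Rmax_r a b).
  lra. }
rewrite !rect_int_eq by (rewrite ?(Rmin_comm y1), ?(Rmax_comm y1); exact H).
rewrite (CInt_swap (fun t => f (x0, t)) y0 y1), (CInt_swap (fun t => f (x1, t)) y0 y1)
 by (eexists; apply is_CInt_vertical; intros; apply H; [apply M|lra]).
ring.
Qed.

Lemma Cmod_le_compare (a b c d : R) :
  Rabs a <= Rabs c -> Rabs b <= Rabs d -> Cmod (a, b) <= Cmod (c, d).
Proof.
intros H1 H2. unfold Cmod; simpl. apply sqrt_le_1_alt.
apply Rsqr_le_abs_1 in H1, H2. unfold Rsqr in *. nra.
Qed.

(** Made for the difference quotient of an analytic function at [a], which is continuous at [a] but
    not yet known to be differentiable there. *)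
Definition holomorphic_except (f : C -> C) (a : C) : Prop :=
  (forall z, in_disk z -> continuous f z) /\
  (forall z, in_disk z -> z <> a -> exists l, is_cderive f z l).

(** Points of the rectangle spanned by 0 and [(x, y)] have coordinates of smaller size, hence stay
    in the disk. A negative coordinate only reverses the orientation. *)
Lemma goursat_disk (f : C -> C) (a : C) (x y : R) :
  holomorphic_except f a -> in_disk (x, y) -> rect_int f 0 x 0 y = RtoC 0.
Proof.
intros [Hc Hf] Hxy. destruct a as [p q].
assert (In : forall x' y', Rmin 0 x <= x' <= Rmax 0 x ->
  Rmin 0 y <= y' <= Rmax 0 y -> in_disk (x', y')).
{ intros x' y' Hx' Hy'. unfold in_disk in *.
  eapply Rle_lt_trans; [apply Cmod_le_compare|exact Hxy];
  unfold Rabs; revert Hx' Hy'; unfold Rmin, Rmax;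
  repeat destruct (Rle_dec _ _); repeat destruct (Rcase_abs _); lra. }
assert (G : forall x0 x1 y0 y1, x0 <= x1 -> y0 <= y1 -> Rmin 0 x <= x0 ->
  x1 <= Rmax 0 x -> Rmin 0 y <= y0 -> y1 <= Rmax 0 y ->
  continuous_on_rect f x0 x1 y0 y1 /\ rect_int f x0 x1 y0 y1 = RtoC 0).
{ intros x0 x1 y0 y1 ? ? ? ? ? ?.
  assert (Hcr : continuous_on_rect f x0 x1 y0 y1).
  { intros x' y' ? ?. apply Hc, In; lra. }
  split; [exact Hcr|].
  apply goursat_except with (p := p) (q := q); try assumption.
  intros x' y' ? ? Hne. apply Hf; [apply In; lra|].
  intros E. injection E as -> ->. destruct Hne; congruence. }
assert (Hcc : forall x' y', Rmin 0 x <= x' <= Rmax 0 x ->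
  Rmin 0 y <= y' <= Rmax 0 y -> continuous f (x', y')).
{ intros. apply Hc, In; assumption. }
generalize (Rmin_l 0 x), (Rmin_r 0 x), (Rmax_l 0 x), (Rmax_r 0 x).
generalize (Rmin_l 0 y), (Rmin_r 0 y), (Rmax_l 0 y), (Rmax_r 0 y).
intros.
destruct (Rle_dec 0 y) as [Hy|Hy].
- destruct (Rle_dec 0 x) as [Hx|Hx].
  + apply G; lra.
  + destruct (G x 0 0 y) as [G1 G2]; try lra.
    rewrite rect_int_swap_x, G2 by (assumption || lra). ring.
- rewrite rect_int_swap_y
    by (intros x' y'; rewrite (Rmin_comm y), (Rmax_comm y); apply Hcc).
  destruct (Rle_dec 0 x) as [Hx|Hx].
  + destruct (G 0 x y 0) as [G1 G2]; try lra. rewrite G2. ring.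
  + destruct (G x 0 y 0) as [G1 G2]; try lra.
    rewrite rect_int_swap_x, G2 by (assumption || lra). ring.
Qed.

Definition path_primitive (f : C -> C) (z : C) : C :=
  (CInt (fun t => f (t, 0)) 0 (Re z) + Ci * CInt (fun t => f (Re z, t)) 0 (Im z))%C.

Lemma in_disk_horizontal (x y t : R) : in_disk (x, y) ->
  Rmin 0 x <= t <= Rmax 0 x -> in_disk (t, y).
Proof.
intros H Ht. eapply Rle_lt_trans; [apply Cmod_le_compare with (c := x) (d := y)|exact H];
 [|apply Rle_refl].
unfold Rabs; revert Ht; unfold Rmin, Rmax;
 repeat destruct (Rle_dec _ _); repeat destruct (Rcase_abs _); lra.
Qed.

Lemma in_disk_vertical (x y t : R) : in_disk (x, y) ->
  Rmin 0 y <= t <= Rmax 0 y -> in_disk (x, t).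
Proof.
intros H Ht. eapply Rle_lt_trans; [apply Cmod_le_compare with (c := x) (d := y)|exact H];
 [apply Rle_refl|].
unfold Rabs; revert Ht; unfold Rmin, Rmax;
 repeat destruct (Rle_dec _ _); repeat destruct (Rcase_abs _); lra.
Qed.

(** The two L-shaped paths from 0 to [(x, y)] bound a rectangle. The definition suits vertical
    increments of the endpoint, this form horizontal ones. *)
Lemma path_primitive_alt (f : C -> C) (a : C) (x y : R) :
  holomorphic_except f a -> in_disk (x, y) ->
  path_primitive f (x, y) =
  (CInt (fun t => f (t, y)) 0 x + Ci * CInt (fun t => f (0, t)) 0 y)%C.
Proof.
intros Hf Hxy. generalize (goursat_disk f a x y Hf Hxy).
rewrite rect_int_eq.
- intros E. unfold path_primitive; simpl.
  apply Ceq_minus. rewrite <- E. ring.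
- intros x' y' Hx' Hy'. apply Hf. apply (in_disk_horizontal x); [|exact Hx'].
  apply (in_disk_vertical x y); assumption.
Qed.

Lemma between_abs (a b t : R) : Rmin a b <= t <= Rmax a b ->
  Rabs (t - a) <= Rabs (b - a).
Proof.
unfold Rmin, Rmax, Rabs. repeat destruct (Rle_dec _ _);
 repeat destruct (Rcase_abs _); lra.
Qed.

Lemma is_cderive_path_primitive (f : C -> C) (a z : C) :
  holomorphic_except f a -> in_disk z -> is_cderive (path_primitive f) z (f z).
Proof.
intros Hf Hz. destruct z as [x y].
apply is_cderive_eps. intros eps Heps.
destruct (proj1 (continuous_C_eps f (x, y)) (proj1 Hf _ Hz) (eps / 2))
  as [d [Hd H]]; [lra|].
set (m := 1 - Cmod (x, y)). assert (Hm : 0 < m) by (unfold m, in_disk in *; lra).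
exists (Rmin m (d / 2)). split; [apply Rmin_pos; lra|].
intros [x' y'] Hz'.
assert (Hz1 := Rlt_le_trans _ _ _ Hz' (Rmin_l _ _)).
assert (Hz2 := Rlt_le_trans _ _ _ Hz' (Rmin_r _ _)).
change ((x', y') - (x, y))%C with ((x' - x, y' - y) : C) in *.
set (h := Cmod (x' - x, y' - y)) in *.
assert (Hx : Rabs (x' - x) <= h) by exact (re_le_Cmod (x' - x, y' - y)).
assert (Hy : Rabs (y' - y) <= h).
{ generalize (Rmax_Cmod (x' - x, y' - y)); simpl. intros K.
  eapply Rle_trans; [apply Rmax_r | exact K]. }
assert (Close : forall u v, Rabs (u - x) <= Rabs (x' - x) ->
  Rabs (v - y) <= Rabs (y' - y) -> in_disk (u, v) /\ Cmod ((u, v) - (x, y)) < d).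
{ intros u v Hu Hv.
  assert (L : Cmod (u - x, v - y) <= h) by (apply Cmod_le_compare; assumption).
  change ((u, v) - (x, y))%C with ((u - x, v - y) : C).
  split; [|lra]. unfold in_disk.
  replace (u, v) with (Cplus (u - x, v - y) (x, y)).
  - eapply Rle_lt_trans; [apply Cmod_triangle|]. unfold m in *. lra.
  - unfold Cplus; simpl. f_equal; ring. }
destruct (Close x' y' (Rle_refl _) (Rle_refl _)) as [D1 _].
assert (D2 : in_disk (x, y')).
{ apply Close; [|apply Rle_refl]. rewrite Rminus_diag, Rabs_R0. apply Rabs_pos. }
assert (I1 : forall u v, (forall t, Rmin u v <= t <= Rmax u v -> in_disk (t, y')) ->
  is_CInt (fun t => f (t, y')) u v (CInt (fun t => f (t, y')) u v)).
{ intros u v K. apply is_CInt_horizontal. intros t Ht. apply Hf, K, Ht. }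
assert (I2 : forall u v, (forall t, Rmin u v <= t <= Rmax u v -> in_disk (x, t)) ->
  is_CInt (fun t => f (x, t)) u v (CInt (fun t => f (x, t)) u v)).
{ intros u v K. apply is_CInt_vertical. intros t Ht. apply Hf, K, Ht. }
assert (K1 : forall t, Rmin x x' <= t <= Rmax x x' ->
  in_disk (t, y') /\ Cmod ((t, y') - (x, y)) < d).
{ intros t Ht. apply Close; [apply between_abs, Ht|apply Rle_refl]. }
assert (K2 : forall t, Rmin y y' <= t <= Rmax y y' ->
  in_disk (x, t) /\ Cmod ((x, t) - (x, y)) < d).
{ intros t Ht. apply Close; [|apply between_abs, Ht].
  rewrite Rminus_diag, Rabs_R0. apply Rabs_pos. }
(* The increment goes through the corner [(x, y')]: its horizontal part is read off the second form
   of the primitive, its vertical part off the definition. *)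
assert (E : (path_primitive f (x', y') - path_primitive f (x, y))%C =
  (CInt (fun t => f (t, y')) x x' + Ci * CInt (fun t => f (x, t)) y y')%C).
{ transitivity ((path_primitive f (x', y') - path_primitive f (x, y')) +
    (path_primitive f (x, y') - path_primitive f (x, y)))%C; [ring|]. f_equal.
  - rewrite !(path_primitive_alt f a) by assumption.
    rewrite (CInt_Chasles (fun t => f (t, y')) 0 x x'); [ring| |];
    eexists; apply I1.
    + intros t Ht. apply (in_disk_horizontal x); assumption.
    + intros t Ht. apply K1, Ht.
  - unfold path_primitive; simpl.
    rewrite (CInt_Chasles (fun t => f (x, t)) 0 y y'); [ring| |];
    eexists; apply I2.
    + intros t Ht. apply (in_disk_vertical x y); assumption.
    + intros t Ht. apply K2, Ht. }
rewrite E.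
assert (B1 : Cmod (CInt (fun t => f (t, y')) x x' - RtoC (x' - x) * f (x, y))
  <= Rabs (x' - x) * (eps / 2)).
{ apply Cmod_is_CInt_le with (f := fun t => (f (t, y') - f (x, y))%C).
  - intros t Ht. left. apply H, K1, Ht.
  - apply is_CInt_minus; [apply I1; intros t Ht; apply K1, Ht|apply is_CInt_const]. }
assert (B2 : Cmod (CInt (fun t => f (x, t)) y y' - RtoC (y' - y) * f (x, y))
  <= Rabs (y' - y) * (eps / 2)).
{ apply Cmod_is_CInt_le with (f := fun t => (f (x, t) - f (x, y))%C).
  - intros t Ht. left. apply H, K2, Ht.
  - apply is_CInt_minus; [apply I2; intros t Ht; apply K2, Ht|apply is_CInt_const]. }
replace (x' - x, y' - y) with (RtoC (x' - x) + Ci * RtoC (y' - y))%C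
  by (unfold Cplus, Cmult, Ci, RtoC; simpl; f_equal; ring).
match goal with |- Cmod ?E0 <= _ => replace E0 with
 ((CInt (fun t => f (t, y')) x x' - RtoC (x' - x) * f (x, y)) +
  Ci * (CInt (fun t => f (x, t)) y y' - RtoC (y' - y) * f (x, y)))%C by ring end.
eapply Rle_trans; [apply Cmod_triangle|].
rewrite Cmod_mult, Cmod_Ci, Rmult_1_l.
assert (Rabs (x' - x) * (eps / 2) <= h * (eps / 2)) by (apply Rmult_le_compat_r; lra).
assert (Rabs (y' - y) * (eps / 2) <= h * (eps / 2)) by (apply Rmult_le_compat_r; lra).
lra.
Qed.

(** * Cauchy's formula *)

Definition circle (r t : R) : C := (r * cos t, r * sin t).

Lemma Cmod_circle (r t : R) : 0 <= r -> Cmod (circle r t) = r.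
Proof.
intros Hr. unfold circle, Cmod; simpl.
transitivity (sqrt (r * r)); [|apply sqrt_square, Hr]. f_equal.
generalize (sin2_cos2 t). unfold Rsqr. intros H.
transitivity (r * r * (sin t * sin t + cos t * cos t)); [ring|rewrite H; ring].
Qed.

Lemma is_path_derive_circle (r t : R) :
  is_path_derive (circle r) t (Ci * circle r t)%C.
Proof.
replace (Ci * circle r t)%C with ((r * - sin t, r * cos t) : C).
- apply (is_path_derive_pair (fun t => r * cos t) (fun t => r * sin t)).
  + apply (is_derive_scal cos t r (- sin t)). apply is_derive_cos.
  + apply (is_derive_scal sin t r (cos t)). apply is_derive_sin.
- unfold circle, Ci, Cmult; simpl. f_equal; ring.
Qed.

Lemma continuous_circle (r t : R) : continuous (circle r) t.
Proof.
apply (ex_derive_continuous (V := C_R_NormedModule)).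
eexists. apply is_path_derive_circle.
Qed.

Lemma circle_2PI (r : R) : circle r (2 * PI) = circle r 0.
Proof. unfold circle. rewrite cos_2PI, sin_2PI, cos_0, sin_0. reflexivity. Qed.

Lemma continuous_C_mult_path (f g : R -> C) (t : R) :
  continuous f t -> continuous g t -> continuous (fun s => f s * g s)%C t.
Proof.
intros Hf Hg. apply continuous_path_eps. intros eps Heps.
rewrite continuous_path_eps in Hf, Hg.
set (A := Cmod (f t)). set (B := Cmod (g t)).
assert (HA : 0 <= A) by apply Cmod_ge_0. assert (HB : 0 <= B) by apply Cmod_ge_0.
set (e := Rmin 1 (eps / (A + B + 2))).
assert (He : 0 < e) by (apply Rmin_pos; [|apply Rdiv_lt_0_compat]; lra).
assert (He1 : e <= 1) by apply Rmin_l.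
assert (He2 : e * (A + B + 2) <= eps).
{ replace eps with (eps / (A + B + 2) * (A + B + 2)) by (field; lra).
  apply Rmult_le_compat_r; [lra|apply Rmin_r]. }
destruct (Hf e He) as [d1 [Hd1 H1]]. destruct (Hg e He) as [d2 [Hd2 H2]].
exists (Rmin d1 d2). split; [apply Rmin_pos; lra|]. intros s Hs.
specialize (H1 s (Rlt_le_trans _ _ _ Hs (Rmin_l _ _))).
specialize (H2 s (Rlt_le_trans _ _ _ Hs (Rmin_r _ _))).
replace (f s * g s - f t * g t)%C with
 ((f s - f t) * (g s - g t) + (f t * (g s - g t) + g t * (f s - f t)))%C by ring.
eapply Rle_lt_trans; [apply Cmod_triangle|].
eapply Rle_lt_trans; [apply Rplus_le_compat_l, Cmod_triangle|].
rewrite !Cmod_mult. fold A B.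
pose proof (Cmod_ge_0 (f s - f t)). pose proof (Cmod_ge_0 (g s - g t)). nra.
Qed.

Lemma continuous_Cinv (z : C) : z <> RtoC 0 -> continuous Cinv z.
Proof.
intros H. apply is_cderive_continuous with (1 := is_cderive_inv z H).
Qed.

Lemma continuous_C_div_path (f g : R -> C) (t : R) : g t <> RtoC 0 ->
  continuous f t -> continuous g t -> continuous (fun s => f s / g s)%C t.
Proof.
intros Hz Hf Hg. apply (continuous_C_mult_path f (fun s => / g s)%C); [exact Hf|].
apply (continuous_comp g Cinv); [exact Hg|apply continuous_Cinv, Hz].
Qed.

Lemma is_CInt_path_derive (F dF : R -> C) (a b : R) :
  (forall t, is_path_derive F t (dF t)) -> (forall t, continuous dF t) ->
  is_CInt dF a b (F b - F a)%C.
Proof.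
intros H1 H2.
exact (is_RInt_derive (V := C_R_CompleteNormedModule) F dF a b
  (fun t _ => H1 t) (fun t _ => H2 t)).
Qed.

Lemma is_CInt_ext (f g : R -> C) (a b : R) (l : C) :
  (forall t, f t = g t) -> is_CInt f a b l -> is_CInt g a b l.
Proof. intros H. apply is_RInt_ext. intros t _. apply H. Qed.

Lemma circle_minus_neq_0 (r : R) (a : C) (t : R) :
  Cmod a < r -> (circle r t - a)%C <> RtoC 0.
Proof.
intros H. apply Cminus_eq_contra. intros E.
assert (0 <= r) by (pose proof (Cmod_ge_0 a); lra).
apply (f_equal Cmod) in E. rewrite Cmod_circle in E by assumption. lra.
Qed.

Lemma circle_neq_0 (r t : R) : 0 < r -> circle r t <> RtoC 0.
Proof. intros H. apply Cmod_gt_0. rewrite Cmod_circle; lra. Qed.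

(* [Clog (1 - a / zeta)] is a primitive along the circle, and it is periodic. *)
Lemma is_CInt_winding (r : R) (a : C) : Cmod a < r ->
  is_CInt (fun t => circle r t / (circle r t - a))%C 0 (2 * PI) (RtoC (2 * PI)).
Proof.
intros Ha.
assert (Hr : 0 < r) by (pose proof (Cmod_ge_0 a); lra).
set (F := fun t => Clog (1 - a / circle r t)%C).
set (dF := fun t => (Ci * a / (circle r t - a))%C).
assert (I : is_CInt dF 0 (2 * PI) (F (2 * PI)%R - F 0)%C).
{ apply is_CInt_path_derive.
  - intros t. unfold F, dF.
    assert (Hz := circle_neq_0 r t Hr). assert (Hza := circle_minus_neq_0 r a t Ha).
    replace (Ci * a / (circle r t - a))%C with
      (/ (1 - a / circle r t) * ((a / (circle r t * circle r t)) * (Ci * circle r t)))%C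
      by (field; auto).
    apply (is_path_derive_comp Clog (fun s => 1 - a / circle r s)%C).
    + apply is_cderive_Clog.
      assert (L : Cmod (a / circle r t) < 1).
      { rewrite Cmod_div, Cmod_circle by (assumption || lra).
        apply Rmult_lt_reg_r with r; [exact Hr|].
        unfold Rdiv. rewrite Rmult_assoc, Rinv_l, Rmult_1_r, Rmult_1_l by lra.
        exact Ha. }
      generalize (re_ge_minus 1 (1 - a / circle r t)).
      replace (1 - a / circle r t - 1)%C with (- (a / circle r t))%C by ring.
      rewrite Cmod_opp. simpl. lra.
    + apply (is_path_derive_comp (fun z => 1 - a / z)%C (circle r));
        [|apply is_path_derive_circle].
      eapply is_cderive_eq.
      * apply is_cderive_minus; [apply is_cderive_const|].
        apply is_cderive_div; [exact Hz|apply is_cderive_const|apply is_cderive_id].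
      * cbv beta. field. exact Hz.
  - intros t. unfold dF.
    apply (continuous_C_div_path (fun _ => Ci * a)%C (fun s => circle r s - a)%C).
    + apply circle_minus_neq_0, Ha.
    + apply continuous_const.
    + apply continuous_C_minus; [apply continuous_circle|apply continuous_const]. }
unfold F in I. rewrite circle_2PI in I.
apply (is_CInt_mult (- Ci)) in I.
(* In [zeta / (zeta - a) = 1 + a / (zeta - a)] the constant contributes [2 pi], and the other term
   is [-i] times the derivative of the periodic primitive. *)
assert (J := is_CInt_plus _ _ _ _ _ _ (is_CInt_const 1 0 (2 * PI)) I).
replace (RtoC (2 * PI)) with
  (RtoC (2 * PI - 0)%R * 1 + - Ci * (Clog (1 - a / circle r 0) - Clog (1 - a / circle r 0)))%C.
- apply is_CInt_ext with (2 := J). intros t. unfold dF.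
  assert (Hza := circle_minus_neq_0 r a t Ha).
  assert (EC : (Ci * Ci)%C = RtoC (-1)) by
    (unfold Ci, Cmult, RtoC; simpl; f_equal; ring).
  replace (- Ci * (Ci * a / (circle r t - a)))%C with
    (- (Ci * Ci) * (a / (circle r t - a)))%C by (field; exact Hza).
  rewrite EC. field. exact Hza.
- rewrite Rminus_0_r. ring.
Qed.

Lemma in_disk_circle (r t : R) : 0 <= r < 1 -> in_disk (circle r t).
Proof. intros H. unfold in_disk. rewrite Cmod_circle; lra. Qed.

Definition slope (f : C -> C) (a l z : C) : C :=
  if Ceq_dec z a then l else ((f z - f a) / (z - a))%C.

Lemma slope_neq (f : C -> C) (a l z : C) : z <> a ->
  slope f a l z = ((f z - f a) / (z - a))%C.
Proof. intros H. unfold slope. destruct (Ceq_dec z a); [contradiction|reflexivity]. Qed.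

Lemma is_cderive_slope (f : C -> C) (a l z k : C) : z <> a -> is_cderive f z k ->
  exists k', is_cderive (slope f a l) z k'.
Proof.
intros Hza Hk. eexists.
apply is_cderive_ext_loc with (f := fun z => ((f z - f a) / (z - a))%C)
  (d := Cmod (z - a)).
- apply Cmod_gt_0, Cminus_eq_contra, Hza.
- intros x Hx. rewrite slope_neq; [reflexivity|]. intros ->.
  rewrite Cmod_minus_sym in Hx. lra.
- apply (is_cderive_div (fun z => f z - f a)%C (fun z => z - a)%C).
  + apply Cminus_eq_contra, Hza.
  + apply is_cderive_minus; [exact Hk|apply is_cderive_const].
  + apply is_cderive_minus; [apply is_cderive_id|apply is_cderive_const].
Qed.

Lemma continuous_slope (f : C -> C) (a l : C) : is_cderive f a l ->
  continuous (slope f a l) a.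
Proof.
intros H. apply continuous_C_eps. intros eps Heps.
rewrite is_cderive_eps in H. destruct (H (eps / 2)) as [d [Hd Hf]]; [lra|].
exists d. split; [exact Hd|]. intros z Hz.
replace (slope f a l a) with l
  by (unfold slope; destruct (Ceq_dec a a); congruence).
destruct (Ceq_dec z a) as [->|Hza].
- unfold slope. destruct (Ceq_dec a a); [|congruence].
  replace (l - l)%C with (RtoC 0) by ring. rewrite Cmod_0. exact Heps.
- rewrite slope_neq by exact Hza. specialize (Hf z Hz).
  assert (N := Cminus_eq_contra _ _ Hza).
  replace ((f z - f a) / (z - a) - l)%C with
    ((f z - f a - l * (z - a)) / (z - a))%C by (field; exact N).
  rewrite Cmod_div by exact N.
  assert (P : 0 < Cmod (z - a)) by (apply Cmod_gt_0, N).
  apply Rle_lt_trans with (eps / 2); [|lra].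
  apply Rmult_le_reg_r with (Cmod (z - a)); [exact P|].
  unfold Rdiv at 1. rewrite Rmult_assoc, Rinv_l, Rmult_1_r by lra. exact Hf.
Qed.

(** The difference quotient at [a] has a primitive on the disk, so its integral over the closed
    circle vanishes; what remains is [f a] times the winding integral. Since [d zeta = i zeta dt],
    the kernel carries a factor [zeta]. *)
Lemma cauchy_formula (f : C -> C) (r : R) (a : C) :
  analytic_on_disk f -> 0 < r < 1 -> Cmod a < r ->
  is_CInt (fun t => f (circle r t) * (circle r t / (circle r t - a)))%C
    0 (2 * PI) (RtoC (2 * PI)%R * f a)%C.
Proof.
intros Hf Hr Ha.
assert (Da : in_disk a) by (unfold in_disk; lra).
destruct (Hf a Da) as [l Hl].
set (g := slope f a l).
assert (Hg : holomorphic_except g a).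
{ split.
  - intros z Hz. destruct (Ceq_dec z a) as [->|Hza]; [apply continuous_slope, Hl|].
    destruct (Hf z Hz) as [k Hk].
    destruct (is_cderive_slope f a l z k Hza Hk) as [k' Hk'].
    exact (is_cderive_continuous _ _ _ Hk').
  - intros z Hz Hza. destruct (Hf z Hz) as [k Hk].
    exact (is_cderive_slope f a l z k Hza Hk). }
assert (I : is_CInt (fun t => g (circle r t) * (Ci * circle r t))%C 0 (2 * PI)
  (path_primitive g (circle r (2 * PI)%R) - path_primitive g (circle r 0))%C).
{ apply (is_CInt_path_derive (fun t => path_primitive g (circle r t))).
  - intros t. apply is_path_derive_comp; [|apply is_path_derive_circle].
    apply is_cderive_path_primitive with (1 := Hg). apply in_disk_circle. lra.
  - intros t.
    apply (continuous_C_mult_path (fun t => g (circle r t)) (fun t => Ci * circle r t)%C).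
    + apply (continuous_comp (circle r) g); [apply continuous_circle|].
      apply Hg, in_disk_circle. lra.
    + apply (continuous_C_mult_path (fun _ => Ci) (circle r));
        [apply continuous_const|apply continuous_circle]. }
rewrite circle_2PI in I.
apply (is_CInt_mult (- Ci)) in I.
assert (J := is_CInt_plus _ _ _ _ _ _
  (is_CInt_mult (f a) _ _ _ _ (is_CInt_winding r a Ha)) I).
match type of J with is_RInt _ _ _ ?v =>
  replace v with (RtoC (2 * PI)%R * f a)%C in J by ring end.
apply is_CInt_ext with (2 := J). intros t.
assert (Hza := circle_minus_neq_0 r a t Ha).
unfold g. rewrite slope_neq.
- assert (EC : (Ci * Ci)%C = RtoC (-1)) by
    (unfold Ci, Cmult, RtoC; simpl; f_equal; ring).
  replace (- Ci * ((f (circle r t) - f a) / (circle r t - a) * (Ci * circle r t)))%C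
   with (- (Ci * Ci) * ((f (circle r t) - f a) / (circle r t - a) * circle r t))%C
   by (field; exact Hza).
  rewrite EC. field. exact Hza.
- intros E. apply Hza. rewrite E. ring.
Qed.

(** * Cauchy integrals and the Schwarz lemma *)

(** A quadratic remainder uniform in [t] can simply be integrated; for powers of the Cauchy kernel
    it comes from explicit algebra. *)
Lemma is_cderive_CInt_param (K : C -> R -> C) (K' : R -> C) (z : C) (d0 c : R) :
  0 < d0 -> 0 <= c ->
  (forall z' t, Cmod (z' - z) < d0 -> continuous (K z') t) ->
  (forall t, continuous K' t) ->
  (forall z' t, 0 <= t <= 2 * PI -> Cmod (z' - z) < d0 ->
    Cmod (K z' t - K z t - (z' - z) * K' t) <= c * Cmod (z' - z) ^ 2) ->
  is_cderive (fun z => CInt (K z) 0 (2 * PI)) z (CInt K' 0 (2 * PI)).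
Proof.
intros Hd0 Hc HK HK' HB.
assert (Hpi := PI_RGT_0).
apply is_cderive_eps. intros eps Heps.
set (q := 2 * PI * c + 1).
assert (Hq : 0 < q) by (assert (0 <= PI * c) by (apply Rmult_le_pos; lra); unfold q; lra).
exists (Rmin d0 (eps / q)). split.
{ apply Rmin_pos; [exact Hd0|apply Rdiv_lt_0_compat; assumption]. }
intros z' Hz'.
assert (H1 := Rlt_le_trans _ _ _ Hz' (Rmin_l _ _)).
assert (H2 := Rlt_le_trans _ _ _ Hz' (Rmin_r _ _)).
assert (I1 : is_CInt (K z') 0 (2 * PI) (CInt (K z') 0 (2 * PI)))
  by (apply is_CInt_CInt; intros t _; apply HK, H1).
assert (I2 : is_CInt (K z) 0 (2 * PI) (CInt (K z) 0 (2 * PI))).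
{ apply is_CInt_CInt. intros t _. apply HK.
  replace (z - z)%C with (RtoC 0) by ring. rewrite Cmod_0. exact Hd0. }
assert (I3 : is_CInt K' 0 (2 * PI) (CInt K' 0 (2 * PI)))
  by (apply is_CInt_CInt; intros t _; apply HK').
apply (is_CInt_mult (z' - z)%C) in I3.
assert (I := is_CInt_minus _ _ _ _ _ _ (is_CInt_minus _ _ _ _ _ _ I1 I2) I3).
rewrite (Cmult_comm (CInt K' _ _)).
assert (P := Cmod_ge_0 (z' - z)).
eapply Rle_trans.
- apply Cmod_is_CInt_le with (2 := I) (M := c * Cmod (z' - z) ^ 2).
  intros t Ht. destruct (Rmin_Rmax_le 0 (2 * PI)) as [m M]; [lra|].
  rewrite m, M in Ht. apply HB; assumption.
- rewrite Rminus_0_r, Rabs_pos_eq by lra.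
  replace (2 * PI * (c * Cmod (z' - z) ^ 2)) with
    (2 * PI * c * Cmod (z' - z) * Cmod (z' - z)) by ring.
  apply Rmult_le_compat_r; [exact P|].
  apply Rle_trans with (q * Cmod (z' - z)).
  + apply Rmult_le_compat_r; [exact P|unfold q; lra].
  + replace eps with (q * (eps / q)) by (field; lra).
    apply Rmult_le_compat_l; lra.
Qed.

Lemma continuous_path_bounded (p : R -> C) (a b : R) : a <= b ->
  (forall t, continuous p t) ->
  exists M, 0 <= M /\ forall t, a <= t <= b -> Cmod (p t) <= M.
Proof.
intros Hab Hp.
destruct (continuity_ab_maj (fun t => Cmod (p t)) a b Hab) as [x [Hx _]].
- intros t _. apply continuity_pt_filterlim.
  apply (continuous_comp p Cmod); [apply Hp|apply continuous_Cmod].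
- exists (Cmod (p x)). split; [apply Cmod_ge_0|exact Hx].
Qed.

Definition cauchy_int (r : R) (p : R -> C) (n : nat) (z : C) : C :=
  CInt (fun t => p t * (/ (circle r t - z)) ^ n)%C 0 (2 * PI).

Lemma continuous_C_pow_path (p : R -> C) (n : nat) (t : R) :
  continuous p t -> continuous (fun s => p s ^ n)%C t.
Proof.
intros H. induction n as [|n IH]; [apply continuous_const|].
exact (continuous_C_mult_path p (fun s => p s ^ n)%C t H IH).
Qed.

Lemma continuous_cauchy_kernel (r : R) (p : R -> C) (n : nat) (z : C) (t : R) :
  Cmod z < r -> (forall t, continuous p t) ->
  continuous (fun t => p t * (/ (circle r t - z)) ^ n)%C t.
Proof.
intros Hz Hp. apply continuous_C_mult_path; [apply Hp|].
apply (continuous_C_pow_path (fun t => / (circle r t - z))%C).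
apply (continuous_comp (fun t => circle r t - z)%C Cinv).
- apply continuous_C_minus; [apply continuous_circle|apply continuous_const].
- apply continuous_Cinv, circle_minus_neq_0, Hz.
Qed.

Lemma Cmod_kernel_le (r : R) (z : C) (t d : R) : 0 < d ->
  Cmod z + d <= r -> Cmod (/ (circle r t - z)) <= / d.
Proof.
intros Hd Hz. pose proof (Cmod_ge_0 z).
rewrite Cmod_inv by (apply circle_minus_neq_0; lra).
apply Rinv_le_contravar; [exact Hd|].
generalize (Cmod_triangle_rev (circle r t) z).
rewrite Cmod_circle by lra. lra.
Qed.

(* With [k = 1/(zeta - z')], [j = 1/(zeta - z)] and [h = z' - z] one has
   [k - j = h k j]; hence [k - j - h j^2 = h^2 k j^2] and
   [k^2 - j^2 - 2 h j^3 = h^2 k j^2 (k + 2 j)]. *)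
Lemma is_cderive_cauchy_int (r : R) (p : R -> C) (n : nat) (z : C) :
  (n = 1 \/ n = 2)%nat -> Cmod z < r -> (forall t, continuous p t) ->
  is_cderive (cauchy_int r p n) z (RtoC (INR n) * cauchy_int r p (S n) z)%C.
Proof.
intros Hn Hz Hp.
destruct (continuous_path_bounded p 0 (2 * PI)) as [M [HM Hb]];
  [pose proof PI_RGT_0; lra|exact Hp|].
set (d := (r - Cmod z) / 2). assert (Hd : 0 < d) by (unfold d; lra).
assert (E : (RtoC (INR n) * cauchy_int r p (S n) z)%C =
  CInt (fun t => RtoC (INR n) * (p t * (/ (circle r t - z)) ^ (S n)))%C 0 (2 * PI)).
{ symmetry. apply is_CInt_eq, is_CInt_mult, is_CInt_CInt. intros t _.
  apply continuous_cauchy_kernel; assumption. }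
rewrite E.
assert (Hid : 0 < / d) by (apply Rinv_0_lt_compat; exact Hd).
assert (B : 0 <= M * (/ d * (/ d * / d) * (1 + 3 * / d))).
{ apply Rmult_le_pos; [exact HM|].
  apply Rmult_le_pos; [|lra].
  apply Rmult_le_pos; [lra|]. apply Rmult_le_pos; lra. }
apply is_cderive_CInt_param with (d0 := d) (2 := B); [exact Hd| | |].
- intros z' t Hz'. apply continuous_cauchy_kernel; [|exact Hp].
  generalize (Cmod_triangle_rev z' z). unfold d in *. lra.
- intros t.
  apply (continuous_C_mult_path (fun _ => RtoC (INR n))
    (fun t => p t * (/ (circle r t - z)) ^ (S n))%C); [apply continuous_const|].
  apply continuous_cauchy_kernel; assumption.
- intros z' t Ht Hz'.
  assert (Hz'1 : Cmod z' + d <= r)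
    by (generalize (Cmod_triangle_rev z' z); unfold d in *; lra).
  assert (N : (circle r t - z)%C <> RtoC 0) by (apply circle_minus_neq_0, Hz).
  assert (N' : (circle r t - z')%C <> RtoC 0) by (apply circle_minus_neq_0; lra).
  assert (Bk : Cmod (/ (circle r t - z')) <= / d) by (apply Cmod_kernel_le; assumption).
  assert (Bj : Cmod (/ (circle r t - z)) <= / d)
    by (apply Cmod_kernel_le; unfold d in *; lra).
  set (k := (/ (circle r t - z'))%C) in *. set (j := (/ (circle r t - z))%C) in *.
  set (h := (z' - z)%C) in *.
  assert (Ekj : (k - j)%C = (h * (k * j))%C) by (unfold k, j, h; field; auto).
  pose proof (Cmod_ge_0 k) as Pk. pose proof (Cmod_ge_0 j) as Pj.
  pose proof (Cmod_ge_0 h) as Ph. pose proof (Cmod_ge_0 (p t)) as Pp.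
  specialize (Hb t Ht).
  set (u := (k * (j * j))%C).
  assert (Bu : Cmod u <= / d * (/ d * / d)).
  { unfold u. rewrite !Cmod_mult. apply Rmult_le_compat; try lra.
    - apply Rmult_le_pos; assumption.
    - apply Rmult_le_compat; lra. }
  assert (Pu := Cmod_ge_0 u).
  assert (G : exists v, Cmod v <= 1 + 3 * / d /\
    (p t * k ^ n - p t * j ^ n - h * (RtoC (INR n) * (p t * j ^ S n)))%C =
    (h * h * (p t * (u * v)))%C).
  { destruct Hn as [-> | ->].
    - exists (RtoC 1). split; [rewrite Cmod_1; lra|].
      simpl. transitivity (p t * ((k - j) - h * (j * j)))%C; [ring|].
      rewrite Ekj. transitivity (p t * (h * j * (k - j)))%C; [ring|].
      rewrite Ekj. unfold u. ring.
    - exists (k + 2 * j)%C. split.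
      + eapply Rle_trans; [apply Cmod_triangle|]. rewrite Cmod_mult, Cmod_R.
        rewrite Rabs_pos_eq by lra. lra.
      + replace (INR 2) with 2 by (simpl; ring).
        transitivity (p t * ((k - j) * (k + j) - 2 * h * (j * j * j)))%C.
        { simpl. ring. }
        rewrite Ekj. transitivity (p t * (h * j * ((k - j) * (k + 2 * j))))%C; [ring|].
        rewrite Ekj. unfold u. ring. }
  destruct G as [v [Bv ->]]. pose proof (Cmod_ge_0 v) as Pv.
  rewrite !Cmod_mult.
  replace (M * (/ d * (/ d * / d) * (1 + 3 * / d)) * Cmod h ^ 2) with
    (Cmod h * Cmod h * (M * (/ d * (/ d * / d) * (1 + 3 * / d)))) by ring.
  apply Rmult_le_compat_l; [apply Rmult_le_pos; assumption|].
  apply Rmult_le_compat; [exact Pp|apply Rmult_le_pos; assumption|exact Hb|].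
  apply Rmult_le_compat; assumption.
Qed.

Lemma analytic_continuous (f : C -> C) (z : C) : analytic_on_disk f -> in_disk z ->
  continuous f z.
Proof.
intros Hf Hz. destruct (Hf z Hz) as [l Hl]. exact (is_cderive_continuous _ _ _ Hl).
Qed.

Lemma continuous_analytic_circle (f : C -> C) (r t : R) : analytic_on_disk f ->
  0 <= r < 1 -> continuous (fun t => f (circle r t)) t.
Proof.
intros Hf Hr. apply (continuous_comp (circle r) f); [apply continuous_circle|].
apply analytic_continuous; [exact Hf|apply in_disk_circle, Hr].
Qed.

Lemma RtoC_2PI_neq_0 : RtoC (2 * PI) <> RtoC 0.
Proof. intros H. apply RtoC_inj in H. pose proof PI_RGT_0. lra. Qed.

Lemma cauchy_formula_int (f : C -> C) (r : R) (z : C) :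
  analytic_on_disk f -> 0 < r < 1 -> Cmod z < r ->
  f z = (/ RtoC (2 * PI) * cauchy_int r (fun t => f (circle r t) * circle r t) 1 z)%C.
Proof.
intros Hf Hr Hz.
assert (I := cauchy_formula f r z Hf Hr Hz).
unfold cauchy_int.
rewrite (is_CInt_eq (fun t => f (circle r t) * circle r t * (/ (circle r t - z)) ^ 1)%C
  _ _ (RtoC (2 * PI)%R * f z)%C).
- field. apply RtoC_2PI_neq_0.
- apply is_CInt_ext with (2 := I). intros t. simpl. field.
  apply circle_minus_neq_0, Hz.
Qed.

Lemma cauchy_derivative (f : C -> C) (r : R) (z : C) :
  analytic_on_disk f -> 0 < r < 1 -> Cmod z < r ->
  is_cderive f z
    (/ RtoC (2 * PI) * cauchy_int r (fun t => f (circle r t) * circle r t) 2 z)%C.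
Proof.
intros Hf Hr Hz.
set (p := fun t => (f (circle r t) * circle r t)%C).
assert (Hp : forall t, continuous p t).
{ intros t. apply (continuous_C_mult_path (fun t => f (circle r t)) (circle r)).
  - apply continuous_analytic_circle; [exact Hf|lra].
  - apply continuous_circle. }
apply is_cderive_ext_loc with
  (f := fun z => (/ RtoC (2 * PI) * cauchy_int r p 1 z)%C) (d := r - Cmod z); [lra| |].
- intros x Hx. symmetry. apply cauchy_formula_int; try assumption.
  generalize (Cmod_triangle_rev x z). lra.
- eapply is_cderive_eq.
  + apply is_cderive_mult; [apply is_cderive_const|].
    apply is_cderive_cauchy_int; [left; reflexivity|exact Hz|exact Hp].
  + cbv beta. simpl INR. ring.
Qed.

Lemma is_cderive_C_derive (f : C -> C) (z l : C) :
  is_cderive f z l -> is_cderive f z (C_derive f z).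
Proof. intros H. rewrite (is_C_derive_unique f z l H). exact H. Qed.

(** Inside a circle the derivative is a Cauchy integral with squared kernel, which can be
    differentiated once more. This makes [1 + z F'/F] analytic, as the definition of subordination
    requires. *)
Lemma analytic_derive (f : C -> C) : analytic_on_disk f -> analytic_on_disk (C_derive f).
Proof.
intros Hf z Hz. unfold in_disk in Hz. pose proof (Cmod_ge_0 z) as Hz0.
set (r := (1 + Cmod z) / 2).
assert (Hr : 0 < r < 1) by (unfold r; lra).
assert (Hzr : Cmod z < r) by (unfold r; lra).
set (p := fun t => (f (circle r t) * circle r t)%C).
assert (Hp : forall t, continuous p t).
{ intros t. apply (continuous_C_mult_path (fun t => f (circle r t)) (circle r)).
  - apply continuous_analytic_circle; [exact Hf|lra].
  - apply continuous_circle. }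
eexists. apply is_cderive_ext_loc with
  (f := fun z => (/ RtoC (2 * PI) * cauchy_int r p 2 z)%C) (d := r - Cmod z); [lra| |].
- intros x Hx. symmetry. apply is_C_derive_unique, cauchy_derivative; try assumption.
  generalize (Cmod_triangle_rev x z). lra.
- apply is_cderive_mult; [apply is_cderive_const|].
  apply is_cderive_cauchy_int; [right; reflexivity|exact Hzr|exact Hp].
Qed.

(** Since [zeta / (zeta - x) - 1 = x / (zeta - x)], subtracting Cauchy's formula at 0 from the one
    at [x] expresses [f x / x] as a Cauchy integral with density [f]. That integral is
    differentiable at 0 as well, and its value there fills the singularity. *)
Lemma analytic_factor (f : C -> C) : analytic_on_disk f -> f (RtoC 0) = RtoC 0 ->
  exists g, analytic_on_disk g /\ forall z, f z = (z * g z)%C.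
Proof.
intros Hf Hf0.
assert (D0 : in_disk (RtoC 0)) by (unfold in_disk; rewrite Cmod_0; lra).
set (r := 1 / 2).
assert (Hr : 0 < r < 1) by (unfold r; lra).
set (q := fun t => f (circle r t)).
assert (Hq : forall t, continuous q t)
  by (intros t; apply continuous_analytic_circle; [exact Hf|lra]).
set (N := fun z => (/ RtoC (2 * PI) * cauchy_int r q 1 z)%C).
exists (slope f 0 (N (RtoC 0))). split.
- intros z Hz. destruct (Ceq_dec z 0) as [->|Hz0].
  + eexists. apply is_cderive_ext_loc with (f := N) (d := r); [lra| |].
    * intros x Hx. replace (x - 0)%C with x in Hx by ring.
      destruct (Ceq_dec x 0) as [->|Hx0].
      { unfold slope. destruct (Ceq_dec 0 0); congruence. }
      rewrite slope_neq, Hf0 by exact Hx0.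
      assert (J0 : is_CInt (fun t => q t) 0 (2 * PI) (RtoC (2 * PI)%R * 0)%C).
      { rewrite <- Hf0.
        apply is_CInt_ext with (2 := cauchy_formula f r 0 Hf Hr
          ltac:(rewrite Cmod_0; lra)).
        intros t. unfold q. field. apply circle_neq_0; lra. }
      assert (J := is_CInt_mult (/ x)%C _ _ _ _
        (is_CInt_minus _ _ _ _ _ _ (cauchy_formula f r x Hf Hr Hx) J0)).
      apply is_CInt_ext with (g := fun t => (q t * (/ (circle r t - x)) ^ 1)%C) in J.
      { apply is_CInt_eq in J. unfold N, cauchy_int. rewrite J.
        field. split; [exact Hx0|apply RtoC_2PI_neq_0]. }
      intros t. unfold q. simpl. field.
      split; [apply circle_minus_neq_0, Hx|exact Hx0].
    * apply is_cderive_mult; [apply is_cderive_const|].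
      apply is_cderive_cauchy_int; [left; reflexivity|rewrite Cmod_0; lra|exact Hq].
  + destruct (Hf z Hz) as [k Hk]. exact (is_cderive_slope f 0 _ z k Hz0 Hk).
- intros z. destruct (Ceq_dec z 0) as [->|Hz0].
  + rewrite Hf0. ring.
  + rewrite slope_neq, Hf0 by exact Hz0. field. exact Hz0.
Qed.

Lemma analytic_pow (f : C -> C) (n : nat) : analytic_on_disk f ->
  analytic_on_disk (fun z => f z ^ n)%C.
Proof.
intros Hf z Hz. induction n as [|n [k Hk]].
- exists (RtoC 0). exact (is_cderive_const (RtoC 1) z).
- destruct (Hf z Hz) as [l Hl].
  exact (ex_intro _ _ (is_cderive_mult f (fun z => f z ^ n)%C z l k Hl Hk)).
Qed.

(* Cauchy's formula bounds [|f a|^n] by [M^n] up to a constant independent of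
   [n], and taking [n]-th roots removes the constant. *)
Lemma maximum_principle (f : C -> C) (r M : R) (a : C) :
  analytic_on_disk f -> 0 < r < 1 -> Cmod a < r -> 0 < M ->
  (forall t, Cmod (f (circle r t)) <= M) -> Cmod (f a) <= M.
Proof.
intros Hf Hr Ha HM Hb. apply Rnot_lt_le. intros Hlt.
assert (Hpi := PI_RGT_0).
set (k := r / (r - Cmod a)).
assert (Hk : 0 < k) by (apply Rdiv_lt_0_compat; lra).
assert (B : forall n, Cmod (f a) ^ n <= k * M ^ n).
{ intros n.
  assert (I := cauchy_formula (fun z => f z ^ n)%C r a (analytic_pow f n Hf) Hr Ha).
  apply Cmod_is_CInt_le with (M := M ^ n * k) in I.
  - rewrite Cmod_mult, Cmod_R, Rminus_0_r, Cmod_pow in I.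
    rewrite Rabs_pos_eq in I by lra.
    rewrite (Rmult_comm k). apply Rmult_le_reg_l with (2 * PI); lra.
  - intros t _. rewrite Cmod_mult, Cmod_pow.
    apply Rmult_le_compat; [apply pow_le, Cmod_ge_0|apply Cmod_ge_0| |].
    + apply pow_incr. split; [apply Cmod_ge_0|apply Hb].
    + unfold Cdiv. rewrite Cmod_mult, Cmod_circle by lra.
      apply Rmult_le_compat_l; [lra|]. apply Cmod_kernel_le; lra. }
set (x := M / Cmod (f a)).
assert (Hx : 0 < x < 1).
{ unfold x. split; [apply Rdiv_lt_0_compat; lra|].
  apply Rmult_lt_reg_r with (Cmod (f a)); [lra|].
  unfold Rdiv. rewrite Rmult_assoc, Rinv_l; lra. }
destruct (pow_lt_1_zero x) with (y := / k) as [n Hn].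
{ rewrite Rabs_pos_eq; lra. }
{ apply Rinv_0_lt_compat, Hk. }
specialize (Hn n (le_n n)). specialize (B n).
rewrite Rabs_pos_eq in Hn by (apply pow_le; lra).
assert (P : 0 < Cmod (f a) ^ n) by (apply pow_lt; lra).
replace (M ^ n) with (x ^ n * Cmod (f a) ^ n) in B.
- assert (k * x ^ n < 1).
  { replace 1 with (k * / k) by (field; lra). apply Rmult_lt_compat_l; lra. }
  nra.
- rewrite <- Rpow_mult_distr. f_equal. unfold x. field. lra.
Qed.

Lemma schwarz (f : C -> C) : analytic_on_disk f -> f (RtoC 0) = RtoC 0 ->
  (forall z, in_disk z -> Cmod (f z) <= 1) ->
  exists g, analytic_on_disk g /\ (forall z, f z = (z * g z)%C) /\
    forall z, in_disk z -> Cmod (g z) <= 1.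
Proof.
intros Hf Hf0 Hb. destruct (analytic_factor f Hf Hf0) as [g [Hg E]].
exists g. split; [exact Hg|]. split; [exact E|].
intros z Hz. unfold in_disk in Hz. pose proof (Cmod_ge_0 z) as Hz0.
apply Rnot_lt_le. intros Hlt.
assert (Hi : / Cmod (g z) < 1) by (rewrite <- Rinv_1; apply Rinv_lt_contravar; lra).
(* On the circle of radius [r] the bound on [f] gives [|g| <= 1/r]. A contradiction needs [r > |z|],
   to apply the maximum principle at [z], and [1/r < |g z|]. *)
set (s := Rmax (Cmod z) (/ Cmod (g z))).
assert (Hs : s < 1) by (apply Rmax_lub_lt; assumption).
assert (Hs1 : Cmod z <= s) by apply Rmax_l.
assert (Hs2 : / Cmod (g z) <= s) by apply Rmax_r.
assert (Hs0 : 0 < / Cmod (g z)) by (apply Rinv_0_lt_compat; lra).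
set (r := (1 + s) / 2).
assert (Hr : s < r < 1) by (unfold r; lra).
assert (K : Cmod (g z) <= / r).
{ apply maximum_principle with (r := r); [exact Hg|lra|lra|apply Rinv_0_lt_compat; lra|].
  intros t. assert (L := Hb _ (in_disk_circle r t ltac:(lra))).
  rewrite E, Cmod_mult, Cmod_circle in L by lra.
  apply Rmult_le_reg_l with r; [lra|]. rewrite Rinv_r by lra. exact L. }
apply Rinv_le_contravar in K; [|lra]. rewrite Rinv_inv in K. lra.
Qed.

(** * The Schwarz-Pick lemma *)

Lemma moebius_identity (a z : C) :
  Cmod (1 + Cconj a * z) ^ 2 - Cmod (z + a) ^ 2 =
  (1 - Cmod a ^ 2) * (1 - Cmod z ^ 2).
Proof.
rewrite !Cmod2_alt. destruct a as [a1 a2], z as [x y].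
unfold Cconj, Cplus, Cmult, RtoC; simpl. ring.
Qed.

Lemma moebius_denominator (a z : C) : Cmod a < 1 -> Cmod z <= 1 ->
  (1 + Cconj a * z)%C <> RtoC 0.
Proof.
intros Ha Hz. apply (C_neq_0_of_close _ 1). rewrite Cmod_1.
replace (1 + Cconj a * z - 1)%C with (Cconj a * z)%C by ring.
rewrite Cmod_mult, Cmod_conj.
pose proof (Cmod_ge_0 a). pose proof (Cmod_ge_0 z). nra.
Qed.

Lemma moebius_le_1 (a z : C) : Cmod a < 1 -> Cmod z <= 1 ->
  Cmod ((z + a) / (1 + Cconj a * z)) <= 1.
Proof.
intros Ha Hz. assert (N := moebius_denominator a z Ha Hz).
rewrite Cmod_div by exact N.
assert (P : 0 < Cmod (1 + Cconj a * z)) by (apply Cmod_gt_0, N).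
apply Rmult_le_reg_r with (Cmod (1 + Cconj a * z)); [exact P|].
unfold Rdiv. rewrite Rmult_assoc, Rinv_l, Rmult_1_r, Rmult_1_l by lra.
generalize (moebius_identity a z).
pose proof (Cmod_ge_0 a). pose proof (Cmod_ge_0 z).
pose proof (Cmod_ge_0 (z + a)).
assert (0 <= (1 - Cmod a ^ 2) * (1 - Cmod z ^ 2)) by (apply Rmult_le_pos; nra).
nra.
Qed.

Lemma moebius_lt_1 (a z : C) : Cmod a < 1 -> Cmod z < 1 ->
  Cmod ((z + a) / (1 + Cconj a * z)) < 1.
Proof.
intros Ha Hz. assert (N := moebius_denominator a z Ha (Rlt_le _ _ Hz)).
rewrite Cmod_div by exact N.
assert (P : 0 < Cmod (1 + Cconj a * z)) by (apply Cmod_gt_0, N).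
apply Rmult_lt_reg_r with (Cmod (1 + Cconj a * z)); [exact P|].
unfold Rdiv. rewrite Rmult_assoc, Rinv_l, Rmult_1_r, Rmult_1_l by lra.
generalize (moebius_identity a z).
pose proof (Cmod_ge_0 a). pose proof (Cmod_ge_0 z).
pose proof (Cmod_ge_0 (z + a)).
assert (0 < (1 - Cmod a ^ 2) * (1 - Cmod z ^ 2)) by (apply Rmult_lt_0_compat; nra).
nra.
Qed.

Lemma is_cderive_moebius (a z : C) : (1 + Cconj a * z)%C <> RtoC 0 ->
  is_cderive (fun z => (z + a) / (1 + Cconj a * z))%C z
    ((1 - a * Cconj a) / ((1 + Cconj a * z) * (1 + Cconj a * z)))%C.
Proof.
intros N. eapply is_cderive_eq.
- apply (is_cderive_div (fun z => z + a)%C (fun z => 1 + Cconj a * z)%C);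
  [exact N| |].
  + apply is_cderive_plus; [apply is_cderive_id|apply is_cderive_const].
  + apply is_cderive_plus; [apply is_cderive_const|].
    apply is_cderive_mult; [apply is_cderive_const|apply is_cderive_id].
- cbv beta. field. exact N.
Qed.

Lemma one_minus_mult_conj (a : C) : (1 - a * Cconj a)%C = RtoC (1 - Cmod a ^ 2).
Proof. rewrite <- Cmod2_conj, RtoC_minus. reflexivity. Qed.

(** Moebius maps [T], sending 0 to [a], and [U], sending [g a] to 0, turn [g] into a function [G]
    fixing 0. The Schwarz lemma bounds [G'(0)] by 1, and the chain rule with [T'(0) = 1 - |a|^2] and
    [U'(g a) = 1 / (1 - |g a|^2)] gives the claim. *)
Lemma schwarz_pick_lt (g : C -> C) (a l : C) : analytic_on_disk g ->
  (forall z, in_disk z -> Cmod (g z) <= 1) -> in_disk a -> Cmod (g a) < 1 ->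
  is_cderive g a l -> Cmod l * (1 - Cmod a ^ 2) <= 1 - Cmod (g a) ^ 2.
Proof.
intros Hg Hb Ha Hga Hl. unfold in_disk in Ha.
set (b := g a) in *.
assert (Hmb : Cmod (- b) < 1) by (rewrite Cmod_opp; exact Hga).
set (T := fun z => ((z + a) / (1 + Cconj a * z))%C).
set (U := fun z => ((z + - b) / (1 + Cconj (- b) * z))%C).
set (G := fun z => U (g (T z))).
assert (HT : forall z, in_disk z -> in_disk (T z))
  by (intros z Hz; apply moebius_lt_1; assumption).
assert (HT0 : T (RtoC 0) = a).
{ unfold T. replace (1 + Cconj a * 0)%C with (RtoC 1) by ring. field. }
assert (D0 : in_disk (RtoC 0)) by (unfold in_disk; rewrite Cmod_0; lra).
assert (HG : analytic_on_disk G).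
{ intros z Hz. destruct (Hg (T z) (HT z Hz)) as [k Hk].
  eexists. apply (is_cderive_comp U (fun z => g (T z))).
  - apply is_cderive_moebius, moebius_denominator; [exact Hmb|apply Hb, HT, Hz].
  - apply (is_cderive_comp g T); [exact Hk|].
    apply is_cderive_moebius, moebius_denominator; [exact Ha|left; exact Hz]. }
assert (HG0 : G (RtoC 0) = RtoC 0).
{ unfold G. rewrite HT0. unfold U. fold b.
  replace (b + - b)%C with (RtoC 0) by ring. unfold Cdiv. ring. }
destruct (schwarz G HG HG0) as [k [Hk [Ek Bk]]].
{ intros z Hz. apply moebius_le_1; [exact Hmb|apply Hb, HT, Hz]. }
assert (D1 : is_cderive G (RtoC 0) (k (RtoC 0))).
{ apply is_derive_ext with (f := fun z => (z * k z)%C); [intros t; symmetry; apply Ek|].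
  destruct (Hk _ D0) as [k' Hk']. eapply is_cderive_eq.
  - apply is_cderive_mult; [apply is_cderive_id|exact Hk'].
  - cbv beta. ring. }
assert (Pa : 0 < 1 - Cmod a ^ 2) by (pose proof (Cmod_ge_0 a); nra).
assert (Pb : 0 < 1 - Cmod b ^ 2) by (pose proof (Cmod_ge_0 b); nra).
assert (Nb : RtoC (1 - Cmod b ^ 2) <> RtoC 0)
  by (intros H; apply RtoC_inj in H; lra).
assert (D2 : is_cderive G (RtoC 0)
  (/ RtoC (1 - Cmod b ^ 2) * (l * RtoC (1 - Cmod a ^ 2)))%C).
{ eapply is_cderive_eq.
  - apply (is_cderive_comp U (fun z => g (T z))).
    + rewrite HT0. fold b. apply is_cderive_moebius, moebius_denominator;
        [exact Hmb|left; exact Hga].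
    + apply (is_cderive_comp g T).
      * rewrite HT0. exact Hl.
      * apply is_cderive_moebius, moebius_denominator; [exact Ha|left; exact D0].
  - rewrite Copp_conj.
    replace (1 + - Cconj b * b)%C with (1 - b * Cconj b)%C by ring.
    replace (1 - - b * - Cconj b)%C with (1 - b * Cconj b)%C by ring.
    replace (1 + Cconj a * 0)%C with (RtoC 1) by ring.
    rewrite !one_minus_mult_conj. field. exact Nb. }
assert (E : k (RtoC 0) = (/ RtoC (1 - Cmod b ^ 2) * (l * RtoC (1 - Cmod a ^ 2)))%C).
{ rewrite <- (is_C_derive_unique _ _ _ D1). apply is_C_derive_unique, D2. }
assert (B := Bk _ D0). rewrite E, !Cmod_mult, Cmod_inv, !Cmod_R in B by exact Nb.
rewrite !Rabs_pos_eq in B by lra.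
apply Rmult_le_reg_l with (/ (1 - Cmod b ^ 2)); [apply Rinv_0_lt_compat, Pb|].
rewrite Rinv_l by lra. exact B.
Qed.

(** The case [|g a| = 1] does occur, since [w z / z] is constant for a rotation [w], and the Moebius
    map then degenerates. Scaling [g] by [t < 1] and letting [t] approach 1 covers it. *)
Lemma schwarz_pick (g : C -> C) (a l : C) : analytic_on_disk g ->
  (forall z, in_disk z -> Cmod (g z) <= 1) -> in_disk a ->
  is_cderive g a l -> Cmod l * (1 - Cmod a ^ 2) <= 1 - Cmod (g a) ^ 2.
Proof.
intros Hg Hb Ha Hl.
set (A := Cmod l * (1 - Cmod a ^ 2)). set (B := Cmod (g a) ^ 2).
assert (HA : 0 <= A).
{ apply Rmult_le_pos; [apply Cmod_ge_0|].
  unfold in_disk in Ha. pose proof (Cmod_ge_0 a). nra. }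
assert (HB : 0 <= B) by apply pow2_ge_0.
assert (K : forall t, 0 < t < 1 -> t * A <= 1 - t ^ 2 * B).
{ intros t Ht.
  assert (Bt : forall z, in_disk z -> Cmod (RtoC t * g z) <= t).
  { intros z Hz. rewrite Cmod_mult, Cmod_R, Rabs_pos_eq by lra.
    specialize (Hb z Hz). nra. }
  assert (L := schwarz_pick_lt (fun z => RtoC t * g z)%C a (RtoC t * l)%C).
  cbv beta in L. rewrite !Cmod_mult, Cmod_R, Rabs_pos_eq in L by lra.
  replace (t * A) with (t * Cmod l * (1 - Cmod a ^ 2)) by (unfold A; ring).
  replace (t ^ 2 * B) with ((t * Cmod (g a)) ^ 2) by (unfold B; ring).
  apply L.
  - intros z Hz. destruct (Hg z Hz) as [k Hk]. eexists.
    apply (is_cderive_mult (fun _ => RtoC t) g); [apply is_cderive_const|exact Hk].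
  - intros z Hz. specialize (Bt z Hz). lra.
  - exact Ha.
  - specialize (Bt a Ha). rewrite Cmod_mult, Cmod_R, Rabs_pos_eq in Bt by lra. lra.
  - eapply is_cderive_eq; [apply is_cderive_mult; [apply is_cderive_const|exact Hl]|].
    cbv beta. ring. }
apply Rnot_lt_le. intros Hlt.
(* The midpoint [t] of [s] and 1 satisfies [s < t^2 <= t], hence
   [t A + t^2 B >= t^2 (A + B) > 1]. *)
set (s := / (A + B)).
assert (Hs : 0 < s < 1).
{ unfold s. split; [apply Rinv_0_lt_compat; lra|].
  rewrite <- Rinv_1. apply Rinv_lt_contravar; lra. }
assert (Es : s * (A + B) = 1) by (unfold s; field; lra).
specialize (K ((1 + s) / 2) ltac:(lra)).
set (t := (1 + s) / 2) in *.
assert (Ht : s < t ^ 2) by (unfold t; nra).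
assert (Ht1 : t ^ 2 <= t) by (unfold t; nra).
assert (t ^ 2 * A <= t * A) by (apply Rmult_le_compat_r; lra).
assert (s * (A + B) < t ^ 2 * (A + B)) by (apply Rmult_lt_compat_r; lra).
lra.
Qed.

(** With [w = z g] one has [z w' - w = z^2 g'], so Schwarz-Pick for [g] is to be multiplied by
    [|z|^2]. *)
Lemma schwarz_second_order (w : C -> C) (z l : C) : analytic_on_disk w ->
  (forall z, in_disk z -> in_disk (w z)) -> w (RtoC 0) = RtoC 0 ->
  in_disk z -> is_cderive w z l ->
  Cmod (w z) <= Cmod z /\
  Cmod (z * l - w z) * (1 - Cmod z ^ 2) <= Cmod z ^ 2 - Cmod (w z) ^ 2.
Proof.
intros Hw Hd Hw0 Hz Hl.
destruct (schwarz w Hw Hw0) as [g [Hg [E B]]].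
{ intros x Hx. left. exact (Hd x Hx). }
destruct (Hg z Hz) as [k Hk].
assert (El : l = (g z + z * k)%C).
{ rewrite <- (is_C_derive_unique _ _ _ Hl). apply is_C_derive_unique.
  apply is_derive_ext with (f := fun z => (z * g z)%C); [intros t; symmetry; apply E|].
  eapply is_cderive_eq; [apply is_cderive_mult; [apply is_cderive_id|exact Hk]|].
  cbv beta. ring. }
pose proof (Cmod_ge_0 z) as Pz.
split.
- rewrite E, Cmod_mult. specialize (B z Hz). nra.
- assert (P := schwarz_pick g z k Hg B Hz Hk).
  rewrite El, E.
  replace (z * (g z + z * k) - z * g z)%C with (z * z * k)%C by ring.
  rewrite !Cmod_mult.
  replace (Cmod z ^ 2 - (Cmod z * Cmod (g z)) ^ 2) with
    (Cmod z * Cmod z * (1 - Cmod (g z) ^ 2)) by ring.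
  rewrite Rmult_assoc. apply Rmult_le_compat_l; [nra|exact P].
Qed.

(** * Logarithmic derivatives of the three generators *)

(* [u = w z] and [v = z w'(z)] for a Schwarz function [w] and [r = |z|]. *)
Definition schwarz_pair (r : R) (u v : C) : Prop :=
  Cmod u <= r /\ Cmod (v - u) * (1 - r ^ 2) <= r ^ 2 - Cmod u ^ 2.

(** In [r^2 - |u|^2 = (r - |u|)(r + |u|)] the last factor is at most [2 r]. The hypothesis, which
    means [r <= sqrt 2 - 1], then bounds [|v - u|] by [r - |u|]. *)
Lemma schwarz_pair_exp (r : R) (u v : C) : r < 1 -> 2 * r <= 1 - r ^ 2 ->
  schwarz_pair r u v -> Cmod v <= r.
Proof.
intros Hr Hr2 [Hu Hv]. pose proof (Cmod_ge_0 u) as Pu.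
pose proof (Cmod_ge_0 (v - u)) as Pv.
assert (B : Cmod v <= Cmod (v - u) + Cmod u).
{ replace v with ((v - u) + u)%C at 1 by ring. apply Cmod_triangle. }
cut (Cmod (v - u) <= r - Cmod u); [lra|].
apply Rmult_le_reg_r with (1 - r ^ 2); [nra|].
apply Rle_trans with (1 := Hv). nra.
Qed.

(** From [r + |u| <= 1 + r] follows [|v - u| (1 - r) <= r - |u|], hence
    [|v| (1 - r) <= r (1 - |u|) <= r |1 + u|]. *)
Lemma schwarz_pair_sqrt (r : R) (u v : C) : r < 1 ->
  schwarz_pair r u v -> Cmod (v / (1 + u)) <= r / (1 - r).
Proof.
intros Hr [Hu Hv]. pose proof (Cmod_ge_0 u) as Pu.
pose proof (Cmod_ge_0 (v - u)) as Pv.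
assert (L : 1 - Cmod u <= Cmod (1 + u)).
{ generalize (Cmod_triangle_rev 1 (- u)). rewrite Cmod_1, Cmod_opp.
  replace (1 - - u)%C with (1 + u)%C by ring. lra. }
assert (N : (1 + u)%C <> RtoC 0) by (apply Cmod_gt_0; lra).
rewrite Cmod_div by exact N.
assert (B : Cmod v <= Cmod (v - u) + Cmod u).
{ replace v with ((v - u) + u)%C at 1 by ring. apply Cmod_triangle. }
apply Rmult_le_reg_r with (Cmod (1 + u) * (1 - r)); [apply Rmult_lt_0_compat; lra|].
replace (Cmod v / Cmod (1 + u) * (Cmod (1 + u) * (1 - r))) with (Cmod v * (1 - r))
  by (field; lra).
replace (r / (1 - r) * (Cmod (1 + u) * (1 - r))) with (r * Cmod (1 + u))
  by (field; lra).
apply Rle_trans with (r * (1 - Cmod u)); [|apply Rmult_le_compat_l; lra].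
apply Rle_trans with ((Cmod (v - u) + Cmod u) * (1 - r));
  [apply Rmult_le_compat_r; lra|].
cut (Cmod (v - u) * (1 - r) <= r - Cmod u); [nra|].
apply Rmult_le_reg_r with (1 + r); [lra|].
replace (Cmod (v - u) * (1 - r) * (1 + r)) with (Cmod (v - u) * (1 - r ^ 2)) by ring.
apply Rle_trans with (1 := Hv).
replace (r ^ 2 - Cmod u ^ 2) with ((r - Cmod u) * (r + Cmod u)) by ring.
apply Rmult_le_compat_l; lra.
Qed.

(** For the crescent [z psi'/psi] is [z / sqrt (1 + z^2)], which equals [- hyp_ratio s] at
    [z = -s]. *)
Definition hyp_ratio (s : R) : R := s / sqrt (1 + s ^ 2).

Lemma hyp_ratio_spec (s : R) : 0 <= s ->
  0 <= hyp_ratio s <= s /\ hyp_ratio s ^ 2 * (1 + s ^ 2) = s ^ 2.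
Proof.
intros Hs. unfold hyp_ratio.
assert (H1 : 1 <= sqrt (1 + s ^ 2)).
{ rewrite <- sqrt_1 at 1. apply sqrt_le_1_alt. nra. }
assert (H2 : sqrt (1 + s ^ 2) * sqrt (1 + s ^ 2) = 1 + s ^ 2)
  by (apply sqrt_sqrt; nra).
set (q := sqrt (1 + s ^ 2)) in *.
split; [split|].
- apply Rmult_le_pos; [exact Hs|]. left. apply Rinv_0_lt_compat; lra.
- apply Rmult_le_reg_r with q; [lra|].
  unfold Rdiv. rewrite Rmult_assoc, Rinv_l by lra. nra.
- rewrite <- H2. field. lra.
Qed.

(* For [p = u / sqrt (1 + u^2)] the relation [u^2 = p^2 / (1 - p^2)] gives
   [n^2 = s^4 ((1 + n)^2 - 4 x^2)] with [n = |p|^2], [x = Re p], [s = |u|], so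
   [p] runs on a curve which is more curved at its leftmost point [-m],
   [m = s / sqrt (1 + s^2)], than the circle through [-m] of center [c]. *)
Lemma crescent_curve_bound (p u : C) (c : R) : Cmod u <= 1 / 4 -> 1 / 6 <= c ->
  (p * p * (1 + u * u))%C = (u * u)%C ->
  Cmod (p - RtoC c) <= c + hyp_ratio (Cmod u).
Proof.
intros Hu Hc E. set (s := Cmod u) in *.
assert (Hs : 0 <= s) by apply Cmod_ge_0.
destruct (hyp_ratio_spec s Hs) as [[Hm0 Hm1] Hm2].
set (m := hyp_ratio s) in *.
assert (E' : (u * u * (1 - p * p))%C = (p * p)%C).
{ transitivity (u * u - u * u * (p * p))%C; [ring|]. rewrite <- E at 1. ring. }
apply (f_equal Cmod) in E'. rewrite !Cmod_mult in E'. fold s in E'.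
assert (E4 : s ^ 4 * Cmod (1 - p * p) ^ 2 = (Cmod p ^ 2) ^ 2).
{ replace (s ^ 4 * Cmod (1 - p * p) ^ 2) with ((s * s * Cmod (1 - p * p)) ^ 2) by ring.
  rewrite E'. ring. }
clear E E'.
rewrite !Cmod2_alt in E4.
cut (Cmod (p - RtoC c) ^ 2 <= (c + m) ^ 2).
{ intros K. apply Rsqr_incr_0_var; [|lra]. unfold Rsqr. nra. }
rewrite Cmod2_alt.
destruct p as [x y]. simpl in E4. simpl.
replace (y + - 0) with y by ring.
set (n := x * x + y * y).
assert (E5 : n * n = s ^ 4 * ((1 + n) * (1 + n) - 4 * (x * x))).
{ unfold n. transitivity (s * (s * (s * (s * 1))) *
   ((1 + - (x * x - y * y)) * ((1 + - (x * x - y * y)) * 1) +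
   (0 + - (x * y + y * x)) * ((0 + - (x * y + y * x)) * 1))).
  - rewrite E4. ring.
  - simpl. ring. }
clear E4.
assert (Hn0 : 0 <= n) by (unfold n; nra).
assert (Hx : x * x <= n) by (unfold n; nra).
assert (Hm : m ^ 2 <= s ^ 2) by nra.
assert (Hs2 : 0 <= s ^ 2 <= 1 / 16) by nra.
set (q := s ^ 2) in *. set (M := m ^ 2) in *.
replace (s ^ 4) with (q * q) in E5 by (unfold q; ring).
assert (HM : 0 <= M) by (unfold M; nra).
(* Inserting [0 <= x^2 <= n] into [E5] encloses [n] between [q (1 - n)] and [q (1 + n)]. As
   [M = q (1 - M)], the lower bound amounts to [M <= n]. *)
assert (Hnn : n <= q * (1 + n)).
{ assert (n * n <= (q * (1 + n)) * (q * (1 + n))) by nra.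
  assert (0 <= q * (1 + n)) by (apply Rmult_le_pos; lra). nra. }
assert (Hn1 : n < 1) by nra.
assert (Hn2 : q * (1 - n) <= n).
{ assert ((q * (1 - n)) * (q * (1 - n)) <= n * n) by nra.
  assert (0 <= q * (1 - n)) by (apply Rmult_le_pos; lra). nra. }
assert (Hnu : M <= n) by nra.
replace ((x + - c) * ((x + - c) * 1) + y * (y * 1)) with (n - 2 * c * x + c * c)
  by (unfold n; ring).
replace ((c + m) * ((c + m) * 1)) with (c * c + 2 * c * m + M) by (unfold M; ring).
cut (n - M <= 2 * c * (m + x)); [lra|].
destruct (Rle_dec q 0) as [Hq0|Hq0].
{ assert (q = 0) by lra. assert (n = 0) by nra. assert (x = 0) by nra.
  assert (M = 0) by lra. assert (0 <= c * m) by (apply Rmult_le_pos; lra). nra. }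
(* The leftmost point satisfies the curve equation with [n = x^2 = M]. Subtracting the two equations
   leaves a multiple of [n - M], whose cofactor is smallest at [n = M]. *)
assert (K1 : (n - M) * (1 - 2 * q) <= 2 * q * (M - x * x)).
{ assert (F : 4 * (q * q) * (M - x * x) =
    (n - M) * ((n + M) * (1 - q * q) - 2 * (q * q))).
  { assert (4 * (q * q) * (x * x) = q * q * ((1 + n) * (1 + n)) - n * n) by lra.
    assert (M = q * (1 - M)) by lra.
    assert (4 * (q * q) * M = q * q * ((1 + M) * (1 + M)) - M * M).
    { replace (M * M) with ((q * (1 - M)) * (q * (1 - M))) by (rewrite <- H0; ring).
      ring. }
    replace (4 * (q * q) * (M - x * x)) with
     (4 * (q * q) * M - 4 * (q * q) * (x * x)) by ring.
    rewrite H, H1. ring. }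
  assert (G : 2 * q * (1 - 2 * q) <= (n + M) * (1 - q * q) - 2 * (q * q)).
  { apply Rle_trans with (2 * M * (1 - q * q) - 2 * (q * q)).
    - assert (M * (1 - q * q) = q * (1 - q)).
      { replace (1 - q * q) with ((1 + q) * (1 - q)) by ring.
        rewrite <- Rmult_assoc, Hm2. reflexivity. }
      nra.
    - nra. }
  apply Rmult_le_reg_l with (2 * q); [lra|].
  replace (2 * q * (2 * q * (M - x * x))) with (4 * (q * q) * (M - x * x)) by ring.
  rewrite F.
  replace (2 * q * ((n - M) * (1 - 2 * q))) with ((n - M) * (2 * q * (1 - 2 * q))) by ring.
  apply Rmult_le_compat_l; lra. }
assert (Hmx : 0 <= m + x).
{ assert (0 <= (n - M) * (1 - 2 * q)) by (apply Rmult_le_pos; lra).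
  assert (x * x <= m * m) by (unfold M in *; nra). nra. }
assert (K2 : M - x * x <= (m + x) * (2 * m)).
{ replace (M - x * x) with ((m + x) * (m - x)) by (unfold M; ring).
  apply Rmult_le_compat_l; [exact Hmx|].
  assert (0 <= (n - M) * (1 - 2 * q)) by (apply Rmult_le_pos; lra).
  assert (x * x <= m * m) by (unfold M in *; nra). nra. }
assert (Hm4 : m <= 1 / 4) by lra.
assert (K3 : (n - M) * (1 - 2 * q) <= (m + x) * (4 * q * m)).
{ apply Rle_trans with (1 := K1).
  replace ((m + x) * (4 * q * m)) with (2 * q * ((m + x) * (2 * m))) by ring.
  apply Rmult_le_compat_l; lra. }
(* With [1 - 2 q >= 7/8] this leaves [n - M <= (m + x) / 14], well below [2 c (m + x)], where
   [2 c >= 1/3]. *)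
assert (K4 : 4 * q * m <= 1 / 16).
{ assert (q * m <= 1 / 16 * (1 / 4)) by (apply Rmult_le_compat; lra). lra. }
assert (K5 : (m + x) * (4 * q * m) <= (m + x) * (1 / 16))
  by (apply Rmult_le_compat_l; lra).
assert (K6 : (m + x) * (1 / 6) <= (m + x) * c) by (apply Rmult_le_compat_l; lra).
nra.
Qed.

(** For the values [a], [b] at [s], [r], the difference [b^2 - a^2] is
    [(r^2 - s^2) / ((1 + r^2)(1 + s^2))], and [a + b <= 1/2] is small enough to make up for the
    factor [(1 - r^2)^2]. *)
Lemma hyp_ratio_diff (s r : R) : 0 <= s <= r -> r <= 1 / 4 ->
  (r ^ 2 - s ^ 2) * (1 / (1 - r ^ 2) ^ 2) <= hyp_ratio r - hyp_ratio s.
Proof.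
intros Hs Hr.
destruct (hyp_ratio_spec s) as [[A1 A2] A3]; [lra|].
destruct (hyp_ratio_spec r) as [[B1 B2] B3]; [lra|].
set (a := hyp_ratio s) in *. set (b := hyp_ratio r) in *.
assert (Hr2 : 0 <= r ^ 2 <= 1 / 16) by nra.
assert (Hs2 : 0 <= s ^ 2 <= r ^ 2) by nra.
destruct (Req_dec r 0) as [->|Hr0].
{ assert (s = 0) by lra. subst s. unfold a, b. lra. }
assert (D : (b - a) * (b + a) * ((1 + r ^ 2) * (1 + s ^ 2)) = r ^ 2 - s ^ 2).
{ transitivity (b ^ 2 * (1 + r ^ 2) * (1 + s ^ 2) - a ^ 2 * (1 + s ^ 2) * (1 + r ^ 2));
  [ring|]. rewrite A3, B3. ring. }
assert (P : 0 < (1 + r ^ 2) * (1 + s ^ 2)) by (apply Rmult_lt_0_compat; lra).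
assert (Hb : 0 < b).
{ destruct (Req_dec b 0) as [Eb|]; [|lra]. rewrite Eb in B3. nra. }
assert (Hba : 0 <= b - a).
{ assert (0 <= (b - a) * ((b + a) * ((1 + r ^ 2) * (1 + s ^ 2)))) by nra.
  assert (0 < (b + a) * ((1 + r ^ 2) * (1 + s ^ 2))) by (apply Rmult_lt_0_compat; lra).
  nra. }
rewrite <- D.
assert (Q : (b + a) * ((1 + r ^ 2) * (1 + s ^ 2)) <= (1 - r ^ 2) ^ 2).
{ apply Rle_trans with (1 / 2 * (17 / 16 * (17 / 16))).
  - apply Rmult_le_compat; try lra. apply Rmult_le_compat; lra.
  - nra. }
assert (PQ : 0 < (1 - r ^ 2) ^ 2) by nra.
apply Rmult_le_reg_r with ((1 - r ^ 2) ^ 2); [exact PQ|].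
replace ((b - a) * (b + a) * ((1 + r ^ 2) * (1 + s ^ 2)) * (1 / (1 - r ^ 2) ^ 2) *
  (1 - r ^ 2) ^ 2) with ((b - a) * ((b + a) * ((1 + r ^ 2) * (1 + s ^ 2))))
  by (field; nra).
apply Rmult_le_compat_l; assumption.
Qed.

Lemma re_1_plus_sqr (u : C) : Cmod u < 1 -> 0 < Re (1 + u * u).
Proof.
intros Hu. generalize (re_ge_minus 1 (1 + u * u)).
replace (1 + u * u - 1)%C with (u * u)%C by ring.
rewrite Cmod_mult. simpl Re at 1. pose proof (Cmod_ge_0 u). nra.
Qed.

Lemma Csqrt_neq_0 (z : C) : 0 < Re z -> Csqrt z <> RtoC 0.
Proof.
intros H E. assert (K := Csqrt_re_gt_0 z H). rewrite E in K. simpl in K. lra.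
Qed.

(** In [v / S = u / S + (v - u) / S] the first term lies in the disk belonging to [|u|], and the
    growth of [hyp_ratio] from [|u|] to [r] pays for the second. *)
Lemma schwarz_pair_crescent (r : R) (u v : C) (c : R) : r <= 1 / 4 -> 1 / 6 <= c ->
  schwarz_pair r u v ->
  Cmod (v / Csqrt (1 + u * u) - RtoC c) <= c + hyp_ratio r.
Proof.
intros Hr Hc [Hu Hv]. pose proof (Cmod_ge_0 u) as Pu.
pose proof (Cmod_ge_0 (v - u)) as Pv.
set (S := Csqrt (1 + u * u)).
assert (ES : (S * S)%C = (1 + u * u)%C) by apply Csqrt_sqr.
assert (NS : S <> RtoC 0) by (apply Csqrt_neq_0, re_1_plus_sqr; lra).
assert (Hr2 : 0 <= r ^ 2 <= 1 / 16) by nra.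
assert (Hu2 : 0 <= Cmod u ^ 2 <= r ^ 2) by nra.
assert (LS : 1 - r ^ 2 <= Cmod S).
{ assert (Q : 1 - Cmod u ^ 2 <= Cmod S * Cmod S).
  { rewrite <- Cmod_mult, ES.
    generalize (Cmod_triangle_rev 1 (- (u * u))).
    rewrite Cmod_1, Cmod_opp, Cmod_mult.
    replace (1 - - (u * u))%C with (1 + u * u)%C by ring. lra. }
  pose proof (Cmod_ge_0 S). nra. }
assert (B1 : Cmod (u / S - RtoC c) <= c + hyp_ratio (Cmod u)).
{ apply crescent_curve_bound; try lra.
  rewrite <- ES. field. exact NS. }
assert (B2 : Cmod ((v - u) / S) <= hyp_ratio r - hyp_ratio (Cmod u)).
{ eapply Rle_trans; [|apply hyp_ratio_diff; lra].
  rewrite Cmod_div by exact NS.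
  assert (P1 : 0 < 1 - r ^ 2) by lra.
  apply Rmult_le_reg_r with (Cmod S); [lra|].
  unfold Rdiv at 1. rewrite Rmult_assoc, Rinv_l, Rmult_1_r by lra.
  apply Rmult_le_reg_r with (1 - r ^ 2); [exact P1|].
  apply Rle_trans with (1 := Hv).
  replace ((r ^ 2 - Cmod u ^ 2) * (1 / (1 - r ^ 2) ^ 2) * Cmod S * (1 - r ^ 2))
    with ((r ^ 2 - Cmod u ^ 2) * (Cmod S / (1 - r ^ 2))) by (field; lra).
  rewrite <- (Rmult_1_r (r ^ 2 - Cmod u ^ 2)) at 1.
  apply Rmult_le_compat_l; [lra|].
  apply Rmult_le_reg_r with (1 - r ^ 2); [exact P1|].
  unfold Rdiv. rewrite Rmult_assoc, Rinv_l by lra. lra. }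
replace (v / S - RtoC c)%C with ((u / S - RtoC c) + (v - u) / S)%C
  by (field; exact NS).
eapply Rle_trans; [apply Cmod_triangle|]. lra.
Qed.

(** * A disk inside the exponential image of the unit disk *)

Lemma cosh_le (x y : R) : 0 <= x <= y -> cosh x <= cosh y.
Proof.
intros H. unfold cosh. rewrite !exp_Ropp.
assert (X : 1 <= exp x) by (generalize (exp_ineq1_le x); lra).
assert (Y : exp x <= exp y).
{ destruct (Req_dec x y) as [->|]; [lra|]. left. apply exp_increasing. lra. }
set (a := exp x) in *. set (b := exp y) in *.
assert (b + / b - (a + / a) = (b - a) * (1 - / (a * b))) by (field; lra).
assert (/ (a * b) <= 1) by (rewrite <- Rinv_1; apply Rinv_le_contravar; nra).
assert (0 <= (b - a) * (1 - / (a * b))) by (apply Rmult_le_pos; lra).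
lra.
Qed.

Lemma cosh_abs (x : R) : cosh (Rabs x) = cosh x.
Proof.
unfold Rabs. destruct (Rcase_abs x); [|reflexivity].
unfold cosh. rewrite Ropp_involutive. lra.
Qed.

Lemma cosh_gt_0 (x : R) : 0 < cosh x.
Proof. unfold cosh. pose proof (exp_pos x). pose proof (exp_pos (- x)). lra. Qed.

Lemma sinh_le_mult_cosh (x : R) : 0 <= x -> sinh x <= x * cosh x.
Proof.
intros [H|<-].
- destruct (MVT_cor2 sinh cosh 0 x H (fun c _ => derivable_pt_lim_sinh c))
    as [c [E Hc]].
  rewrite sinh_0 in E.
  assert (cosh c <= cosh x) by (apply cosh_le; lra). nra.
- rewrite sinh_0. lra.
Qed.

Lemma mult_cos_le_sin (x : R) : 0 <= x <= 1 -> x * cos x <= sin x.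
Proof.
intros [[H|<-] H1].
- destruct (MVT_cor2 sin cos 0 x H (fun c _ => derivable_pt_lim_sin c))
    as [c [E Hc]].
  rewrite sin_0 in E.
  assert (cos x <= cos c) by (apply cos_decr_1; pose proof PI_RGT_0;
    pose proof PI2_1; lra). nra.
- rewrite sin_0. lra.
Qed.

(* The quotient [cosh (cos th) / cos (sin th)] increases on [[0, pi/2]]: its
   logarithmic derivative is [cos th tan (sin th) - sin th tanh (cos th)], where
   [tan y >= y] and [tanh x <= x]. *)
Lemma cosh_cos_ge (th : R) : 0 <= th <= PI / 2 ->
  cosh 1 * cos (sin th) <= cosh (cos th).
Proof.
assert (HPI := PI2_1).
assert (P : forall x, 0 < cos (sin x)).
{ intros x. pose proof (SIN_bound x). apply cos_gt_0; lra. }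
assert (D : forall x, is_derive (fun x => cosh (cos x) / cos (sin x)) x
  ((- sin x * sinh (cos x) * cos (sin x) + cosh (cos x) * (sin (sin x) * cos x))
   / (cos (sin x)) ^ 2)).
{ intros x. unfold cosh, sinh. specialize (P x). auto_derive; [lra|]. field. lra. }
intros [[H|<-] H1].
- destruct (MVT_cor2 (fun x => cosh (cos x) / cos (sin x)) _ 0 th H
    (fun c _ => proj1 (is_derive_Reals _ _ _) (D c))) as [c [E Hc]].
  rewrite sin_0, cos_0 in E.
  assert (Sc : 0 <= sin c <= 1).
  { split; [apply sin_ge_0; lra|apply SIN_bound]. }
  assert (Cc : 0 <= cos c) by (apply cos_ge_0; lra).
  assert (K1 := sinh_le_mult_cosh (cos c) Cc).
  assert (K2 := mult_cos_le_sin (sin c) Sc).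
  pose proof (P c) as P1. pose proof (cosh_gt_0 (cos c)) as P2.
  assert (N : 0 <= - sin c * sinh (cos c) * cos (sin c) +
    cosh (cos c) * (sin (sin c) * cos c)).
  { assert (sin c * cos (sin c) * sinh (cos c) <=
      sin c * cos (sin c) * (cos c * cosh (cos c))).
    { apply Rmult_le_compat_l; [apply Rmult_le_pos; lra|exact K1]. }
    assert (cos c * cosh (cos c) * (sin c * cos (sin c)) <=
      cos c * cosh (cos c) * sin (sin c)).
    { apply Rmult_le_compat_l; [apply Rmult_le_pos; lra|exact K2]. }
    lra. }
  assert (0 <= (- sin c * sinh (cos c) * cos (sin c) +
    cosh (cos c) * (sin (sin c) * cos c)) / cos (sin c) ^ 2 * (th - 0)).
  { apply Rmult_le_pos; [|lra]. apply Rmult_le_pos; [exact N|].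
    left. apply Rinv_0_lt_compat. nra. }
  specialize (P th).
  apply Rmult_le_reg_r with (/ cos (sin th)); [apply Rinv_0_lt_compat, P|].
  rewrite Rmult_assoc, Rinv_r by lra.
  unfold Rdiv in *. lra.
- rewrite sin_0, cos_0. lra.
Qed.

(** Monotonicity reduces the claim to the unit circle, parametrized by [th = asin |t|], if
    [|t| <= 1]. For larger [|t|] the point [th = pi/2], that is [cosh 1 cos 1 <= cosh 0],
    suffices. *)
Lemma cosh_ge_cos (s t : R) : 1 <= s ^ 2 + t ^ 2 -> - (PI / 2) < t < PI / 2 ->
  cosh 1 * cos t <= cosh s.
Proof.
intros Hst Ht. assert (HPI := PI2_1).
rewrite <- (cosh_abs s).
assert (Ec : cos t = cos (Rabs t)).
{ unfold Rabs. destruct (Rcase_abs t); [rewrite cos_neg|]; reflexivity. }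
rewrite Ec.
assert (Ht' : 0 <= Rabs t < PI / 2) by (split; [apply Rabs_pos|apply Rabs_def1; lra]).
assert (Hst' : 1 <= Rabs s ^ 2 + Rabs t ^ 2) by (rewrite !pow2_abs; exact Hst).
assert (Hs' := Rabs_pos s).
set (a := Rabs s) in *. set (b := Rabs t) in *. clear Hst Ht Ec.
pose proof (cosh_gt_0 1) as P.
destruct (Rle_dec 1 b) as [Hb|Hb].
- apply Rle_trans with (cosh 1 * cos 1).
  + apply Rmult_le_compat_l; [lra|]. apply cos_decr_1; lra.
  + assert (K := cosh_cos_ge (PI / 2) ltac:(lra)).
    rewrite sin_PI2, cos_PI2 in K. apply Rle_trans with (1 := K).
    apply cosh_le. lra.
- assert (K := cosh_cos_ge (asin b)).
  rewrite sin_asin, cos_asin in K by lra.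
  apply Rle_trans with (cosh (sqrt (1 - Rsqr b))).
  + apply K. split; [|apply asin_bound].
    apply Rnot_lt_le. intros Hneg. pose proof (asin_bound b).
    assert (Hsin := sin_lt_0_var (asin b) ltac:(lra) Hneg).
    rewrite sin_asin in Hsin; lra.
  + apply cosh_le. split; [apply sqrt_pos|].
    rewrite <- (sqrt_square a Hs'). apply sqrt_le_1_alt. unfold Rsqr. nra.
Qed.

(* Writing a point of the disk as [exp (s + i t)], membership reads
   [cosh s < cosh 1 cos t]. *)
Lemma disk_in_exp_disk (q : C) : Cmod (q - RtoC (cosh 1)) < sinh 1 ->
  0 < Re q /\ in_disk (Clog q).
Proof.
intros H.
assert (He : 0 < exp 1) by apply exp_pos.
assert (Ei : cosh 1 - sinh 1 = / exp 1) by (unfold cosh, sinh; rewrite exp_Ropp; lra).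
assert (E1 : cosh 1 ^ 2 - sinh 1 ^ 2 = 1).
{ unfold cosh, sinh. rewrite exp_Ropp. field. lra. }
assert (Hre : 0 < Re q).
{ generalize (re_ge_minus (RtoC (cosh 1)) q). rewrite re_RtoC.
  assert (0 < / exp 1) by (apply Rinv_0_lt_compat, He). lra. }
split; [exact Hre|].
unfold in_disk. apply Rnot_le_lt. intros Hge.
set (w := Clog q) in *.
assert (Ew : Cexp w = q) by (apply Cexp_Clog, Hre).
assert (Ht : - (PI / 2) < Im w < PI / 2).
{ generalize (atan_bound (Im q / Re q)). unfold w, Clog; simpl. lra. }
assert (Hst : 1 <= Re w ^ 2 + Im w ^ 2) by (rewrite <- Cmod2_alt; nra).
assert (K := cosh_ge_cos _ _ Hst Ht).
assert (H2 : Cmod (q - RtoC (cosh 1)) ^ 2 < sinh 1 ^ 2).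
{ pose proof (Cmod_ge_0 (q - RtoC (cosh 1))). nra. }
rewrite Cmod2_alt in H2. unfold Cminus in H2.
rewrite re_plus, im_plus, re_opp, im_opp, re_RtoC, im_RtoC in H2.
assert (Eq2 := Cmod2_alt q). rewrite <- Ew in Eq2 at 1. rewrite Cmod_Cexp in Eq2.
assert (Er : Re q = exp (Re w) * cos (Im w)) by (rewrite <- Ew; reflexivity).
set (x := exp (Re w)) in *.
assert (Hx : 0 < x) by apply exp_pos.
assert (Ec : 2 * x * cosh (Re w) = x ^ 2 + 1).
{ unfold cosh. rewrite exp_Ropp. fold x. field. lra. }
assert (H3 : x ^ 2 - 2 * cosh 1 * Re q + 1 < 0) by nra.
rewrite Er in H3.
assert (x * (cosh 1 * cos (Im w)) <= x * cosh (Re w)) by (apply Rmult_le_compat_l; lra).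
nra.
Qed.

(** * Radius of a class defined by two generators *)

Lemma Cdiv_0_r (x : C) : (x / 0)%C = RtoC 0.
Proof.
unfold Cdiv, Cinv, Cmult, RtoC; simpl. unfold Rdiv.
rewrite !Ropp_0, !Rmult_0_l. f_equal; ring.
Qed.

Lemma in_disk_0 : in_disk (RtoC 0).
Proof. unfold in_disk. rewrite Cmod_0. lra. Qed.

Lemma is_cderive_ext_disk (f g : C -> C) (z l : C) : in_disk z ->
  (forall x, in_disk x -> f x = g x) -> is_cderive f z l -> is_cderive g z l.
Proof.
intros Hz He. unfold in_disk in *.
apply is_cderive_ext_loc with (d := 1 - Cmod z); [lra|].
intros x Hx. apply He. generalize (Cmod_triangle_rev x z). lra.
Qed.

(** [lam] is the logarithmic derivative of [psi]. *)
Definition is_generator (psi lam : C -> C) : Prop :=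
  psi (RtoC 0) = RtoC 1 /\
  forall u, in_disk u -> psi u <> RtoC 0 /\ is_cderive psi u (psi u * lam u)%C.

Lemma generator_analytic (psi lam : C -> C) :
  is_generator psi lam -> analytic_on_disk psi.
Proof. intros [_ H] u Hu. eexists. apply H, Hu. Qed.

Lemma subordinate_generator (psi lam f : C -> C) : is_generator psi lam ->
  subordinate f psi ->
  f (RtoC 0) = RtoC 1 /\
  (forall z, in_disk z -> f z <> RtoC 0 /\
    exists u v, schwarz_pair (Cmod z) u v /\
      exists l, is_cderive f z l /\ (z * l)%C = (f z * (v * lam u))%C).
Proof.
intros [H0 H] [Hf [_ [w [Hw [Hd [Hw0 E]]]]]].
split; [rewrite E, Hw0, H0 by exact in_disk_0; reflexivity|].
intros z Hz. rewrite E by exact Hz.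
destruct (H (w z) (Hd z Hz)) as [N D]. split; [exact N|].
destruct (Hw z Hz) as [k Hk].
exists (w z), (z * k)%C. split.
- destruct (schwarz_second_order w z k Hw Hd Hw0 Hz Hk). split; assumption.
- exists (psi (w z) * lam (w z) * k)%C. split; [|ring].
  apply is_cderive_ext_disk with (f := fun z => psi (w z)); [exact Hz| |].
  + intros x Hx. symmetry. apply E, Hx.
  + apply is_cderive_comp; assumption.
Qed.

Lemma class_T_factor (phi psi lphi lpsi f : C -> C) :
  is_generator phi lphi -> is_generator psi lpsi -> class_T phi psi f ->
  exists F, analytic_on_disk F /\ F (RtoC 0) = RtoC 1 /\
    (forall z, in_disk z -> F z <> RtoC 0) /\
    (forall z, in_disk z -> f z = (z * F z)%C) /\
    forall z, in_disk z -> exists u0 u1 u2 v0 v1 v2,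
      schwarz_pair (Cmod z) u0 v0 /\ schwarz_pair (Cmod z) u1 v1 /\
      schwarz_pair (Cmod z) u2 v2 /\
      (z * C_derive F z / F z)%C =
      (v0 * lpsi u0 + (v1 * lphi u1 + v2 * lphi u2))%C.
Proof.
intros Gphi Gpsi [[Hf [Hf0 _]] [g [p [_ [Hp [[h1 [E1 S1]] [h2 [E2 S2]]]]]]]].
assert (Ap : analytic_on_disk p) by apply Hp.
assert (A1 : analytic_on_disk h1) by apply S1. assert (A2 : analytic_on_disk h2) by apply S2.
destruct (subordinate_generator _ _ _ Gpsi Hp) as [p0 Kp].
destruct (subordinate_generator _ _ _ Gphi S1) as [h10 K1].
destruct (subordinate_generator _ _ _ Gphi S2) as [h20 K2].
assert (D : forall z a b c, is_cderive p z a -> is_cderive h1 z b ->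
  is_cderive h2 z c -> is_cderive (fun z => p z * (h1 z * h2 z))%C z
    (a * (h1 z * h2 z) + p z * (b * h2 z + h1 z * c))%C).
{ intros z a b c Ha Hb Hc.
  apply (is_cderive_mult p (fun z => h1 z * h2 z)%C); [exact Ha|].
  apply is_cderive_mult; assumption. }
exists (fun z => p z * (h1 z * h2 z))%C. repeat apply conj.
- intros z Hz. destruct (Ap z Hz) as [a Ha]. destruct (A1 z Hz) as [b Hb].
  destruct (A2 z Hz) as [c Hc]. eexists. apply D; eassumption.
- rewrite p0, h10, h20. ring.
- intros z Hz. repeat apply Cmult_neq_0; [apply Kp|apply K1|apply K2]; exact Hz.
- intros z Hz. destruct (Ceq_dec z 0) as [->|Hz0]; [rewrite Hf0; ring|].
  destruct (K1 z Hz) as [N1 _]. destruct (K2 z Hz) as [N2 _].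
  rewrite E1 in N1 by assumption. rewrite E2 in N2 by assumption.
  (* Division by 0 would give the value 0, which a function subordinate to a generator omits. *)
  assert (Ng : g z <> RtoC 0) by (intros E; apply N1; rewrite E; apply Cdiv_0_r).
  assert (Np : (z * p z)%C <> RtoC 0)
    by (intros E; apply N2; rewrite E; apply Cdiv_0_r).
  rewrite E1, E2 by assumption. field. repeat split; try assumption.
  intros E. apply Np. rewrite E. ring.
- intros z Hz.
  destruct (Kp z Hz) as [Np [u0 [v0 [P0 [a [Ha Ea]]]]]].
  destruct (K1 z Hz) as [N1 [u1 [v1 [P1 [b [Hb Eb]]]]]].
  destruct (K2 z Hz) as [N2 [u2 [v2 [P2 [c [Hc Ec]]]]]].
  exists u0, u1, u2, v0, v1, v2. repeat (split; [assumption|]).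
  rewrite (is_C_derive_unique (fun z => p z * (h1 z * h2 z))%C _ _ (D z a b c Ha Hb Hc)).
  replace (z * (a * (h1 z * h2 z) + p z * (b * h2 z + h1 z * c)))%C with
   ((z * a) * (h1 z * h2 z) + p z * ((z * b) * h2 z + h1 z * (z * c)))%C by ring.
  rewrite Ea, Eb, Ec. field. auto.
Qed.

(** For [f = z F] the left side is [z f'/f] with its singularity at 0 filled in. *)
Definition log_derivative_in_exp (F : C -> C) (z : C) : Prop :=
  exists om, in_disk om /\ (1 + z * C_derive F z / F z)%C = Cexp om.

Lemma Cmod_lt_scale (r : R) (z : C) : 0 < r ->
  in_disk z -> Cmod (RtoC r * z) < r.
Proof.
unfold in_disk. intros Hr Hz. rewrite Cmod_mult, Cmod_R, Rabs_pos_eq by lra. nra.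
Qed.

Lemma is_cderive_dilation (r : R) (f : C -> C) (z l : C) : r <> 0 ->
  is_cderive f (RtoC r * z)%C l -> is_cderive (dilation r f) z l.
Proof.
intros Hr Hl. assert (N : RtoC r <> RtoC 0) by (intros H; apply RtoC_inj in H; auto).
apply is_derive_ext with (f := fun z => (/ RtoC r * f (RtoC r * z))%C).
{ intros x. unfold dilation, Cdiv. apply Cmult_comm. }
eapply is_cderive_eq.
- apply is_cderive_mult; [apply is_cderive_const|].
  apply (is_cderive_comp f (fun z => RtoC r * z)%C z l (RtoC r)); [exact Hl|].
  eapply is_cderive_eq; [apply is_cderive_mult;
    [apply is_cderive_const|apply is_cderive_id]|].
  cbv beta. ring.
- cbv beta. field. exact N.
Qed.

Lemma in_disk_Im (om : C) : in_disk om -> - (PI / 2) < Im om < PI / 2.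
Proof.
unfold in_disk. intros H. pose proof PI2_1.
assert (Rabs (Im om) <= Cmod om).
{ generalize (Rmax_Cmod om). intros K.
  eapply Rle_trans; [|exact K]. apply Rmax_r. }
split; [|generalize (Rle_abs (Im om)); lra].
generalize (Rle_abs (- Im om)). rewrite Rabs_Ropp. lra.
Qed.

(** The exponential is injective on the disk with analytic inverse [Clog], so subordination reduces
    to pointwise membership in the image: the Schwarz function is the logarithm of the filled
    quotient. *)
Lemma class_S_e_dilation (f F : C -> C) (r : R) :
  class_A f -> analytic_on_disk F -> F (RtoC 0) = RtoC 1 ->
  (forall z, in_disk z -> F z <> RtoC 0) ->
  (forall z, in_disk z -> f z = (z * F z)%C) -> 0 < r <= 1 ->
  class_S_e (dilation r f) <->
  forall z, Cmod z < r -> log_derivative_in_exp F z.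
Proof.
intros [Hf [Hf0 Hf1]] HF HF0 HFn HfF Hr.
assert (Nr : RtoC r <> RtoC 0) by (intros H; apply RtoC_inj in H; lra).
assert (In : forall z, in_disk z -> in_disk (RtoC r * z)).
{ intros z Hz. assert (K := Cmod_lt_scale r z (proj1 Hr) Hz).
  unfold in_disk. lra. }
assert (DF : forall z, in_disk z -> is_cderive F z (C_derive F z)).
{ intros z Hz. destruct (HF z Hz) as [l Hl]. exact (is_cderive_C_derive _ _ _ Hl). }
assert (E : forall z, in_disk z -> z <> RtoC 0 ->
  (z * C_derive (dilation r f) z / dilation r f z)%C =
  (1 + RtoC r * z * C_derive F (RtoC r * z) / F (RtoC r * z))%C).
{ intros z Hz Hz0. specialize (In z Hz).
  assert (D : is_cderive f (RtoC r * z)%C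
    (1 * F (RtoC r * z) + RtoC r * z * C_derive F (RtoC r * z))%C).
  { apply is_cderive_ext_disk with (f := fun z => (z * F z)%C); [exact In| |].
    - intros x Hx. symmetry. apply HfF, Hx.
    - apply (is_cderive_mult (fun z => z) F); [apply is_cderive_id|apply DF, In]. }
  rewrite (is_C_derive_unique (dilation r f) _ _ (is_cderive_dilation r f z _ ltac:(lra) D)).
  unfold dilation. rewrite HfF by exact In. field.
  repeat split; auto. }
split.
- intros [_ [h [Eh [_ [_ [w [_ [Hw [_ Hhw]]]]]]]]] z Hz.
  destruct (Ceq_dec z 0) as [->|Hz0].
  + exists (RtoC 0). split; [exact in_disk_0|]. rewrite Cexp_0, HF0. field.
  + set (x := (z / RtoC r)%C).
    assert (Ex : (RtoC r * x)%C = z) by (unfold x; field; exact Nr).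
    assert (Hx : in_disk x).
    { unfold in_disk, x. rewrite Cmod_div, Cmod_R, Rabs_pos_eq by (exact Nr || lra).
      apply Rmult_lt_reg_r with r; [lra|].
      unfold Rdiv. rewrite Rmult_assoc, Rinv_l; lra. }
    assert (Hx0 : x <> RtoC 0) by (intros K; apply Hz0; rewrite <- Ex, K; ring).
    exists (w x). split; [apply Hw, Hx|].
    rewrite <- Hhw, Eh, E, Ex by assumption. reflexivity.
- intros HQ. split; [split; [|split]|].
  + intros z Hz. destruct (Hf _ (In z Hz)) as [l Hl].
    eexists. apply is_cderive_dilation; [lra|exact Hl].
  + unfold dilation. rewrite Cmult_0_r, Hf0. field. exact Nr.
  + apply is_cderive_dilation; [lra|]. rewrite Cmult_0_r. exact Hf1.
  + set (h := fun z => (1 + RtoC r * z * C_derive F (RtoC r * z) / F (RtoC r * z))%C).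
    assert (Dr : forall z, is_cderive (fun z => RtoC r * z)%C z (RtoC r)).
    { intros z. eapply is_cderive_eq; [apply is_cderive_mult;
        [apply is_cderive_const|apply is_cderive_id]|]. cbv beta. ring. }
    assert (Hh : analytic_on_disk h).
    { intros z Hz. specialize (In z Hz).
      destruct (analytic_derive F HF _ In) as [l Hl].
      eexists. apply (is_cderive_plus (fun _ => RtoC 1)
        (fun z => RtoC r * z * C_derive F (RtoC r * z) / F (RtoC r * z))%C);
        [apply is_cderive_const|].
      apply (is_cderive_div (fun z => RtoC r * z * C_derive F (RtoC r * z))%C
        (fun z => F (RtoC r * z))%C).
      - apply HFn, In.
      - apply (is_cderive_mult (fun z => RtoC r * z)%C
          (fun z => C_derive F (RtoC r * z))%C); [apply Dr|].
        apply (is_cderive_comp (C_derive F) (fun z => RtoC r * z)%C);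
          [exact Hl|apply Dr].
      - apply (is_cderive_comp F (fun z => RtoC r * z)%C);
          [apply DF, In|apply Dr]. }
    assert (Hlog : forall z, in_disk z -> 0 < Re (h z) /\ in_disk (Clog (h z))).
    { intros z Hz. destruct (HQ _ (Cmod_lt_scale r z (proj1 Hr) Hz)) as [om [Hom Eom]].
      assert (B := in_disk_Im om Hom).
      unfold h. rewrite Eom. split; [|rewrite Clog_Cexp; assumption].
      simpl. apply Rmult_lt_0_compat; [apply exp_pos|apply cos_gt_0; lra]. }
    exists h. split.
    * intros z Hz Hz0. rewrite E by assumption. reflexivity.
    * split; [exact Hh|]. split; [intros z _; exists (Cexp z); apply is_cderive_Cexp|].
      exists (fun z => Clog (h z)). split; [|split; [|split]].
      -- intros z Hz. destruct (Hh z Hz) as [l Hl].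
         eexists. apply (is_cderive_comp Clog h); [apply is_cderive_Clog, Hlog, Hz|exact Hl].
      -- intros z Hz. apply Hlog, Hz.
      -- unfold h. rewrite Cmult_0_r, HF0.
         replace (1 + 0 * C_derive F 0 / 1)%C with (RtoC 1); [apply Clog_1|field].
      -- intros z Hz. symmetry. apply Cexp_Clog, Hlog, Hz.
Qed.

(** The condition concerns open disks, so the supremum of the good radii is itself good: a failure
    at [z] would make [|z|] an upper bound of them. *)
Lemma radius_exists (f F : C -> C) (r0 : R) :
  (forall r, 0 < r <= 1 -> class_S_e (dilation r f) <->
    forall z, Cmod z < r -> log_derivative_in_exp F z) ->
  0 < r0 <= 1 -> (forall z, Cmod z < r0 -> log_derivative_in_exp F z) ->
  (exists rho, is_radius_of class_S_e f rho) /\ holds_up_to class_S_e f r0.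
Proof.
intros Hiff Hr0 HQ0.
set (good := fun r => 0 < r <= 1 /\ forall z, Cmod z < r -> log_derivative_in_exp F z).
assert (G0 : good r0) by (split; assumption).
split.
- destruct (completeness good) as [rho [Hub Hlub]].
  + exists 1. intros r [Hr _]. lra.
  + exists r0. exact G0.
  + assert (Hrho : 0 < rho <= 1).
    { split; [generalize (Hub r0 G0); lra|]. apply Hlub. intros r [Hr _]. lra. }
    assert (Hex : forall z, Cmod z < rho -> log_derivative_in_exp F z).
    { intros z Hz. apply NNPP. intros Hn.
      assert (rho <= Cmod z); [|lra].
      apply Hlub. intros r [_ Hr]. apply Rnot_lt_le. intros Hlt. apply Hn, Hr, Hlt. }
    exists rho. split.
    * split; [exact Hrho|]. intros r Hr. apply Hiff; [lra|].
      intros z Hz. apply Hex. lra.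
    * intros rho' [H1 H2]. apply Hub. split; [exact H1|].
      apply Hiff; [exact H1|]. apply H2. lra.
- split; [exact Hr0|]. intros r Hr. apply Hiff; [lra|].
  intros z Hz. apply HQ0. lra.
Qed.

Lemma not_in_exp_disk (om : C) : in_disk om -> Cexp om <> RtoC (/ exp 1).
Proof.
intros Hom E. apply (f_equal Cmod) in E.
rewrite Cmod_Cexp, Cmod_R, <- exp_Ropp, Rabs_pos_eq in E by (left; apply exp_pos).
apply exp_inv in E. generalize (re_le_Cmod om). rewrite E.
rewrite Rabs_left by lra. unfold in_disk in Hom. lra.
Qed.

Definition extremal_factor (phi psi : C -> C) (z : C) : C :=
  (psi z * (phi z * phi z))%C.

Lemma is_cderive_extremal_factor (phi psi lphi lpsi : C -> C) (z : C) :
  is_generator phi lphi -> is_generator psi lpsi -> in_disk z ->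
  is_cderive (extremal_factor phi psi) z
    (extremal_factor phi psi z * (lpsi z + (lphi z + lphi z)))%C.
Proof.
intros Gphi Gpsi Hz. eapply is_cderive_eq.
- apply (is_cderive_mult psi (fun z => phi z * phi z)%C); [apply Gpsi, Hz|].
  apply is_cderive_mult; apply Gphi, Hz.
- unfold extremal_factor. ring.
Qed.

Lemma extremal_class_T (phi psi lphi lpsi : C -> C) :
  is_generator phi lphi -> is_generator psi lpsi ->
  class_T phi psi (fun z => z * extremal_factor phi psi z)%C.
Proof.
intros Gphi Gpsi.
assert (Aphi := generator_analytic _ _ Gphi).
assert (Apsi := generator_analytic _ _ Gpsi).
generalize Gphi Gpsi. intros [phi0 Hphi] [psi0 Hpsi].
assert (A : forall h : C -> C, analytic_on_disk h -> h (RtoC 0) = RtoC 1 ->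
  class_A (fun z => z * h z)%C).
{ intros h Hh h0. split; [|split].
  - intros z Hz. destruct (Hh z Hz) as [l Hl].
    eexists. apply (is_cderive_mult (fun z => z) h); [apply is_cderive_id|exact Hl].
  - ring.
  - destruct (Hh _ in_disk_0) as [l Hl]. eapply is_cderive_eq.
    + apply (is_cderive_mult (fun z => z) h); [apply is_cderive_id|exact Hl].
    + cbv beta. rewrite h0. ring. }
assert (S : forall h : C -> C, analytic_on_disk h -> subordinate h h).
{ intros h Hh. split; [exact Hh|]. split; [exact Hh|].
  exists (fun z => z). split; [intros z _; eexists; apply is_cderive_id|].
  split; [auto|]. split; auto. }
split.
- apply A.
  + intros z Hz. eexists.
    apply (is_cderive_extremal_factor phi psi lphi lpsi); assumption.
  + unfold extremal_factor. rewrite phi0, psi0. ring.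
- exists (fun z => z * (psi z * phi z))%C, psi. split; [|split; [|split]].
  + apply (A (fun z => psi z * phi z)%C).
    * intros z Hz. eexists. apply is_cderive_mult; [apply Hpsi, Hz|apply Hphi, Hz].
    * rewrite phi0, psi0. ring.
  + apply S, Apsi.
  + exists phi. split; [|apply S, Aphi].
    intros z Hz Hz0. unfold extremal_factor. field. destruct (Hphi z Hz), (Hpsi z Hz). auto.
  + exists phi. split; [|apply S, Aphi].
    intros z Hz Hz0. field. destruct (Hphi z Hz), (Hpsi z Hz). auto.
Qed.

Lemma class_T_radius (phi psi lphi lpsi : C -> C) (r0 : R) :
  is_generator phi lphi -> is_generator psi lpsi -> 0 < r0 < 1 ->
  (forall r u0 u1 u2 v0 v1 v2, 0 <= r < r0 ->
    schwarz_pair r u0 v0 -> schwarz_pair r u1 v1 -> schwarz_pair r u2 v2 ->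
    Cmod (1 + (v0 * lpsi u0 + (v1 * lphi u1 + v2 * lphi u2)) - RtoC (cosh 1))
      < sinh 1) ->
  (1 + RtoC (- r0) * (lpsi (RtoC (- r0)) + (lphi (RtoC (- r0)) + lphi (RtoC (- r0)))))%C
    = RtoC (/ exp 1) ->
  is_class_radius class_S_e (class_T phi psi) r0.
Proof.
intros Gphi Gpsi Hr0 Hbound Hext.
assert (HT := extremal_class_T _ _ _ _ Gphi Gpsi).
set (F := extremal_factor phi psi) in HT.
assert (Main : forall f, class_T phi psi f ->
  (exists rho, is_radius_of class_S_e f rho) /\ holds_up_to class_S_e f r0).
{ intros f Hf.
  destruct (class_T_factor _ _ _ _ f Gphi Gpsi Hf) as [G [AG [G0 [GN [GE GL]]]]].
  apply (radius_exists f G r0).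
  - intros r Hr. apply class_S_e_dilation; try assumption. apply Hf.
  - lra.
  - intros z Hz. destruct (GL z) as (u0 & u1 & u2 & v0 & v1 & v2 & P0 & P1 & P2 & E).
    { unfold in_disk. lra. }
    unfold log_derivative_in_exp. rewrite E.
    assert (B := Hbound (Cmod z) u0 u1 u2 v0 v1 v2
      (conj (Cmod_ge_0 z) Hz) P0 P1 P2).
    destruct (disk_in_exp_disk _ B) as [Hre Hlog].
    eexists. split; [exact Hlog|]. symmetry. apply Cexp_Clog, Hre. }
split; [intros f Hf; apply Main, Hf|]. split.
- intros rho [f [Hf [_ Hmax]]]. simpl. apply Hmax, Main, Hf.
- intros b Hb.
  destruct (Main _ HT) as [[rho Hrho] _].
  apply Rbar_le_trans with (Finite rho).
  + apply Hb. eexists. split; [exact HT|exact Hrho].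
  (* Were the radius [rho] of the extremal function larger than [r0], the point [-r0] would lie
     inside its disk, although [z f'/f] equals [1/e] there. *)
  + simpl. apply Rnot_lt_le. intros Hlt.
    destruct Hrho as [[H1 H2] _]. specialize (H2 rho ltac:(lra)).
    generalize Gphi Gpsi. intros [phi0 Hphi] [psi0 Hpsi].
    assert (K : class_S_e (dilation rho (fun z => z * F z)%C) <->
      forall z, Cmod z < rho -> log_derivative_in_exp F z).
    { apply class_S_e_dilation; try apply HT; try assumption.
      - intros z Hz. eexists.
        apply (is_cderive_extremal_factor phi psi lphi lpsi); assumption.
      - unfold F, extremal_factor. rewrite phi0, psi0. ring.
      - intros z Hz. unfold F, extremal_factor. destruct (Hphi z Hz), (Hpsi z Hz).
        repeat apply Cmult_neq_0; assumption.
      - reflexivity. }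
    rewrite K in H2.
    assert (D : in_disk (RtoC (- r0))).
    { unfold in_disk. rewrite Cmod_R, Rabs_left; lra. }
    destruct (H2 (RtoC (- r0))) as [om [Hom Eom]].
    { rewrite Cmod_R, Rabs_left; lra. }
    apply (not_in_exp_disk om Hom). rewrite <- Eom, <- Hext.
    rewrite (is_C_derive_unique F _ _
      (is_cderive_extremal_factor phi psi lphi lpsi _ Gphi Gpsi D)).
    unfold F, extremal_factor. field. destruct (Hphi _ D), (Hpsi _ D). auto.
Qed.

(** * The three classes *)

Lemma Cexp_generator : is_generator Cexp (fun _ => RtoC 1).
Proof.
split; [exact Cexp_0|]. intros u _. split; [apply Cexp_neq_0|].
rewrite Cmult_1_r. apply is_cderive_Cexp.
Qed.

Lemma re_1_plus (u : C) : Cmod u < 1 -> 0 < Re (1 + u).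
Proof.
intros Hu. generalize (re_ge_minus 1 (1 + u)).
replace (1 + u - 1)%C with u by ring. simpl Re at 1. lra.
Qed.

Lemma C_neq_0_of_re (z : C) : 0 < Re z -> z <> RtoC 0.
Proof. intros H E. rewrite E in H. simpl in H. lra. Qed.

Lemma sqrt_one_plus_generator :
  is_generator sqrt_one_plus (fun u => / (2 * (1 + u)))%C.
Proof.
split.
- unfold sqrt_one_plus. rewrite Cplus_0_r. exact Csqrt_1.
- intros u Hu. assert (P := re_1_plus u Hu).
  assert (N := Csqrt_neq_0 _ P). split; [exact N|].
  unfold sqrt_one_plus. eapply is_cderive_eq.
  + apply (is_cderive_comp Csqrt (fun u => 1 + u)%C); [apply is_cderive_Csqrt, P|].
    apply is_cderive_plus; [apply is_cderive_const|apply is_cderive_id].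
  + transitivity (Csqrt (1 + u) * / (2 * (Csqrt (1 + u) * Csqrt (1 + u))))%C;
      [field; exact N|].
    rewrite Csqrt_sqr. reflexivity.
Qed.

Lemma crescent_generator :
  is_generator crescent (fun u => / Csqrt (1 + u * u))%C.
Proof.
split.
- unfold crescent. rewrite Cmult_0_r, Cplus_0_r, Csqrt_1. ring.
- intros u Hu. assert (P := re_1_plus_sqr u Hu).
  assert (N := Csqrt_neq_0 _ P). unfold crescent. split.
  + intros E.
    assert (E1 : (u * u)%C = (1 + u * u)%C).
    { rewrite <- (Csqrt_sqr (1 + u * u)).
      replace u with (- Csqrt (1 + u * u) + (u + Csqrt (1 + u * u)))%C at 1 2 by ring.
      rewrite E. ring. }
    apply C1_nz. transitivity (1 + u * u - u * u)%C; [ring|].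
    rewrite <- E1. ring.
  + eapply is_cderive_eq.
    * apply is_cderive_plus; [apply is_cderive_id|].
      apply (is_cderive_comp Csqrt (fun u => 1 + u * u)%C); [apply is_cderive_Csqrt, P|].
      apply is_cderive_plus; [apply is_cderive_const|].
      apply is_cderive_mult; apply is_cderive_id.
    * cbv beta. field. exact N.
Qed.

(** [cosh 1 >= 3/2] needs [e >= (3 + sqrt 5) / 2], about 2.618. Squaring [1 + x < exp x] four times
    from [x = 1/16] gives about 2.638, whereas starting from 1/8 would stop below 2.57. *)
Lemma exp_1_bounds : 262 / 100 < exp 1 <= 3.
Proof.
split; [|exact exp_le_3].
assert (E : forall x, exp (2 * x) = exp x * exp x)
  by (intros x; rewrite <- exp_plus; f_equal; ring).
assert (H : 17 / 16 < exp (/ 16)) by (generalize (exp_ineq1 (/ 16) ltac:(lra)); lra).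
replace 1 with (2 * (2 * (2 * (2 * / 16)))) by field.
rewrite !E. set (x := exp (/ 16)) in *.
assert (H2 : 17 / 16 * (17 / 16) < x * x) by nra.
set (y := x * x) in *.
assert (H3 : 1274 / 1000 < y * y) by nra. set (z := y * y) in *.
assert (H4 : 162 / 100 < z * z) by nra. set (t := z * z) in *. nra.
Qed.

(** The first part puts the common center [(cosh 1 - 1) / 3] at 1/6 or more, as the crescent
    requires; the second names the leftmost point of the target disk. *)
Lemma cosh_1_sinh_1 : 3 / 2 <= cosh 1 /\ cosh 1 - sinh 1 = / exp 1.
Proof.
destruct exp_1_bounds as [H1 H2].
unfold cosh, sinh. rewrite exp_Ropp. split; [|field; lra].
assert (exp 1 * / exp 1 = 1) by (apply Rinv_r; lra).
assert (0 < / exp 1) by (apply Rinv_0_lt_compat; lra).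
nra.
Qed.

(** Centers and radii of disks add up: the sum has center [1 + c0 = cosh 1] and radius
    [c0 + d0 + d1 + d2], while [sinh 1 = c0 + 1 - 1/e]. *)
Lemma radius_bound (b0 b1 b2 : C) (c0 d0 d1 d2 : R) :
  c0 = cosh 1 - 1 ->
  Cmod (b0 - RtoC (c0 / 3)) <= c0 / 3 + d0 ->
  Cmod (b1 - RtoC (c0 / 3)) <= c0 / 3 + d1 ->
  Cmod (b2 - RtoC (c0 / 3)) <= c0 / 3 + d2 ->
  d0 + (d1 + d2) < 1 - / exp 1 ->
  Cmod (1 + (b0 + (b1 + b2)) - RtoC (cosh 1)) < sinh 1.
Proof.
intros E H0 H1 H2 H. destruct cosh_1_sinh_1 as [_ Es].
replace (1 + (b0 + (b1 + b2)) - RtoC (cosh 1))%C with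
  ((b0 - RtoC (c0 / 3)) + ((b1 - RtoC (c0 / 3)) + (b2 - RtoC (c0 / 3))))%C.
- eapply Rle_lt_trans; [apply Cmod_triangle|].
  eapply Rle_lt_trans; [apply Rplus_le_compat_l, Cmod_triangle|]. lra.
- replace (cosh 1) with (1 + (c0 / 3 + (c0 / 3 + c0 / 3))) by lra.
  rewrite !RtoC_plus. ring.
Qed.

(** Moves the summands of [e^z] and [sqrt (1 + z)] from disks around 0 to larger ones with the same
    leftmost point. *)
Lemma Cmod_shift_le (b : C) (c d : R) : 0 <= c -> Cmod b <= d ->
  Cmod (b - RtoC c) <= c + d.
Proof.
intros Hc Hb. eapply Rle_trans; [apply Cmod_triangle_minus|].
rewrite Cmod_R, Rabs_pos_eq by exact Hc. lra.
Qed.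

Lemma schwarz_pair_half_sqrt (r : R) (u v : C) : r < 1 -> schwarz_pair r u v ->
  Cmod (v * / (2 * (1 + u))) <= r / (1 - r) / 2.
Proof.
intros Hr H. assert (K := schwarz_pair_sqrt r u v Hr H). destruct H as [Hu _].
assert (N : (1 + u)%C <> RtoC 0) by (apply C_neq_0_of_re, re_1_plus; lra).
replace (v * / (2 * (1 + u)))%C with (RtoC (/ 2) * (v / (1 + u)))%C.
- rewrite Cmod_mult, Cmod_R, Rabs_pos_eq by lra. lra.
- rewrite RtoC_inv by lra. field. exact N.
Qed.

Lemma frac_increasing (r s : R) : 0 <= r < s -> s < 1 -> r / (1 - r) < s / (1 - s).
Proof.
intros H Hs. apply Rmult_lt_reg_r with ((1 - r) * (1 - s));
  [apply Rmult_lt_0_compat; lra|].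
replace (r / (1 - r) * ((1 - r) * (1 - s))) with (r * (1 - s)) by (field; lra).
replace (s / (1 - s) * ((1 - r) * (1 - s))) with (s * (1 - r)) by (field; lra).
lra.
Qed.

Lemma sqrt_between (x a b : R) : 0 <= a -> 0 <= b -> a ^ 2 <= x -> x < b ^ 2 ->
  a <= sqrt x < b.
Proof.
intros Ha Hb H1 H2.
assert (Hx : 0 <= x) by nra.
assert (E := sqrt_sqrt x Hx). pose proof (sqrt_pos x). split; nra.
Qed.

Lemma radius_T1 :
  let e := exp 1 in
  is_class_radius class_S_e class_T1
    ((- 2 + 7 * e - sqrt (4 + 4 * e + 17 * e ^ 2)) / (8 * e)).
Proof.
intros e. destruct exp_1_bounds as [He1 He2]. fold e in He1, He2.
destruct cosh_1_sinh_1 as [Hc _].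
set (D := 4 + 4 * e + 17 * e ^ 2).
(* These bounds say [0 < r0 <= 1/3], and 1/3 is below the limit [sqrt 2 - 1] of
   [schwarz_pair_exp]. *)
assert (HD : 13 * e / 3 - 2 <= sqrt D < 7 * e - 2).
{ apply sqrt_between; unfold D; nra. }
assert (ED : sqrt D * sqrt D = D) by (apply sqrt_sqrt; unfold D; nra).
set (r0 := (- 2 + 7 * e - sqrt D) / (8 * e)).
assert (Er : 8 * e * r0 = - 2 + 7 * e - sqrt D) by (unfold r0; field; lra).
assert (Hr0 : 0 < r0 <= 1 / 3) by (split; nra).
(* Without denominators this is [4 e r^2 - (7 e - 2) r + 2 (e - 1) = 0], of discriminant [D]; [r0]
   is the smaller root. *)
assert (Eq : 2 * r0 + r0 / (1 - r0) / 2 = 1 - / e).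
{ apply Rmult_eq_reg_r with (2 * e * (1 - r0)); [|nra].
  replace ((2 * r0 + r0 / (1 - r0) / 2) * (2 * e * (1 - r0))) with
    (4 * e * r0 * (1 - r0) + e * r0) by (field; lra).
  replace ((1 - / e) * (2 * e * (1 - r0))) with (2 * (e - 1) * (1 - r0))
    by (field; lra).
  assert (sqrt D = 7 * e - 2 - 8 * e * r0) by lra.
  rewrite H in ED. unfold D in ED.
  apply Rmult_eq_reg_l with (16 * e); [|nra]. nra. }
unfold class_T1.
apply (class_T_radius _ _ _ _ _ Cexp_generator sqrt_one_plus_generator); [lra| |].
- intros r u0 u1 u2 v0 v1 v2 Hr H0 H1 H2.
  apply schwarz_pair_half_sqrt in H0; [|lra].
  apply schwarz_pair_exp in H1; [|lra|nra].
  apply schwarz_pair_exp in H2; [|lra|nra].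
  rewrite !Cmult_1_r.
  apply radius_bound with (c0 := cosh 1 - 1) (d0 := r / (1 - r) / 2)
    (d1 := r) (d2 := r); [reflexivity| | | |];
    try (apply Cmod_shift_le; [lra|assumption]).
  assert (K := frac_increasing r r0 Hr ltac:(lra)). fold e. lra.
- cbv beta. replace (RtoC 1 + RtoC (- r0))%C with (RtoC (1 - r0))
    by (rewrite <- RtoC_plus; reflexivity).
  rewrite <- RtoC_mult, <- RtoC_inv by lra.
  rewrite <- !RtoC_plus, <- RtoC_mult, <- RtoC_plus. f_equal.
  fold e. replace (/ e) with (1 - (2 * r0 + r0 / (1 - r0) / 2)) by lra.
  field. lra.
Qed.

Lemma radius_T2 :
  let e := exp 1 in
  is_class_radius class_S_e class_T2
    ((- 1 + 3 * e - sqrt (1 - 2 * e + 5 * e ^ 2)) / (2 * e)).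
Proof.
intros e. destruct exp_1_bounds as [He1 He2]. fold e in He1, He2.
destruct cosh_1_sinh_1 as [Hc _].
set (D := 1 - 2 * e + 5 * e ^ 2).
assert (HD : 7 * e / 3 - 1 <= sqrt D < 3 * e - 1).
{ apply sqrt_between; unfold D; nra. }
assert (ED : sqrt D * sqrt D = D) by (apply sqrt_sqrt; unfold D; nra).
set (r0 := (- 1 + 3 * e - sqrt D) / (2 * e)).
assert (Er : 2 * e * r0 = - 1 + 3 * e - sqrt D) by (unfold r0; field; lra).
assert (Hr0 : 0 < r0 <= 1 / 3) by (split; nra).
(* Without denominators this is [e r^2 - (3 e - 1) r + (e - 1) = 0], of discriminant [D]; [r0] is
   the smaller root. *)
assert (Eq : r0 + r0 / (1 - r0) = 1 - / e).
{ apply Rmult_eq_reg_r with (e * (1 - r0)); [|nra].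
  replace ((r0 + r0 / (1 - r0)) * (e * (1 - r0))) with
    (e * r0 * (1 - r0) + e * r0) by (field; lra).
  replace ((1 - / e) * (e * (1 - r0))) with ((e - 1) * (1 - r0)) by (field; lra).
  assert (sqrt D = 3 * e - 1 - 2 * e * r0) by lra.
  rewrite H in ED. unfold D in ED.
  apply Rmult_eq_reg_l with (4 * e); [|nra]. nra. }
unfold class_T2.
apply (class_T_radius _ _ _ _ _ sqrt_one_plus_generator Cexp_generator); [lra| |].
- intros r u0 u1 u2 v0 v1 v2 Hr H0 H1 H2.
  apply schwarz_pair_half_sqrt in H1; [|lra].
  apply schwarz_pair_half_sqrt in H2; [|lra].
  apply schwarz_pair_exp in H0; [|lra|nra].
  rewrite !Cmult_1_r.
  apply radius_bound with (c0 := cosh 1 - 1) (d0 := r)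
    (d1 := r / (1 - r) / 2) (d2 := r / (1 - r) / 2); [reflexivity| | | |];
    try (apply Cmod_shift_le; [lra|assumption]).
  assert (K := frac_increasing r r0 Hr ltac:(lra)). fold e. lra.
- cbv beta. replace (RtoC 1 + RtoC (- r0))%C with (RtoC (1 - r0))
    by (rewrite <- RtoC_plus; reflexivity).
  rewrite <- RtoC_mult, <- RtoC_inv by lra.
  rewrite <- !RtoC_plus, <- RtoC_mult, <- RtoC_plus. f_equal.
  fold e. replace (/ e) with (1 - (r0 + r0 / (1 - r0))) by lra.
  field. lra.
Qed.

Lemma Csqrt_RtoC (x : R) : 0 <= x -> Csqrt (RtoC x) = RtoC (sqrt x).
Proof.
intros H. unfold Csqrt. rewrite Cmod_R, Rabs_pos_eq by exact H. simpl.
replace ((x + x) / 2) with x by field. replace ((x - x) / 2) with 0 by field.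
rewrite sqrt_0. destruct (Rle_dec 0 0); [reflexivity|lra].
Qed.

Lemma radius_T3 :
  let e := exp 1 in
  is_class_radius class_S_e class_T3
    (sqrt ((1 - 2 * e + e ^ 2) / (- 1 + 2 * e + 8 * e ^ 2))).
Proof.
intros e. destruct exp_1_bounds as [He1 He2]. fold e in He1, He2.
destruct cosh_1_sinh_1 as [Hc _].
assert (HN : 0 < 1 - 2 * e + e ^ 2) by nra.
assert (HM : 0 < - 1 + 2 * e + 8 * e ^ 2) by nra.
set (q := (1 - 2 * e + e ^ 2) / (- 1 + 2 * e + 8 * e ^ 2)).
assert (Hq : 0 < q) by (apply Rdiv_lt_0_compat; assumption).
assert (Eq : q * (- 1 + 2 * e + 8 * e ^ 2) = 1 - 2 * e + e ^ 2)
  by (unfold q; field; lra).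
set (r0 := sqrt q).
assert (Er : r0 * r0 = q) by (apply sqrt_sqrt; lra).
assert (Hr0 : 0 < r0) by (apply sqrt_lt_R0, Hq).
assert (Hr1 : r0 <= 1 / 4).
{ assert (q <= 1 / 16).
  { apply Rmult_le_reg_r with (- 1 + 2 * e + 8 * e ^ 2); [exact HM|].
    rewrite Eq. nra. }
  nra. }
(* Squared, this reads [9 e^2 r^2 = (e - 1)^2 (1 + r^2)], so [r^2] is [(e - 1)^2] over
   [9 e^2 - (e - 1)^2], and that denominator is [8 e^2 + 2 e - 1]. *)
assert (Eh : 3 * hyp_ratio r0 = 1 - / e).
{ destruct (hyp_ratio_spec r0) as [[A1 _] A3]; [lra|].
  set (m := hyp_ratio r0) in *.
  assert (E2 : (3 * e * m) ^ 2 = (e - 1) ^ 2).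
  { apply Rmult_eq_reg_r with ((1 + r0 ^ 2) * (- 1 + 2 * e + 8 * e ^ 2)); [|nra].
    replace ((3 * e * m) ^ 2 * ((1 + r0 ^ 2) * (- 1 + 2 * e + 8 * e ^ 2))) with
     (9 * e ^ 2 * (m ^ 2 * (1 + r0 ^ 2)) * (- 1 + 2 * e + 8 * e ^ 2)) by ring.
    rewrite A3. replace (r0 ^ 2) with q by (rewrite <- Er; ring).
    replace (9 * e ^ 2 * q * (- 1 + 2 * e + 8 * e ^ 2)) with
      (9 * e ^ 2 * (q * (- 1 + 2 * e + 8 * e ^ 2))) by ring.
    replace ((e - 1) ^ 2 * ((1 + q) * (- 1 + 2 * e + 8 * e ^ 2))) with
      ((e - 1) ^ 2 * ((- 1 + 2 * e + 8 * e ^ 2) + q * (- 1 + 2 * e + 8 * e ^ 2)))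
      by ring.
    rewrite Eq. ring. }
  assert (0 <= 3 * e * m) by (apply Rmult_le_pos; lra).
  assert (E3 : 3 * e * m = e - 1) by nra.
  apply Rmult_eq_reg_l with e; [|lra].
  replace (e * (3 * m)) with (3 * e * m) by ring. rewrite E3. field. lra. }
unfold class_T3.
apply (class_T_radius _ _ _ _ _ crescent_generator crescent_generator); [lra| |].
- intros r u0 u1 u2 v0 v1 v2 Hr H0 H1 H2.
  apply radius_bound with (c0 := cosh 1 - 1) (d0 := hyp_ratio r)
    (d1 := hyp_ratio r) (d2 := hyp_ratio r); [reflexivity| | | |];
    try (apply schwarz_pair_crescent; [lra|lra|assumption]).
  (* Used here only to see that [hyp_ratio] increases strictly from [r] to [r0]. *)
  assert (K := hyp_ratio_diff r r0 ltac:(lra) Hr1).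
  assert (0 < (r0 ^ 2 - r ^ 2) * (1 / (1 - r0 ^ 2) ^ 2)).
  { apply Rmult_lt_0_compat; [nra|]. apply Rdiv_lt_0_compat; [lra|].
    apply pow_lt. nra. }
  fold e. lra.
- assert (Hs : 0 < sqrt (1 + r0 ^ 2)) by (apply sqrt_lt_R0; nra).
  cbv beta. replace (RtoC 1 + RtoC (- r0) * RtoC (- r0))%C with (RtoC (1 + r0 ^ 2)).
  + rewrite Csqrt_RtoC by nra. rewrite <- RtoC_inv by lra.
    rewrite <- !RtoC_plus, <- RtoC_mult, <- RtoC_plus. f_equal.
    fold e. replace (/ e) with (1 - 3 * hyp_ratio r0) by lra.
    unfold hyp_ratio. field. lra.
  + rewrite <- RtoC_mult, <- RtoC_plus. f_equal. ring.
Qed.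

Theorem corollary3p3 :
  let e := exp 1 in
  is_class_radius class_S_e class_T1
    ((- 2 + 7 * e - sqrt (4 + 4 * e + 17 * e ^ 2)) / (8 * e)) /\
  is_class_radius class_S_e class_T2
    ((- 1 + 3 * e - sqrt (1 - 2 * e + 5 * e ^ 2)) / (2 * e)) /\
  is_class_radius class_S_e class_T3
    (sqrt ((1 - 2 * e + e ^ 2) / (- 1 + 2 * e + 8 * e ^ 2))).
Proof. exact (conj radius_T1 (conj radius_T2 radius_T3)). Qed.
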